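(* Let $K$ be a regular compact set with $K\subset[-1,1]$ and $\pm1\in K$, and let $n\in\mathbb N$. (i) Let $d\mu(x)=(1-x^2)\,d\mu_K(x)$ and $w(x)=\sqrt{1-x^2}$. Then $[W_{2,n}(\mu)]^2=2S(\mu)$ if and only if $K=\{z\in\mathbb C:(1-z^2)S_n^2(z)\in[0,1]\}$ for some polynomial $S_n$ of degree $n$. (ii) Let $d\mu(x)=(1+x)\,d\mu_K(x)$ and $w(x)=\sqrt{1+x}$. Then $[W_{2,n}(\mu)]^2=2S(\mu)$ if and only if $K=\{z\in\mathbb C:(1+z)S_n^2(z)\in[0,1]\}$ for some polynomial $S_n$ of degree $n$. (iii) Let $d\mu(x)=(1-x)\,d\mu_K(x)$ and $w(x)=\sqrt{1-x}$. Then $[W_{2,n}(\mu)]^2=2S(\mu)$ if and only if $K=\{z\in\mathbb C:(1-z)S_n^2(z)\in[0,1]\}$ for some polynomial $S_n$ of degree $n$. Moreover, in each of the three cases, if $[W_{2,n}(\mu)]^2=2S(\mu)$ and $S_n$ is the corresponding polynomial with leading coefficient $c$, then $$P_n(x;\mu)=\frac{S_n(x)}{c}=T^{(K)}_{n,w}(x).$$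
   Context: $\mu_K$ is the equilibrium measure and $\mathrm{Cap}(K)$ the logarithmic capacity of $K$; regular means regular for the Dirichlet problem. For a finite positive Borel measure $\mu$ with support $K$, write $d\mu=f\,d\mu_K+d\mu_s$ (Lebesgue decomposition) and $S(\mu)=\exp\big[\int\log f\,d\mu_K\big]$. $P_n(\cdot;\mu)$ is the monic polynomial of degree $n$ minimizing $\|P_n\|_{L_2(\mu)}$ and $W_{2,n}(\mu)=\|P_n(\cdot;\mu)\|_{L_2(\mu)}/\mathrm{Cap}(K)^n$. For a weight $w$ on $K$, $T^{(K)}_{n,w}$ is the monic polynomial of degree $n$ minimizing the sup-norm $\|wP_n\|_K$ over monic polynomials $P_n$ of degree $n$. *)

(* Defs.v *)
From HB Require Import structures.
From mathcomp Require Import all_boot all_order all_algebra.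
From mathcomp Require Import all_classical all_reals all_analysis.
From mathcomp Require Import complex.
Set Implicit Arguments. Unset Strict Implicit. Unset Printing Implicit Defensive.
Import Order.TTheory GRing.Theory Num.Theory.
Import numFieldNormedType.Exports.
Local Open Scope classical_set_scope.
Local Open Scope ring_scope.

Section Defs.
Variable R : realType.
Local Notation C := (complex R).

Definition cmod (z : C) : R := Num.sqrt (complex.Re z ^+ 2 + complex.Im z ^+ 2).

Definition cR (x : R) : C := Complex x 0.

Definition logkernel (x y : R) : \bar R :=
  if x == y then +oo%E else (- ln `|x - y|)%:E.

Definition log_energy (nu : {measure set R -> \bar R}) : \bar R :=
  (\int[nu]_x \int[nu]_y logkernel x y)%E.

Definition prob_on (K : set R) (nu : {measure set R -> \bar R}) : Prop :=
  nu setT = 1%E /\ nu (~` K) = 0%E.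

Definition robin_const (K : set R) : \bar R :=
  ereal_inf [set log_energy nu | nu in prob_on K].

(* logarithmic capacity Cap(K) = exp(-V(K))  (= 0 when V(K) = +oo) *)
Definition log_cap (K : set R) : R := fine (expeR (- robin_const K)%E).

Definition equilibrium_measure (K : set R) (muK : {measure set R -> \bar R}) :=
  prob_on K muK /\ log_energy muK = robin_const K.

Definition compl_C (K : set R) : set C :=
  [set z | ~ (complex.Im z = 0 /\ K (complex.Re z))].

Definition openC (U : set C) : Prop :=
  forall w, U w -> exists2 d : R, 0 < d & forall z, cmod (z - w) < d -> U z.

Definition circ_pt (w : C) (r t : R) : C := w + Complex (r * cos t) (r * sin t).

Definition usc_on (U : set C) (u : C -> \bar R) : Prop :=
  forall w, U w -> forall a : R, (u w < a%:E)%E ->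
    exists2 d : R, 0 < d & forall z, U z -> cmod (z - w) < d -> (u z < a%:E)%E.

Definition submean_on (U : set C) (u : C -> \bar R) : Prop :=
  forall w, U w -> exists2 rho : R, 0 < rho &
    (forall z, cmod (z - w) < rho -> U z) /\
    forall r, 0 <= r -> r < rho ->
      (u w <= ((2 * pi)^-1)%:E *
         \int[lebesgue_measure]_(t in `[0%R, (2 * pi)%R]) u (circ_pt w r t))%E.

(* subharmonic functions (Ransford, Def. 2.2.1) *)
Definition subharmonic_on (U : set C) (u : C -> \bar R) : Prop :=
  openC U /\ (forall z, U z -> (u z < +oo)%E) /\ usc_on U u /\ submean_on U u.

(* barrier at a boundary point zeta of the open set D (Ransford, Def. 4.1.4) *)
Definition has_barrier (D : set C) (zeta : C) : Prop :=
  exists N : set C, exists b : C -> \bar R,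
    [/\ openC N, N zeta,
        subharmonic_on (N `&` D) b,
        (forall z, (N `&` D) z -> (b z < 0)%E) &
        (forall e : R, 0 < e -> exists2 d : R, 0 < d &
           forall z, (N `&` D) z -> cmod (z - zeta) < d -> ((- e)%:E < b z)%E)].

(* K (compact, contained in R) is regular: every boundary point of
   C \ K (i.e. every point of K) is a regular boundary point *)
Definition regular_set (K : set R) : Prop :=
  forall x, K x -> has_barrier (compl_C K) (cR x).

Definition logE (y : R) : \bar R := if y == 0 then -oo%E else (ln y)%:E.

(* Szego function S(mu) = exp(\int log f dmu_K) for d mu = f d mu_K
   (here mu has no singular part) *)
Definition szego (muK : {measure set R -> \bar R}) (f : R -> R) : \bar R :=
  expeR (\int[muK]_x logE (f x))%E.

(* ||P||^2_{L2(mu)} for d mu = f d muK *)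
Definition L2sq (muK : {measure set R -> \bar R}) (f : R -> R) (P : {poly C})
  : \bar R := (\int[muK]_x (f x * cmod P.[cR x] ^+ 2)%:E)%E.

Definition monic_deg (n : nat) (P : {poly C}) : Prop :=
  P \is monic /\ size P = n.+1.

Definition W2n_sq (K : set R) (muK : {measure set R -> \bar R}) (f : R -> R)
  (n : nat) : \bar R :=
  (ereal_inf [set L2sq muK f P | P in monic_deg n]
    * ((log_cap K ^+ (2 * n))^-1)%:E)%E.

Definition L2_extremal (muK : {measure set R -> \bar R}) (f : R -> R) (n : nat)
  (P : {poly C}) : Prop :=
  monic_deg n P /\ forall Q, monic_deg n Q -> (L2sq muK f P <= L2sq muK f Q)%E.

Definition wsupnorm (K : set R) (w : R -> R) (P : {poly C}) : \bar R :=
  ereal_sup [set (w x * cmod P.[cR x])%:E | x in K].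

Definition wChebyshev (K : set R) (w : R -> R) (n : nat) (T : {poly C}) : Prop :=
  monic_deg n T /\ forall Q, monic_deg n Q -> (wsupnorm K w T <= wsupnorm K w Q)%E.

Definition is_inverse_image (K : set R) (q : {poly R}) (S : {poly C}) : Prop :=
  forall z : C, (exists2 x, K x & z = cR x) <->
    (let v := (map_poly cR q).[z] * S.[z] ^+ 2 in
     complex.Im v = 0 /\ 0 <= complex.Re v <= 1).

End Defs.

(* Main.v *)
(* Write V for the Robin constant of K, mu for its equilibrium measure and, for a real
   polynomial T, c(T) = |lead T| Cap(K)^(deg T).  Factoring over the complex numbers, the
   mu-mean of ln |T| is ln c(T) plus the sum over the roots z of the nonnegative numbers
   V - U(z), where U is the potential of mu; V - U(z) vanishes exactly when z lies in K.  That U = V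
   everywhere on K is where regularity enters: Frostman's argument gives U = V outside
   a set of capacity zero, and near a point with a barrier V - U is dominated by the
   barrier plus a small multiple of a discrete potential that is large on that set.

   If T >= 0 on K then the mean of T is at least 2 c(T).  Indeed, with g_s the Green function
   of the complement of [0, 4s], Chebyshev polynomials of [0, 4s] composed with T
   show that the mean of g_s(T) is at least ln (c(T) / s); integrating over s > 0 and using that
   the integral of g_s(t) is t / 2 gives the claim.  In the case of equality T <= 4 c(T)
   on K and no solution of T = b, 0 <= b <= 4 c(T), can lie off K.  With T = q |P|^2 this is the
   implication from W^2 = 2 S(mu) to K = {q S^2 in [0, 1]}.  Conversely, if K = v^-1([0, 1])
   then integrating - ln |4 v(x) (1 - v(x)) - v(y)| in both orders gives c(v) = 1/4, and
   the inequality for v and 1 - v forces the mean of v to be 1/2.  The weighted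
   Chebyshev statement comes from the inequality for T and M - T. *)
Require Import Defs.
From HB Require Import structures.
From mathcomp Require Import all_boot all_order all_algebra.
From mathcomp Require Import all_classical all_reals all_analysis measurable_realfun.
From mathcomp Require Import complex.
From mathcomp Require Import ring lra.
Set Implicit Arguments. Unset Strict Implicit. Unset Printing Implicit Defensive.
Import Order.TTheory GRing.Theory Num.Theory.
Import numFieldNormedType.Exports.
Local Open Scope classical_set_scope.
Local Open Scope ring_scope.

(** * Logarithmic kernel and potentials *)

(** Everything reduces to one real polynomial. On the line [q |P|^2] is [T = q (A^2 + B^2)], with
    [A] and [B] the real and imaginary parts of [P]; for monic [P] of degree [n], [B] has lower
    degree, so [T] has degree [2 n + deg q], leading coefficient of modulus 1 and
    [c(T) = Cap(K)^(2 n + deg q)]. The zeros of [q] are among 1 and -1, which lie in [K], so the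
    mean of [ln q] has no surplus and [S(mu) = Cap(K)^(deg q)]. Hence [W^2 = 2 S(mu)] says that the
    least mean of [T] is exactly [2 c]. The factor 2 arises because [ln (c / s)] integrates to [c]
    over [0 < s < c], against [t / 2] for the Green functions. The factor 4 is that of the interval
    [[0, 4 c]], of capacity [c]: in the case of equality nothing is left for [s > c], so the mean of
    [g_s(T)] vanishes there. In the potential theory the obstacle is that potentials may be infinite
    on the line. The kernel is therefore evaluated at height [sqrt s] above the line, where it is
    Lipschitz, and [s -> 0] is a monotone limit. *)

Section AsProb.
Variables (R : realType) (nu : {measure set R -> \bar R}).
Definition as_prob of nu setT = 1%E : set R -> \bar R := nu.
Hypothesis h : nu setT = 1%E.
HB.instance Definition _ := Measure.copy (as_prob h) nu.
HB.instance Definition _ := Measure_isProbability.Build _ R R (as_prob h) h.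
End AsProb.

Section IntegralExtra.
Context d (T : measurableType d) (R : realType).
Implicit Types (mu : {measure set T -> \bar R}) (D : set T).
Local Open Scope ereal_scope.

(* No measurability is needed: the integral is a difference of suprema over
   simple functions. *)
Lemma le_integral_nomeas mu D (f g : T -> \bar R) :
  (forall x, D x -> f x <= g x) ->
  \int[mu]_(x in D) f x <= \int[mu]_(x in D) g x.
Proof.
move=> fg.
have fg' x : (f \_ D) x <= (g \_ D) x.
  by rewrite /patch; case: ifPn => // /set_mem /fg.
rewrite /integral; apply: leeB; apply: ereal_sup_le => _ [h hf <-]; exists h => // x.
  by apply: (le_trans (hf x)); rewrite !funeposE ge_max !le_max fg' lexx orbT.
by apply: (le_trans (hf x)); rewrite !funenegE ge_max !le_max leeN2 fg' lexx orbT.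
Qed.

(** The integral of [f] may be infinite. For [c >= 0] the negative part stays below [c], so its
    integral is finite, and [f^+ + c = (f + c) + f^-] is an identity between nonnegative functions
    that is integrated term by term. For [c < 0] the function [f] itself is nonnegative. *)
Lemma integral_shift (mu : probability T R) D (f : T -> \bar R) (c : R) :
  measurable D -> mu D = 1 -> measurable_fun D f ->
  (forall x, D x -> 0 <= f x + c%:E) ->
  \int[mu]_(x in D) (f x + c%:E) = \int[mu]_(x in D) f x + c%:E.
Proof.
move=> mD muD mf fc0.
have cE (a : R) : \int[mu]_(x in D) a%:E = a%:E.
  have -> : \int[mu]_(x in D) a%:E = a%:E * mu D := integral_cst mu mD _.
  by rewrite muD mule1.
wlog c0 : c fc0 / (0 <= c)%R.
  move=> H; have [c0|c0] := leP 0%R c; first exact: H.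
  have f0 x : D x -> 0 <= f x.
    move=> Dx; have := fc0 x Dx; case: (f x) => [r| |] //=.
    by rewrite -EFinD !lee_fin => h; lra.
  have H0 : \int[mu]_(x in D) f x = \int[mu]_(x in D) (f x + c%:E) + (- c)%:E.
    have e x : f x = f x + c%:E + (- c)%:E.
      by rewrite -addeA -EFinD subrr adde0.
    rewrite (eq_integral (fun x => f x + c%:E + (- c)%:E)); last by move=> x _; exact: e.
    rewrite ge0_integralD//.
    - by rewrite cE.
    - by apply: emeasurable_funD.
    - by move=> x _; rewrite lee_fin oppr_ge0 ltW.
  by rewrite H0 -addeA -EFinD addNr adde0.
have mfp : measurable_fun D f^\+ by exact: measurable_funepos.
have mfn : measurable_fun D f^\- by exact: measurable_funeneg.
have e x : D x -> f^\+ x + c%:E = (f x + c%:E) + f^\- x.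
  move=> Dx; have := fc0 x Dx; rewrite funeposE funenegE.
  case: (f x) => [r| |] //= _.
  by rewrite -!EFin_max -!EFinD; congr EFin; rewrite !maxEle; case: ifPn; case: ifPn => *; lra.
  by rewrite max_l ?leey// max_r ?leNye// adde0.
have fnc x : D x -> f^\- x <= c%:E.
  move=> Dx; have := fc0 x Dx; rewrite funenegE.
  case: (f x) => [r| |] //=.
    by rewrite -EFinD !lee_fin => ?; rewrite -EFin_max lee_fin ge_max; apply/andP; split; lra.
  by move=> _; rewrite ge_max leNye lee_fin c0.
have : \int[mu]_(x in D) (f^\+ x + c%:E) = \int[mu]_(x in D) ((f x + c%:E) + f^\- x).
  by apply: eq_integral => x /set_mem; exact: e.
rewrite ge0_integralD// ?cE//.
rewrite ge0_integralD//; last by exact: emeasurable_funD.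
have fin : \int[mu]_(x in D) f^\- x \is a fin_num.
  rewrite ge0_fin_numE; last exact: integral_ge0.
  apply: (@le_lt_trans _ _ (\int[mu]_(x in D) c%:E)); last by rewrite cE ltry.
  exact: ge0_le_integral.
rewrite [\int[mu]_(x in D) f x]integralE => H.
by rewrite addeAC H addeK.
Qed.

End IntegralExtra.

Section LogKernel.
Variable R : realType.
Implicit Types (x y s t c : R).

(* [lk x s t] is [- log |z - t|] for [z = x + i sqrt s]. *)
Definition lk x s t : \bar R :=
  if (x - t) ^+ 2 + s == 0 then +oo%E else (- (ln ((x - t) ^+ 2 + s) / 2))%:E.

Lemma lk_logkernel x t : logkernel x t = lk x 0 t.
Proof.
rewrite /logkernel /lk addr0 sqrf_eq0 subr_eq0; case: ifPn => // xt.
congr EFin; congr (- _).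
rewrite -[in RHS]real_normK ?num_real// lnXn ?normr_gt0 ?subr_eq0//.
by rewrite -(mulr_natr (ln _)) mulfK// pnatr_eq0.
Qed.

Lemma lk_sym x s t : lk x s t = lk t s x.
Proof. by rewrite /lk -sqrrN opprB. Qed.

Lemma lk_ge x s t (M : R) : 0 <= s -> 0 < M -> (x - t) ^+ 2 + s <= M ^+ 2 ->
  ((- ln M)%:E <= lk x s t)%E.
Proof.
move=> s0 M0 h; rewrite /lk; case: ifPn => [_|n0]; first exact: leey.
rewrite lee_fin lerN2 ler_pdivrMr// mulr_natr -lnXn// ler_ln// posrE.
  by rewrite lt_neqAle eq_sym n0 addr_ge0// sqr_ge0.
by rewrite exprn_gt0.
Qed.

Lemma lk_le x s t (M : R) : 0 <= s -> 0 < M -> M ^+ 2 <= (x - t) ^+ 2 + s ->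
  (lk x s t <= (- ln M)%:E)%E.
Proof.
move=> s0 M0 h; have p : 0 < (x - t) ^+ 2 + s by rewrite (lt_le_trans _ h)// exprn_gt0.
rewrite /lk gt_eqF// lee_fin lerN2 ler_pdivlMr// mulr_natr -lnXn// ler_ln//.
by rewrite posrE exprn_gt0.
Qed.

Lemma lk_decr x s s' t : 0 <= s -> s <= s' -> (lk x s' t <= lk x s t)%E.
Proof.
move=> s0 ss'; rewrite /lk; case: ifPn => [/eqP e|n0].
  have h := sqr_ge0 (x - t).
  have -> : (x - t) ^+ 2 + s == 0 by apply/eqP; lra.
  exact: lexx.
case: ifPn => [_|n0']; first exact: leey.
have p : 0 < (x - t) ^+ 2 + s by rewrite lt_neqAle eq_sym n0' addr_ge0// sqr_ge0.
rewrite lee_fin lerN2 ler_pM2r ?invr_gt0// ler_ln ?posrE ?lerD2l//.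
by rewrite (lt_le_trans p)// lerD2l.
Qed.

Lemma measurable_lk2 (s : R) : measurable_fun setT (fun z : R * R => lk z.1 s z.2).
Proof.
have m : measurable_fun setT (fun z : R * R => (z.1 - z.2) ^+ 2 + s).
  apply: measurable_funD => //; apply: measurable_funX; exact: measurable_funB.
apply: measurable_fun_ifT => //.
- exact: measurable_fun_eqr.
- apply/measurable_EFinP; apply: measurableT_comp => //.
  apply: measurable_funM => //; exact: (measurableT_comp (@measurable_ln R)).
Qed.

Lemma measurable_lk x s : measurable_fun setT (lk x s).
Proof. exact: (measurableT_comp (measurable_lk2 s) (measurable_pair1 x)). Qed.

(* shift making the kernel nonnegative on the disc of radius 3 *)
Definition shift4 : R := ln 5.

(** Here [(x - t)^2 + s <= 16 + 9 = 25], which explains the constant [ln 5] in [shift4]. *)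
Lemma lk_shift_ge0 x s t : `|x| <= 3 -> `|t| <= 1 -> 0 <= s <= 9 ->
  (0 <= lk x s t + shift4%:E)%E.
Proof.
move=> x3 t1 /andP[s0 s9].
have : ((- shift4)%:E <= lk x s t)%E.
  apply: lk_ge => //; have : `|x - t| <= 4.
    by rewrite (le_trans (ler_normB _ _))//; lra.
  rewrite -(ler_pXn2r (n:=2)) ?nnegrE// real_normK ?num_real// => h.
  by rewrite !exprnP in h *; lra.
case: (lk x s t) => [r| |] //=; last by move=> _; exact: leey.
by rewrite -EFinD !lee_fin => h; lra.
Qed.

End LogKernel.

Section Potential.
Variables (R : realType) (K : set R).
Hypotheses (cK : compact K) (K1 : K `<=` [set x : R | -1 <= x <= 1]).
Implicit Types (mu nu : probability R R).
Local Open Scope ereal_scope.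

Lemma mK : measurable K. Proof. exact: compact_measurable. Qed.

Lemma Knorm t : K t -> (`|t| <= 1)%R.
Proof. by move=> /K1 /= h; rewrite ler_norml. Qed.

Lemma prob_onK mu : prob_on K mu -> mu K = 1.
Proof.
case=> muT muC.
have : mu (K `|` ~` K) = mu K + mu (~` K).
  by apply: measureU => //; [exact: mK|apply: measurableC; exact: mK|rewrite setICr].
by rewrite setUv muT => ->; rewrite muC adde0.
Qed.

Lemma ae_in mu (P : R -> Prop) : prob_on K mu -> (forall x, K x -> P x) -> {ae mu, forall x, P x}.
Proof.
move=> [_ h] KP; exists (~` K); split => //; first by apply: measurableC; exact: mK.
by move=> x /= nP Kx; apply: nP; exact: KP.
Qed.

Lemma integral_onK mu (f : R -> \bar R) : prob_on K mu -> measurable_fun setT f ->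
  \int[mu]_x f x = \int[mu]_(x in K) f x.
Proof.
move=> muK mf; rewrite [RHS]integral_mkcond; apply: ae_eq_integral => //.
  apply/(measurable_restrictT _ _).1; first exact: mK.
  exact: measurable_funTS.
apply: (ae_in muK) => x Kx _; rewrite patchE; case: ifPn => // /negP; case.
exact/mem_set.
Qed.

Definition pot mu (x s : R) : \bar R := \int[mu]_(t in K) lk x s t.

Lemma pot_shift mu x s : prob_on K mu -> (`|x| <= 3)%R -> (0 <= s <= 9)%R ->
  \int[mu]_(t in K) (lk x s t + (shift4 R)%:E) = pot mu x s + (shift4 R)%:E.
Proof.
move=> muK x3 s9; apply: integral_shift.
- exact: mK.
- exact: prob_onK.
- by apply: measurable_funTS; exact: measurable_lk.
- by move=> t /Knorm t1; exact: lk_shift_ge0.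
Qed.

Lemma pot_ge mu x s (c : R) : prob_on K mu -> (forall t, K t -> c%:E <= lk x s t) ->
  c%:E <= pot mu x s.
Proof.
move=> muK h; apply: (@le_trans _ _ (\int[mu]_(t in K) c%:E)).
  have -> : \int[mu]_(t in K) c%:E = c%:E * mu K := integral_cst mu mK _.
  by rewrite (prob_onK muK) mule1.
exact: le_integral_nomeas.
Qed.

Lemma pot_le mu x s (c : R) : prob_on K mu -> (forall t, K t -> lk x s t <= c%:E) ->
  pot mu x s <= c%:E.
Proof.
move=> muK h; apply: (@le_trans _ _ (\int[mu]_(t in K) c%:E)).
  exact: le_integral_nomeas.
have -> : \int[mu]_(t in K) c%:E = c%:E * mu K := integral_cst mu mK _.
by rewrite (prob_onK muK) mule1.
Qed.

Lemma pot_decr mu x s s' : (0 <= s)%R -> (s <= s')%R -> pot mu x s' <= pot mu x s.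
Proof. by move=> s0 ss'; apply: le_integral_nomeas => t _; exact: lk_decr. Qed.

Lemma lk_cvg (x t : R) :
  lk x (n.+1%:R^-1) t @[n --> \oo] --> lk x 0 t.
Proof.
rewrite /lk addr0; case: ifPn => [/eqP e|n0].
  rewrite e; under eq_fun do rewrite add0r invr_eq0 pnatr_eq0 /=.
  apply/cvgeyPge => A.
  exists (Num.trunc (expR (2 * A))) => // n /= hn.
  rewrite lee_fin lnV ?posrE// mulNr opprK ler_pdivlMr// mulrC.
  rewrite -[leLHS]expRK ler_ln ?posrE ?expR_gt0//.
  have := truncnS_gt (expR (2 * A)); move=> /ltW h; rewrite (le_trans h)// ler_nat.
  by rewrite ltnS.
have p : (0 < (x - t) ^+ 2)%R by rewrite lt_neqAle eq_sym n0 sqr_ge0.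
under eq_fun => n.
  rewrite gt_eqF; last by rewrite addr_gt0.
  over.
apply/cvg_EFin; first by near=> n.
rewrite /=.
apply: cvgN; apply: cvgMr_tmp.
apply: (@continuous_cvg _ _ _ _ _ (fun y : nat => (x - t) ^+ 2 + y.+1%:R^-1)%R (@ln R)); first exact: continuous_ln.
rewrite -[X in _ --> X]addr0; apply: cvgD; first exact: cvg_cst.
exact: cvg_harmonic.
Unshelve. all: by end_near. Qed.

(** The kernels for [s = 1 / (n + 1)] increase to the kernel on the line, so by monotone convergence
    the potential on the line is the supremum of the regularised ones. *)
Lemma pot_gt mu x (c : R) : prob_on K mu -> (`|x| <= 3)%R -> c%:E < pot mu x 0 ->
  exists2 s : R, (0 < s <= 1)%R & c%:E < pot mu x s.
Proof.
move=> muK x3 h.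
have s9 n : (0 <= (n.+1%:R^-1 : R) <= 9)%R.
  rewrite invr_ge0 ler0n/= (@le_trans _ _ 1%R)// ?invf_le1//; last by lra.
  by rewrite ler1n.
pose g n t := lk x (n.+1%:R^-1) t + (shift4 R)%:E.
have mlk s : measurable_fun K (lk x s) by apply: measurable_funTS; exact: measurable_lk.
have mg n : measurable_fun K (g n) by apply: emeasurable_funD.
have g0 n t : K t -> 0 <= g n t by move=> /Knorm t1; exact: lk_shift_ge0.
have gnd t : K t -> {homo g^~ t : n m / (n <= m)%N >-> n <= m}.
  move=> _ n m nm; rewrite /g leeD2r// lk_decr ?invr_ge0//.
  by rewrite lef_pV2 ?posrE// ler_nat ltnS.
have := cvg_monotone_convergence mK mg g0 gnd (mu := mu).
have -> : \int[mu]_(t in K) (limn (g^~ t)) = pot mu x 0 + (shift4 R)%:E.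
  rewrite -pot_shift// ?lexx ?ler0n//; apply: eq_integral => t _.
  apply/cvg_lim => //; apply: cvgeD; [|exact: lk_cvg|exact: cvg_cst].
  by rewrite fin_num_adde_defl.
move=> cv; have h' : c%:E + (shift4 R)%:E < pot mu x 0 + (shift4 R)%:E by rewrite lteD2rE.
have [[N hN]|no] := pselect (exists n, c%:E < pot mu x (n.+1%:R^-1)%R); last first.
  have : pot mu x 0 + (shift4 R)%:E <= c%:E + (shift4 R)%:E.
    apply: (cvge_to_le cv); apply: nearW => n; rewrite /g pot_shift// leeD2r//.
    by rewrite leNgt; apply/negP => h2; apply: no; exists n.
  by rewrite leNgt h'.
exists (N.+1%:R^-1)%R => //; rewrite invr_gt0 ltr0n/= invf_le1// ?ler1n//.
Qed.

(** The distance [sqrt ((x - t)^2 + s)] is at least [sqrt s], so moving [x] by [delta] multiplies it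
    by at most [1 + delta / sqrt s], and [ln (1 + e) <= e]. *)
Lemma lk_lip (x x' s t : R) : (0 < s)%R ->
  lk x s t - (`|x - x'| / Num.sqrt s)%:E <= lk x' s t.
Proof.
move=> s0; have p y : (0 < (y - t) ^+ 2 + s)%R by rewrite ltr_wpDl// sqr_ge0.
rewrite /lk !gt_eqF// -EFinB lee_fin.
set q := Num.sqrt s; have q0 : (0 < q)%R by rewrite sqrtr_gt0.
have sq : s = (q ^+ 2)%R by rewrite sqr_sqrtr// ltW.
set e := (`|x - x'| / q)%R; have e0 : (0 <= e)%R by rewrite divr_ge0// ltW.
suff h : ((x' - t) ^+ 2 + s <= (1 + e) ^+ 2 * ((x - t) ^+ 2 + s))%R.
  have : (ln ((x' - t) ^+ 2 + s) <= ln ((1 + e) ^+ 2 * ((x - t) ^+ 2 + s)))%R.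
    by rewrite ler_ln ?posrE// mulr_gt0// exprn_gt0//; lra.
  rewrite lnM ?posrE// ?exprn_gt0//; last by lra.
  rewrite lnXn; last by lra.
  have : (ln (1 + e) <= e)%R by apply: le_ln1Dx; lra.
  rewrite -mulr_natr; lra.
have hx : (`|x' - t| <= `|x - t| + e * q)%R.
  rewrite /e divfK ?gt_eqF//.
  have -> : (x' - t = (x - t) - (x - x'))%R by ring.
  exact: ler_normB.
have h2 : ((x' - t) ^+ 2 <= (`|x - t| + e * q) ^+ 2)%R.
  rewrite -(real_normK (num_real (x' - t))) ler_pXn2r ?nnegrE//.
  by rewrite addr_ge0// mulr_ge0// ltW.
have e2 : ((x - t) ^+ 2 = `|x - t| ^+ 2)%R by rewrite real_normK// num_real.
rewrite sq e2; apply: (le_trans (lerD h2 (lexx _))).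
have n0 : (0 <= `|x - t|)%R by [].
move: (`|x - t|)%R n0 => n n0.
have : (0 <= e * (n - q) ^+ 2)%R by rewrite mulr_ge0// sqr_ge0.
have : (0 <= e ^+ 2 * n ^+ 2)%R by rewrite mulr_ge0// sqr_ge0.
have : (0 <= e * n ^+ 2)%R by rewrite mulr_ge0// sqr_ge0.
have : (0 <= e * q ^+ 2)%R by rewrite mulr_ge0// sqr_ge0.
nra.
Qed.

Lemma pot_lip mu (x x' s : R) : prob_on K mu -> (`|x| <= 3)%R -> (`|x'| <= 3)%R ->
  (0 < s <= 9)%R -> pot mu x s <= pot mu x' s + (`|x - x'| / Num.sqrt s)%:E.
Proof.
move=> muK x3 x3' /andP[s0 s9].
have s09 : (0 <= s <= 9)%R by rewrite ltW.
set e := (`|x - x'| / Num.sqrt s)%R.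
have e0 : (0 <= e)%R by rewrite divr_ge0// sqrtr_ge0.
have mlk y : measurable_fun K (lk y s) by apply: measurable_funTS; exact: measurable_lk.
have h t : K t -> lk x s t + (shift4 R)%:E <= lk x' s t + (shift4 R + e)%:E.
  move=> Kt; rewrite EFinD (addeC (shift4 R)%:E) addeA leeD2r// -leeBlDr//.
  exact: lk_lip.
have := @le_integral_nomeas _ _ _ mu K _ _ h.
rewrite pot_shift// integral_shift//.
- by rewrite EFinD (addeC (shift4 R)%:E) addeA leeD2rE.
- exact: mK.
- exact: prob_onK.
- move=> t Kt; apply: le_trans (h _ Kt).
  exact: (lk_shift_ge0 x3 (Knorm Kt)).
Qed.

(** Joint lower semicontinuity in position and height: the strict bound holds at some [s > 0] by
    [pot_gt], spreads to nearby [x'] by the Lipschitz bound, and descends to every height below [s]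
    by monotonicity. *)
Lemma pot_lsc mu (x c : R) : prob_on K mu -> (`|x| < 3)%R -> c%:E < pot mu x 0 ->
  exists2 d : R, (0 < d)%R & forall x' s', (`|x - x'| < d)%R -> (0 <= s' <= d)%R ->
    c%:E < pot mu x' s'.
Proof.
move=> muK x3 h; have [s /andP[s0 s1] hs] := pot_gt muK (ltW x3) h.
have q0 : (0 < Num.sqrt s)%R by rewrite sqrtr_gt0.
have hub : pot mu x s <= (- ln (Num.sqrt s))%:E.
  apply: pot_le => // t Kt; apply: lk_le => //; first exact: ltW.
  by rewrite (sqr_sqrtr (ltW s0)) lerDr sqr_ge0.
have [r re] : exists r, pot mu x s = r%:E.
  move: hs hub; case: (pot mu x s) => [r| |]//; first by exists r.
rewrite re lte_fin in hs.
set e := (r - c)%R; have e0 : (0 < e)%R by rewrite subr_gt0.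
set d := (Num.min s (Num.min (Num.sqrt s * e / 2) ((3 - `|x|) / 2)))%R.
have dp : (0 < d)%R.
  rewrite /d !lt_min s0/=; apply/andP; split; first by rewrite divr_gt0// mulr_gt0.
  by rewrite divr_gt0// subr_gt0.
exists d => // x' s' xx' /andP[s'0 s'd].
have [d1 [d2 d3]] : (d <= s /\ (d <= Num.sqrt s * e / 2 /\ d <= (3 - `|x|) / 2))%R.
  by rewrite /d !ge_min !lexx !orbT.
have x3' : (`|x'| <= 3)%R.
  have -> : (x' = x - (x - x'))%R by ring.
  by rewrite (le_trans (ler_normB _ _))//; lra.
apply: (@lt_le_trans _ _ (pot mu x' s)); last by apply: pot_decr => //; lra.
have : pot mu x s <= pot mu x' s + (`|x - x'| / Num.sqrt s)%:E.
  by apply: pot_lip => //; [exact: ltW|lra].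
rewrite re => hl.
have : (`|x - x'| / Num.sqrt s < e)%R.
  by rewrite ltr_pdivrMr// mulrC; nra.
move=> hh; move: hl; case: (pot mu x' s) => [r'| |]//; last by move=> _; exact: ltry.
by rewrite -EFinD !lee_fin lte_fin /e in hh *; lra.
Qed.

End Potential.

(** * Energy and first variation *)

Section Energy.
Variables (R : realType) (K : set R).
Hypotheses (cK : compact K) (K1 : K `<=` [set x : R | -1 <= x <= 1]).
Implicit Types (mu nu : probability R R).
Local Open Scope ereal_scope.

(* Shifting the kernel makes every energy integral on [K] nonnegative, so that
   Tonelli applies without integrability conditions. *)
Definition nonneg_kernel (z : R * R) : \bar R := maxe 0 (lk z.1 0 z.2 + (shift4 R)%:E).
Local Notation kn := nonneg_kernel.

Lemma kn_ge0 z : 0 <= kn z. Proof. by rewrite /kn le_max lexx. Qed.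

Lemma measurable_kn : measurable_fun setT kn.
Proof.
apply: measurable_maxe => //; apply: emeasurable_funD => //.
exact: measurable_lk2.
Qed.

Lemma measurable_kn1 x : measurable_fun setT (fun y => kn (x, y)).
Proof. exact: (measurableT_comp measurable_kn (measurable_pair1 x)). Qed.

Lemma kn_sym x y : kn (x, y) = kn (y, x).
Proof. by rewrite /kn/= lk_sym. Qed.

Definition energy mu nu := \int[mu]_x \int[nu]_y kn (x, y).

Lemma measurable_potkn nu : measurable_fun setT (fun x => \int[nu]_y kn (x, y)).
Proof. exact: (measurable_fun_fubini_tonelli_F kn measurable_kn kn_ge0). Qed.

Lemma potkn_ge0 nu x : 0 <= \int[nu]_y kn (x, y).
Proof. by apply: integral_ge0 => *; exact: kn_ge0. Qed.

Lemma energy_sym mu nu : energy mu nu = energy nu mu.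
Proof.
rewrite /energy (fubini_tonelli kn measurable_kn kn_ge0).
by apply: eq_integral => y _; apply: eq_integral => x _; exact: kn_sym.
Qed.

Lemma potkn_pot nu x : prob_on K nu -> (`|x| <= 3)%R ->
  \int[nu]_y kn (x, y) = pot K nu x 0 + (shift4 R)%:E.
Proof.
move=> nuK x3; rewrite (integral_onK cK nuK); last exact: measurable_kn1.
rewrite -pot_shift// ?lexx ?ler0n//; apply: eq_integral => y /set_mem /(Knorm K1) y1.
by rewrite /kn/= max_r// lk_shift_ge0// lexx/= ler0n.
Qed.

Lemma measurable_pot_out nu : measurable_fun setT (fun x => \int[nu]_y lk x 0 y).
Proof.
have -> : (fun x => \int[nu]_y lk x 0 y) =
  (fun x => \int[nu]_y ((fun z : R * R => lk z.1 0 z.2)^\+ (x, y))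
          - \int[nu]_y ((fun z : R * R => lk z.1 0 z.2)^\- (x, y))).
  apply/funext => x; rewrite integralE; congr (_ - _).
    by apply: eq_integral => y _; rewrite !funeposE.
  by apply: eq_integral => y _; rewrite !funenegE.
have m := @measurable_lk2 R 0.
apply: emeasurable_funB.
  apply: (measurable_fun_fubini_tonelli_F _ (measurable_funepos m)).
  by move=> z; exact: funepos_ge0.
apply: (measurable_fun_fubini_tonelli_F _ (measurable_funeneg m)).
by move=> z; exact: funeneg_ge0.
Qed.

(** On [K] the truncation at 0 in the kernel is inactive, so both energies have the same minimisers
    and differ by a constant. *)
Lemma log_energyE nu : prob_on K nu ->
  log_energy nu + (shift4 R)%:E = energy nu nu.
Proof.
move=> nuK.
have mpot := measurable_pot_out nu.
have potE x : \int[nu]_y lk x 0 y = pot K nu x 0.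
  by apply: integral_onK => //; exact: measurable_lk.
have -> : log_energy nu = \int[nu]_x \int[nu]_y lk x 0 y.
  by apply: eq_integral => x _; apply: eq_integral => y _; rewrite lk_logkernel.
rewrite (integral_onK cK nuK mpot) -integral_shift//.
- rewrite [RHS](integral_onK cK nuK (measurable_potkn nu)).
  apply: eq_integral => x /set_mem /(Knorm K1) x1.
  by rewrite potkn_pot ?potE//; lra.
- exact: mK.
- exact: prob_onK.
- exact: measurable_funTS.
- move=> x /(Knorm K1) x1; rewrite potE -potkn_pot//; last by lra.
  exact: potkn_ge0.
Qed.

Section mixture.
Variables (mu nu : probability R R) (a b : {nonneg R}).
Hypothesis ab : (a%:num + b%:num = 1)%R.

Lemma mixtureT : measure_add (mscale a mu) (mscale b nu) setT = 1.
Proof.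
transitivity (a%:num%:E * mu setT + b%:num%:E * nu setT); first exact: measure_addE.
by rewrite (probability_setT mu) (probability_setT nu) !mule1 -EFinD ab.
Qed.

Definition mixture : probability R R := as_prob mixtureT.

Lemma mixture_prob_on : prob_on K mu -> prob_on K nu -> prob_on K mixture.
Proof.
move=> [_ muC] [_ nuC]; split; first exact: mixtureT.
transitivity (a%:num%:E * mu (~` K) + b%:num%:E * nu (~` K)); first exact: measure_addE.
by rewrite muC nuC !mule0 adde0.
Qed.

Lemma integral_mixture (f : R -> \bar R) : (forall x, 0 <= f x) -> measurable_fun setT f ->
  \int[mixture]_x f x = a%:num%:E * \int[mu]_x f x + b%:num%:E * \int[nu]_x f x.
Proof.
move=> f0 mf.
have -> : \int[mixture]_x f x = \int[measure_add (mscale a mu) (mscale b nu)]_x f x by [].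
by rewrite ge0_integral_measure_add// !ge0_integral_mscale.
Qed.

End mixture.

Lemma energy_mixture mu nu (a b : {nonneg R}) (ab : (a%:num + b%:num = 1)%R) :
  energy (mixture mu nu ab) (mixture mu nu ab) =
  (a%:num ^+ 2)%:E * energy mu mu + (2 * a%:num * b%:num)%:E * energy mu nu
  + (b%:num ^+ 2)%:E * energy nu nu.
Proof.
rewrite {1}/energy.
under eq_integral => x _.
  rewrite integral_mixture; [|by move=> *; exact: kn_ge0|exact: measurable_kn1].
  over.
have h1 (p : probability R R) x : 0 <= \int[p]_y kn (x, y) by exact: potkn_ge0.
have m1 (p : probability R R) : measurable_fun setT (fun x => \int[p]_y kn (x, y)) by exact: measurable_potkn.
have e (p : probability R R) : \int[p]_x (a%:num%:E * \int[mu]_y kn (x, y) + b%:num%:E * \int[nu]_y kn (x, y)) =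
   a%:num%:E * energy p mu + b%:num%:E * energy p nu.
  rewrite ge0_integralD//.
  - by rewrite !ge0_integralZl_EFin.
  - by move=> x _; rewrite mule_ge0.
  - exact: measurable_funeM.
  - by move=> x _; rewrite mule_ge0.
  - exact: measurable_funeM.
rewrite integral_mixture; last 2 first.
- by move=> x; rewrite adde_ge0// mule_ge0.
- by apply: emeasurable_funD; exact: measurable_funeM.
rewrite !e (energy_sym nu mu).
have E0 (p q : probability R R) : 0 <= energy p q by apply: integral_ge0 => x _; exact: h1.
have := E0 mu mu; have := E0 mu nu; have := E0 nu nu.
move: (energy mu mu) (energy mu nu) (energy nu nu) => I J L L0 J0 I0.
rewrite !ge0_muleDr ?mule_ge0// !muleA -!EFinM -!addeA; congr (_ + _).
rewrite !addeA -ge0_muleDl ?lee_fin ?mulr_ge0//; congr (_ * _ + _ * _).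
by rewrite -EFinD; congr EFin; ring.
Qed.

(* First variation of the energy at its minimum. *)
Lemma cross_energy_ge mu nu :
  (forall p : probability R R, prob_on K p -> energy mu mu <= energy p p) ->
  prob_on K mu -> prob_on K nu -> energy mu mu < +oo -> energy nu nu < +oo ->
  energy mu mu <= energy mu nu.
Proof.
move=> mumin muK nuK Ioo Loo.
have E0 (p q : probability R R) : 0 <= energy p q.
  by apply: integral_ge0 => x _; exact: potkn_ge0.
rewrite leNgt; apply/negP => JI.
have [I Ie] : exists I : R, energy mu mu = I%:E.
  by exists (fine (energy mu mu)); rewrite fineK// ge0_fin_numE.
have [L Le] : exists L : R, energy nu nu = L%:E.
  by exists (fine (energy nu nu)); rewrite fineK// ge0_fin_numE.
have [J Je] : exists J : R, energy mu nu = J%:E.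
  by exists (fine (energy mu nu)); rewrite fineK// ge0_fin_numE// (lt_trans JI).
move: JI; rewrite Ie Je lte_fin => JI.
set d := (I - J)%R; have d0 : (0 < d)%R by rewrite subr_gt0.
(* Weight [s] on [nu] changes the energy by [- 2 s d + s^2 (I - 2 J + L)]. With [s = d / A] the
   quadratic term is at most [s d], and the summand [d] in [A] ensures [s <= 1]. *)
set A := (`|I - 2 * J + L| + 1 + d)%R.
have A0 : (0 < A)%R by rewrite /A ltr_wpDl// addr_ge0.
have dA : (d <= A)%R by rewrite /A lerDr addr_ge0.
pose s := (d / A)%R.
have s0 : (0 < s)%R by rewrite divr_gt0.
have s1 : (s <= 1)%R by rewrite ler_pdivrMr// mul1r.
have s1' : (0 <= 1 - s)%R by rewrite subr_ge0.
have ab : ((NngNum s1')%:num + (NngNum (ltW s0))%:num = 1)%R by rewrite /= subrK.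
have := mumin _ (mixture_prob_on ab muK nuK).
rewrite energy_mixture/= Ie Je Le -!EFinM -!EFinD lee_fin.
have sA : (s * A = d)%R by rewrite /s divfK// gt_eqF.
have h : (s * (I - 2 * J + L) <= d)%R.
  rewrite -sA ler_pM2l//; apply: (le_trans (ler_norm _)).
  by rewrite /A; lra.
have h' : (s * (s * (I - 2 * J + L)) <= s * d)%R by rewrite ler_pM2l.
have : (0 < s * d)%R by rewrite mulr_gt0.
rewrite /d in h h' *; lra.
Qed.

End Energy.

(** * Frostman inequality *)

Lemma ln_le_tangent (R : realType) (a m : R) : 0 < a -> 0 < m -> ln a <= ln m + (a / m - 1).
Proof.
move=> a0 m0; have h : 0 < a / m by rewrite divr_gt0.
have := @le_ln1Dx R (a / m - 1).
have -> : 1 + (a / m - 1) = a / m by ring.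
rewrite ln_div ?posrE// => H; have := H _; lra.
Qed.

Lemma ln_concave (R : realType) (l a b : R) : 0 <= l <= 1 -> 0 < a -> 0 < b ->
  l * ln a + (1 - l) * ln b <= ln (l * a + (1 - l) * b).
Proof.
move=> /andP[l0 l1] a0 b0; set m := l * a + (1 - l) * b.
have m0 : 0 < m.
  rewrite /m; have [->|ln0] := eqVneq l 0; first by rewrite mul0r subr0 mul1r add0r.
  by rewrite ltr_pwDl ?mulr_gt0 ?mulr_ge0 ?subr_ge0// ?ltW// lt_neqAle eq_sym ln0.
have ha := ln_le_tangent a0 m0; have hb := ln_le_tangent b0 m0.
have e : l * (a / m) + (1 - l) * (b / m) = 1.
  by rewrite !mulrA -mulrDl divff// gt_eqF.
have l1' : 0 <= 1 - l by rewrite subr_ge0.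
have := ler_wpM2l l0 ha; have := ler_wpM2l l1' hb; nra.
Qed.

Lemma ln_prod (R : realType) (I : Type) (r : seq I) (f : I -> R) : (forall i, 0 < f i) ->
  ln (\prod_(i <- r) f i) = \sum_(i <- r) ln (f i).
Proof.
move=> f0; elim: r => [|i r IH]; first by rewrite !big_nil ln1.
by rewrite !big_cons lnM ?posrE ?prodr_gt0// IH.
Qed.

(** The infimum of the points of [P] works: the complement of [P] being open, the infimum cannot lie
    in it. *)
Lemma first_hit (R : realType) (P : R -> Prop) (x0 y0 : R) : x0 <= y0 -> P y0 ->
  (forall y, x0 <= y <= y0 -> ~ P y ->
     exists2 d, 0 < d & forall z, `|y - z| < d -> ~ P z) ->
  exists b, [/\ x0 <= b <= y0, P b & forall y, x0 <= y < b -> ~ P y].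
Proof.
move=> xy Py op.
pose S := [set y | x0 <= y <= y0 /\ P y].
have S0 : S y0 by split => //; rewrite xy lexx.
have hS : has_inf S by split; [exists y0|exists x0 => y [/andP[]]].
set b := inf S.
have xb : x0 <= b by apply: lb_le_inf; [exists y0|move=> y [/andP[]]].
have by0 : b <= y0 by apply: ge_inf => //; exact: hS.2.
have lt y : x0 <= y < b -> ~ P y.
  move=> /andP[xy' yb] Py'; move: (yb); rewrite ltNge => /negP; apply.
  apply: ge_inf; first exact: hS.2.
  by split => //; rewrite xy'/= (ltW (lt_le_trans yb by0)).
exists b; split => //; first by rewrite xb.
apply: contrapT => nP; have [|d d0 hd] := op b _ nP; first by rewrite xb.
have [y [/andP[xy' yy0] Py'] ybd] := inf_adherent d0 hS.
have bley : b <= y by apply: ge_inf; [exact: hS.2|split => //; rewrite xy'].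
apply: (hd y) => //; rewrite distrC ger0_norm ?subr_ge0//.
by rewrite ltrBlDl.
Qed.

Lemma probU (R : realType) (mu : probability R R) (A B : set R) :
  measurable A -> measurable B -> A `&` B = set0 ->
  (mu (A `|` B) = mu A + mu B)%E.
Proof. by move=> mA mB AB; exact: measureU. Qed.

Section Frostman.
Variables (R : realType) (K : set R).
Hypotheses (cK : compact K) (K1 : K `<=` [set x : R | -1 <= x <= 1]).
Variables (mu : probability R R) (I : R).
Hypotheses (muK : prob_on K mu).
Hypothesis mumin : forall p : probability R R, prob_on K p -> (energy mu mu <= energy p p)%E.
Hypothesis muI : energy mu mu = I%:E.
Local Open Scope ereal_scope.
Local Notation kn := (@nonneg_kernel R).
Let g x := \int[mu]_y kn (x, y).

Let mg : measurable_fun setT g. Proof. exact: measurable_potkn. Qed.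
Let g0 x : 0 <= g x. Proof. exact: potkn_ge0. Qed.

(** Otherwise the normalised restriction of [mu] to this set has finite energy, its density being
    bounded, while its cross energy with [mu] is at most [c < I], against the first variation. *)
Lemma null_low (c : R) : (c < I)%R -> mu (K `&` [set x | g x <= c%:E]) = 0.
Proof.
move=> cI; set A := K `&` _.
have mA : measurable A.
  by apply: measurableI; [exact: mK|rewrite -[X in measurable X]setTI; exact: emeasurable_fun_infty_c].
apply: contrapT => muA.
have A1 : mu A <= 1 by exact: probability_le1.
have [a ae] : exists a : R, mu A = a%:E.
  exists (fine (mu A)); rewrite fineK// ge0_fin_numE; last exact: measure_ge0.
  exact: (le_lt_trans A1 (ltry _)).
have a0 : (0 < a)%R.
  rewrite lt_neqAle -lee_fin -ae measure_ge0 andbT; apply/eqP => a0.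
  by apply: muA; rewrite ae -a0.
have ai0 : (0 <= a^-1)%R by rewrite invr_ge0 ltW.
pose k := NngNum ai0.
pose nu0 : {measure set R -> \bar R} := mscale k (mrestr mu mA).
have nuE B : nu0 B = (a^-1)%:E * mu (B `&` A) by [].
have nuT : nu0 setT = 1.
  by rewrite nuE setTI ae -EFinM mulVf// gt_eqF.
pose nu : probability R R := as_prob nuT.
have nuK : prob_on K nu.
  split => //; transitivity (nu0 (~` K)) => //; rewrite nuE.
  have -> : ~` K `&` A = set0 by apply/seteqP; split => // x [nK [Kx _]].
  by rewrite measure0 mule0.
have nule S : measurable S -> nu S <= mscale k mu S.
  move=> mS; have -> : nu S = nu0 S by []. rewrite nuE /mscale/= lee_wpmul2l ?lee_fin//.
  by apply: le_measure; rewrite ?inE//; exact: measurableI.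
have Loo : energy nu nu < +oo.
  apply: (@le_lt_trans _ _ (\int[nu]_x ((a^-1)%:E * g x))).
    apply: ge0_le_integral => //.
    - by move=> x _; exact: potkn_ge0.
    - exact: measurable_potkn.
    - exact: measurable_funeM.
    - move=> x _; rewrite /g -(ge0_integral_mscale mu measurableT k).
      + apply: ge0_le_measure_integral => //; first by move=> *; exact: kn_ge0.
        exact: measurable_kn1.
      + exact: measurable_kn1.
      + by move=> *; exact: kn_ge0.
  apply: (@le_lt_trans _ _ (\int[mscale k mu]_x ((a^-1)%:E * g x))).
    apply: ge0_le_measure_integral => //.
    - by move=> x; rewrite mule_ge0.
    - exact: measurable_funeM.
  rewrite ge0_integral_mscale//; last 2 first.
  - exact: measurable_funeM.
  - by move=> x _; rewrite mule_ge0.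
  rewrite ge0_integralZl_EFin//.
  have -> : \int[mu]_x g x = I%:E by [].
  by rewrite -!EFinM ltry.
have := cross_energy_ge mumin muK nuK; rewrite muI ltry => /(_ erefl Loo).
rewrite energy_sym /energy.
have nuA : nu (~` A) = 0.
  transitivity (nu0 (~` A)) => //; rewrite nuE.
  by rewrite setICl measure0 mule0.
have : \int[nu]_x \int[mu]_y kn (x, y) <= c%:E.
  rewrite (ge0_negligible_integral (measurableC mA) measurableT _ _ nuA)//; last by move=> x _; exact: potkn_ge0.
  apply: (@le_trans _ _ (\int[nu]_(x in setT `\` ~` A) c%:E)).
    by apply: le_integral_nomeas => x [_ /contrapT [_]].
  have e : setT `\` ~` A = A by rewrite setTD setCK.
  rewrite e; have -> : \int[nu]_(x in A) c%:E = c%:E * nu A := integral_cst nu mA _.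
  have -> : nu A = nu0 A by []. rewrite nuE setIid ae.
  by have -> : (a^-1)%:E * a%:E = 1%:E; [rewrite -EFinM mulVf// gt_eqF|rewrite mule1].
move=> h1 h2; have := le_trans h2 h1; rewrite lee_fin leNgt.
by rewrite cI.
Qed.

(** The mean of [g] is [I] and, by [null_low], [g > I - e] almost everywhere. An excess [d] on a set
    of mass [p] then forces [d p <= e] for every [e > 0]. *)
Lemma null_high (d : R) : (0 < d)%R -> mu (K `&` [set x | (I + d)%:E < g x]) = 0.
Proof.
move=> d0; set G := K `&` _.
have mG : measurable G.
  by apply: measurableI; [exact: mK|rewrite -[X in measurable X]setTI; exact: emeasurable_fun_o_infty].
have G1 : mu G <= 1 by exact: probability_le1.
have [p pe] : exists p : R, mu G = p%:E.
  exists (fine (mu G)); rewrite fineK// ge0_fin_numE; last exact: measure_ge0.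
  exact: (le_lt_trans G1 (ltry _)).
have p0 : (0 <= p)%R by rewrite -lee_fin -pe measure_ge0.
have p1 : (p <= 1)%R by rewrite -lee_fin -pe.
have key e : (0 < e)%R -> (d * p <= e)%R.
  move=> e0; set c := (I - e)%R.
  set N := K `&` [set x | g x <= c%:E].
  have mN : measurable N.
    by apply: measurableI; [exact: mK|rewrite -[X in measurable X]setTI; exact: emeasurable_fun_infty_c].
  have N0 : mu N = 0 by apply: null_low; rewrite /c; lra.
  pose H := (K `\` N) `\` G.
  have mH : measurable H by apply: measurableD => //; apply: measurableD => //; exact: mK.
  have GN : G `&` N = set0.
    apply/seteqP; split => // x [[_ /= h1] [_ /= h2]].
    have := lt_le_trans h1 h2; rewrite lte_fin /c; lra.
  have KN : K `\` N = G `|` H.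
    apply/seteqP; split => x.
      move=> xKN; have [xG|nxG] := pselect (G x); [by left|by right].
    case=> [xG|[]//]; split; first exact: xG.1.
    by move=> xN; have : (G `&` N) x by []; rewrite GN.
  have muKN : mu (K `\` N) = 1.
    have <- : mu K = 1 by exact: prob_onK.
    have := probU mu (measurableD (mK cK) mN) mN.
    have -> : (K `\` N) `|` N = K.
      apply/seteqP; split => x; first by case=> [[]//|[]].
      by move=> Kx; have [xN|xN] := pselect (N x); [right|left].
    have -> : (K `\` N) `&` N = set0 by apply/seteqP; split => // x [[_ h] h'].
    have e2 : mu (K `\` N) + mu N = mu (K `\` N) by rewrite N0 adde0.
    by move=> /(_ erefl) ->; exact/esym/e2.
  have muH : mu H = (1 - p)%:E.
    have := probU mu mG mH.
    rewrite -KN muKN pe => h; have : G `&` H = set0 by rewrite setDIK.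
    move=> /h; case: (mu H) => [r| |]//; rewrite -EFinD => -[->]; congr EFin; ring.
  have : I%:E >= (I + d)%:E * p%:E + c%:E * (1 - p)%:E.
    rewrite -muI /energy (integral_onK cK muK mg).
    rewrite (ge0_negligible_integral mN (mK cK) _ _ N0)//; last by apply: measurable_funTS.
    rewrite KN ge0_integral_setU//; last 2 first.
    - by apply: measurable_funTS.
    - by apply/disj_setPS; rewrite setDIK.
    apply: leeD.
    - rewrite -pe -(integral_cst mu mG); apply: le_integral_nomeas => x [_ /=]; exact: ltW.
    - rewrite -muH -(integral_cst mu mH); apply: le_integral_nomeas => x [[Kx nN] _].
      rewrite /cst leNgt; apply/negP => h; apply: nN; split => //=; exact: ltW.
  rewrite -!EFinM -EFinD lee_fin /c; nra.
rewrite pe; congr EFin; apply: le_anti; rewrite p0 andbT.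
rewrite leNgt; apply/negP => pp.
have dp : (0 < d * p)%R by rewrite mulr_gt0.
have := key (d * p / 2)%R; rewrite divr_gt0// => /(_ erefl); lra.
Qed.

End Frostman.

Section FrostmanUpper.
Variables (R : realType) (K : set R).
Hypotheses (cK : compact K) (K1 : K `<=` [set x : R | -1 <= x <= 1]).
Variables (mu : probability R R) (I : R).
Hypotheses (muK : prob_on K mu).
Hypothesis mumin : forall p : probability R R, prob_on K p -> (energy mu mu <= energy p p)%E.
Hypothesis muI : energy mu mu = I%:E.
Local Open Scope ereal_scope.

(** For [t] outside []a, b[] the function [- ln |x - t|] is convex on the gap, and almost every [t]
    is of this kind. An endpoint equal to [t] makes the right side infinite. *)
Lemma pot_gap_convex (a b x : R) : (a < x < b)%R -> mu (K `&` `]a, b[%classic) = 0 ->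
  (`|a| <= 3)%R -> (`|b| <= 3)%R ->
  pot K mu x 0 + (shift4 R)%:E <=
    ((b - x) / (b - a))%:E * (pot K mu a 0 + (shift4 R)%:E) +
    ((x - a) / (b - a))%:E * (pot K mu b 0 + (shift4 R)%:E).
Proof.
move=> /andP[ax xb] N0 a3 b3.
set N := K `&` _ in N0.
have mN : measurable N by apply: measurableI => //; exact: mK.
set l := ((b - x) / (b - a))%R.
have ba : (0 < b - a)%R by lra.
have l0 : (0 < l)%R by rewrite divr_gt0//; lra.
have l1' : ((x - a) / (b - a) = 1 - l)%R.
  by rewrite /l -[1%R in RHS](divff (lt0r_neq0 ba)) -mulrBl; congr (_ / _)%R; ring.
have l1 : (0 < 1 - l)%R by rewrite -l1' divr_gt0//; lra.
have xl : (x = l * a + (1 - l) * b)%R.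
  have hba : (b - a != 0)%R by rewrite gt_eqF.
  by rewrite /l; field.
rewrite l1'.
have x3 : (`|x| <= 3)%R.
  by rewrite ler_norml in a3; rewrite ler_norml in b3; rewrite ler_norml; lra.
have s9 : (0 <= (0 : R) <= 9)%R by rewrite lexx/=; lra.
rewrite -!(pot_shift cK K1 muK)//.
have mf y : measurable_fun K (fun t => lk y 0 t + (shift4 R)%:E).
  by apply: emeasurable_funD => //; apply: measurable_funTS; exact: measurable_lk.
have f0 y : (`|y| <= 3)%R -> forall t, K t -> 0 <= lk y 0 t + (shift4 R)%:E.
  by move=> y3 t Kt; exact: lk_shift_ge0 y3 (Knorm K1 Kt) s9.
rewrite !(ge0_negligible_integral mN (mK cK) _ _ N0)//; try by apply: f0.
have mKN : measurable (K `\` N) by apply: measurableD => //; exact: mK.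
have sub : K `\` N `<=` K by move=> t [].
have mf' y : measurable_fun (K `\` N) (fun t => lk y 0 t + (shift4 R)%:E).
  by apply: (measurable_funS (mK cK) sub).
rewrite -!ge0_integralZl_EFin//; try (by move=> t /sub; apply: f0); try exact: ltW.
rewrite -ge0_integralD//; last 4 first.
- by move=> t Kt; rewrite mule_ge0 ?f0 ?lee_fin// ?ltW//; exact: sub.
- exact: measurable_funeM.
- by move=> t Kt; rewrite mule_ge0 ?f0 ?lee_fin// ?ltW//; exact: sub.
- exact: measurable_funeM.
apply: le_integral_nomeas => t [Kt nN].
have tab : (t <= a \/ b <= t)%R.
  have [ta|ta] := leP t a; first by left.
  have [bt|bt] := leP b t; first by right.
  by exfalso; apply: nN; split => //=; rewrite in_itv/= ta bt.
rewrite /lk !addr0 !sqrf_eq0 !subr_eq0.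
have xt : x != t by case: tab => h; [rewrite gt_eqF|rewrite lt_eqF] => //; lra.
rewrite (negbTE xt).
have [ta|ta] := eqVneq a t.
  rewrite addye ?eqe// gt0_muley ?lte_fin// addye ?leey//.
  case: ifPn => _; first by rewrite addye ?eqe// gt0_muley ?lte_fin.
  by rewrite -EFinD -EFinM.
have [tb|tb] := eqVneq b t.
  by rewrite addye ?eqe// gt0_muley ?lte_fin// addey ?leey// -EFinD -EFinM.
suff : (- (ln ((x - t) ^+ 2) / 2) + shift4 R <= l * (- (ln ((a - t) ^+ 2) / 2) + shift4 R) + (1 - l) * (- (ln ((b - t) ^+ 2) / 2) + shift4 R))%R by rewrite -lee_fin.
have e y : (ln ((y - t) ^+ 2) / 2 = ln `|y - t|)%R \/ y = t.
  have [->|yt] := eqVneq y t; [by right|left].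
  rewrite -(real_normK (num_real (y - t))) lnXn ?normr_gt0 ?subr_eq0//.
  by rewrite -(mulr_natr (ln _)) mulfK// pnatr_eq0.
case: (e x) (e a) (e b) => [->|/eqP]; last by rewrite (negbTE xt).
case=> [->|/eqP]; last by rewrite (negbTE ta).
case=> [->|/eqP]; last by rewrite (negbTE tb).
have pa : (0 < `|a - t|)%R by rewrite normr_gt0 subr_eq0.
have pb : (0 < `|b - t|)%R by rewrite normr_gt0 subr_eq0.
have l01 : (0 <= l <= 1)%R by rewrite ltW//=; lra.
have := ln_concave l01 pa pb.
have -> : (l * `|a - t| + (1 - l) * `|b - t| = `|x - t|)%R.
  case: tab => h.
    by rewrite !ger0_norm ?xl; [ring|lra|lra|lra].
  by rewrite !ler0_norm ?xl; [ring|lra|lra|lra].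
move=> h; have := h; lra.
Qed.

(** A maximum principle on the line. If the bound failed at [x], let [a < x < b] be the nearest
    points on both sides where it holds; they exist because at distance 3 the potential is at most
    [- ln 2]. Between them the potential is too large, so [mu] has no mass there by [null_high], and
    convexity across the gap gives the bound at [x]. *)
Lemma frostman_upper3 (x : R) (d : R) : (0 < d)%R -> (- ln 2 <= I + d - shift4 R)%R ->
  (`|x| <= 3)%R -> pot K mu x 0 <= (I + d - shift4 R)%:E.
Proof.
move=> d0 Vge x3; set V := (I + d - shift4 R)%R.
have gE y : (`|y| <= 3)%R -> \int[mu]_z nonneg_kernel (y, z) = pot K mu y 0 + (shift4 R)%:E.
  by move=> y3; exact: potkn_pot.
pose P y := pot K mu y 0 <= V%:E.
have P3 y : (`|y| = 3)%R -> P y.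
  move=> y3; apply: (@le_trans _ _ (- ln 2)%:E); last by rewrite lee_fin.
  apply: (pot_le cK muK) => t /(Knorm K1) t1; apply: lk_le => //.
  rewrite addr0 -(real_normK (num_real (y - t))) ler_pXn2r ?nnegrE//.
  have := lerB_dist y t; lra.
have op y : (`|y| < 3)%R -> ~ P y -> exists2 e : R, (0 < e)%R & forall z, (`|y - z| < e)%R -> ~ P z.
  move=> y3 /negP; rewrite -ltNge => h.
  have [e e0 he] := pot_lsc cK K1 muK y3 h.
  exists e => // z yz; apply/negP; rewrite -ltNge.
  by apply: he => //; rewrite lexx ltW.
have oPP y : (`|y| <= 3)%R -> ~ P y -> (`|y| < 3)%R.
  by move=> y3 nP; rewrite lt_neqAle y3 andbT; apply/eqP => /P3.
apply: contrapT => nPx.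
have x3' := oPP _ x3 nPx.
have /andP[x3l x3r] : (-3 < x < 3)%R by rewrite -ltr_norml.
have [b [/andP[xb b3] Pb ltb]] : exists b, [/\ (x <= b <= 3)%R, P b & forall y, (x <= y < b)%R -> ~ P y].
  apply: first_hit; [exact: ltW|by apply: P3; rewrite ger0_norm|].
  move=> y /andP[xy y3] nPy; apply: op => //; apply: oPP => //.
  by rewrite ler_norml; lra.
have [a' [/andP[xa a3] Pa lta]] : exists b, [/\ (- x <= b <= 3)%R, P (- b)%R & forall y, (- x <= y < b)%R -> ~ P (- y)%R].
  apply: (first_hit (P := fun y => P (- y)%R)); [lra|by apply: P3; rewrite normrN ger0_norm|].
  move=> y /andP[xy y3] nPy; have [|e e0 he] := op (- y)%R _ nPy.
    by apply: oPP => //; rewrite ler_norml; lra.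
  exists e => // z yz; apply: he.
  have -> : (- y - - z = - (y - z))%R by ring.
  by rewrite normrN.
pose a := (- a')%R.
have ax : (a <= x)%R by rewrite /a; lra.
have neq : forall y, P y -> y <> x by move=> y Py yx; apply: nPx; rewrite -yx.
have ax' : (a < x)%R by rewrite lt_neqAle ax andbT; apply/eqP; exact: neq.
have xb' : (x < b)%R by rewrite lt_neqAle xb andbT eq_sym; apply/eqP; exact: neq.
have a3' : (`|a| <= 3)%R by rewrite ler_norml /a; lra.
have b3' : (`|b| <= 3)%R by rewrite ler_norml; lra.
have N0 : mu (K `&` `]a, b[%classic) = 0.
  have h0 := null_high cK muK mumin muI d0.
  have mH : measurable (K `&` [set x | (I + d)%:E < \int[mu]_y nonneg_kernel (x, y)]).
    apply: measurableI; [exact: mK|rewrite -[X in measurable X]setTI].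
    by apply: emeasurable_fun_o_infty => //; exact: measurable_potkn.
  have mN : measurable (K `&` `]a, b[%classic) by apply: measurableI => //; exact: mK.
  apply: (subset_measure0 mN mH) => // y [Ky /=]; rewrite in_itv/= => /andP[ay yb].
  have y3 : (`|y| <= 3)%R.
    by move: a3' b3'; rewrite !ler_norml; lra.
  split => //=; rewrite gE// -lteBlDr// -EFinB -/V ltNge; apply/negP => Py.
  have [yx|xy] := leP x y; first by apply: (ltb y) => //; rewrite yx yb.
  by apply: (lta (- y)%R); rewrite ?opprK//; move: ay; rewrite /a; lra.
have axb : (a < x < b)%R by rewrite ax' xb'.
have := pot_gap_convex axb N0 a3' b3'.
have ba : (0 < b - a)%R by lra.
have pl : (0 <= (b - x) / (b - a))%R by rewrite divr_ge0//; lra.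
have pr : (0 <= (x - a) / (b - a))%R by rewrite divr_ge0//; lra.
move=> h; apply: nPx; rewrite /P -(@leeD2rE _ (shift4 R)%:E)//.
apply: (le_trans h).
apply: (@le_trans _ _ (((b - x) / (b - a))%:E * (V%:E + (shift4 R)%:E) + ((x - a) / (b - a))%:E * (V%:E + (shift4 R)%:E))).
  by apply: leeD; rewrite lee_wpmul2l ?lee_fin// leeD2r.
suff : ((b - x) / (b - a) * (V + shift4 R) + (x - a) / (b - a) * (V + shift4 R) <= V + shift4 R)%R.
  by rewrite -lee_fin.
rewrite -mulrDl -mulrDl.
have -> : (b - x + (x - a) = b - a)%R by ring.
by rewrite divff ?mul1r// gt_eqF.
Qed.

End FrostmanUpper.

(** * Polar sets and small products *)

Section EmpiricalEnergy.
Variables (R : realType) (t : nat -> R) (M : R).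
Hypothesis tinj : forall i k, (i < k)%N -> t i != t k.
Hypothesis t1 : forall i, `|t i| <= 1.
Hypothesis tM : forall k, \sum_(i < k) (ln 5 - ln `|t k - t i|) <= k%:R * M.

(** Point number [n] adds one diagonal term, at most [B], and twice [n] other terms, together at
    most [2 n M]; the increment of [M n^2] pays for the latter. *)
Lemma pair_energy (w : R -> R -> R) (B : R) n : 0 <= M ->
  (forall x y, w x y = w y x) -> (forall i, w (t i) (t i) <= B) ->
  (forall i k, (i < k)%N -> w (t k) (t i) <= ln 5 - ln `|t k - t i|) ->
  \sum_(k < n) \sum_(i < n) w (t k) (t i) <= M * n%:R ^+ 2 + B * n%:R.
Proof.
move=> M0 ws wB wk; elim: n => [|n IH].
  by rewrite big_ord0 expr0n/= !mulr0 addr0.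
rewrite big_ord_recr/=.
under eq_bigr do rewrite big_ord_recr/=.
rewrite big_split/= big_ord_recr/=.
have e : \sum_(i < n) w (t i) (t n) = \sum_(i < n) w (t n) (t i).
  by apply: eq_bigr => i _; exact: ws.
have h : \sum_(i < n) w (t n) (t i) <= n%:R * M.
  by apply: le_trans (tM n); apply: ler_sum => i _; exact: wk.
rewrite e; have := wB n; rewrite -natr1; have n0 : 0 <= n%:R :> R by [].
move: (n%:R) n0 h IH => N N0 h IH hB; nra.
Qed.

(** The strict inequality makes increments count the points of half-open intervals [[a, b[]. *)
Definition ecdf n x : R := (\sum_(i < n) (t i < x)%R%:R) / n%:R.

Lemma ecdf_ge0 n x : 0 <= ecdf n x.
Proof. by rewrite divr_ge0// sumr_ge0. Qed.

Lemma ecdf_le1 n x : ecdf n x <= 1.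
Proof.
have [->|n0] := eqVneq n 0%N; first by rewrite /ecdf big_ord0 mul0r.
rewrite ler_pdivrMr ?ltr0n ?lt0n// mul1r.
rewrite -[leRHS](_ : \sum_(i < n) 1 = _); last by rewrite sumr_const card_ord.
by apply: ler_sum => i _; rewrite lern1 leq_b1.
Qed.

Lemma ecdf_mono n x y : x <= y -> ecdf n x <= ecdf n y.
Proof.
move=> xy; rewrite ler_wpM2r ?invr_ge0//; apply: ler_sum => i _.
by rewrite ler_nat; case: (ltP (t i) x) => // h; rewrite (lt_le_trans h xy).
Qed.

Lemma ecdf_sub n a b : a <= b ->
  ecdf n b - ecdf n a = (\sum_(i < n) (a <= t i < b)%R%:R) / n%:R.
Proof.
move=> ab; rewrite /ecdf -mulrBl -sumrB; congr (_ / _); apply: eq_bigr => i _.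
case: (ltP (t i) a) => h; first by rewrite (lt_le_trans h ab) subrr.
by rewrite subr0.
Qed.

Lemma ecdf_out n a b : a <= b -> (forall i, ~ (a <= t i < b)) -> ecdf n a = ecdf n b.
Proof.
move=> ab h; apply/eqP; rewrite eq_sym -subr_eq0 ecdf_sub// big1 ?mul0r// => i _.
by have /negP/negbTE -> := h i.
Qed.

(** Two points in [[a, b[] are closer than [b - a] and contribute at least [ln (5 / (b - a))] to the
    energy; the squared increment is the proportion of such pairs. In the limit this is a modulus of
    continuity. *)
Lemma ecdf_modulus n a b : 0 <= M -> (0 < n)%N -> a < b -> b - a <= 5 ->
  (ecdf n b - ecdf n a) ^+ 2 * ln (5 / (b - a)) <= M + ln (5 / (b - a)) / n%:R.
Proof.
move=> M0 n0 ab ba5; set L := ln _.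
have ba : 0 < b - a by rewrite subr_gt0.
have L0 : 0 <= L by rewrite ln_ge0// ler_pdivlMr// mul1r.
pose c (x : R) : R := (a <= x < b)%R%:R.
have c01 x : 0 <= c x <= 1 by rewrite /c ler0n lern1 leq_b1.
have := @pair_energy (fun x y => c x * c y * L) L n M0.
have -> : \sum_(k < n) \sum_(i < n) c (t k) * c (t i) * L = (\sum_(i < n) c (t i)) ^+ 2 * L.
  rewrite expr2 !mulr_suml; apply: eq_bigr => k _.
  by rewrite mulr_sumr mulr_suml; apply: eq_bigr.
move=> H.
have n0' : 0 < n%:R :> R by rewrite ltr0n.
rewrite (ecdf_sub _ (ltW ab)) exprMn exprVn -mulrA [_^-1 * L]mulrC mulrA ler_pdivrMr ?exprn_gt0//.
have -> : (M + L / n%:R) * n%:R ^+ 2 = M * n%:R ^+ 2 + L * n%:R.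
  by field; rewrite gt_eqF.
apply: H.
- by move=> x y; rewrite [c x * _]mulrC.
- by move=> i; rewrite -[leRHS]mul1r ler_wpM2r//; have := c01 (t i); nra.
- move=> i k ik; have dk : 0 < `|t k - t i| by rewrite normr_gt0 subr_eq0 eq_sym tinj.
  rewrite /c; case: (boolP (a <= t k < b)) => [/andP[h1 h2]|_]; last first.
    rewrite !mul0r subr_ge0 ler_ln ?posrE//.
    have := ler_normB (t k) (t i); have := t1 k; have := t1 i; lra.
  case: (boolP (a <= t i < b)) => [/andP[h3 h4]|_]; last first.
    rewrite mulr0 mul0r subr_ge0 ler_ln ?posrE//.
    have := ler_normB (t k) (t i); have := t1 k; have := t1 i; lra.
  rewrite !mul1r /L ln_div ?posrE// lerB// ler_ln ?posrE//.
  rewrite ler_norml; lra.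
Qed.

Variable m : nat.
Hypothesis m0 : (0 < m)%N.
Let h : R := 4 / m%:R.

Definition grid (i : nat) : R := -2 + i%:R * h.
(** A lower bound for [ln 5 - ln |x - y|] with [x] in cell [i] and [y] in cell [j], whose distance
    is at most [h (|i - j| + 1)]. *)
Definition cellw (i j : nat) : R := ln (5 / (h * (`|i%:R - j%:R| + 1))).

Let h0 : 0 < h. Proof. by rewrite divr_gt0// ltr0n. Qed.

Lemma cellw_den (i j : nat) : (i < m)%N -> (j < m)%N ->
  0 < h * (`|i%:R - j%:R| + 1) <= 4.
Proof.
move=> im jm; apply/andP; split; first by rewrite mulr_gt0// ltr_wpDl.
have hm : h * m%:R = 4 by rewrite /h divfK// pnatr_eq0 -lt0n.
rewrite -hm ler_pM2l// -lerBrDr ler_norml.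
have i1 : i%:R + 1 <= m%:R :> R by rewrite natr1 ler_nat.
have j1 : j%:R + 1 <= m%:R :> R by rewrite natr1 ler_nat.
have i0 : 0 <= i%:R :> R by []. have j0 : 0 <= j%:R :> R by [].
lra.
Qed.

Lemma cellw_ge0 (i j : nat) : (i < m)%N -> (j < m)%N -> 0 <= cellw i j.
Proof.
move=> im jm; have /andP[d0 d4] := cellw_den im jm.
by rewrite ln_ge0// ler_pdivlMr// mul1r; lra.
Qed.

Lemma cellw_sym i j : cellw i j = cellw j i.
Proof. by rewrite /cellw distrC. Qed.

Definition cell (x : R) : nat := Num.truncn ((x + 2) / h).

Lemma cell_lt x : `|x| <= 1 -> (cell x < m)%N.
Proof.
rewrite ler_norml => x1; rewrite truncn_lt_nat; last by rewrite divr_ge0 ?(ltW h0)//; lra.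
by rewrite ltr_pdivrMr// /h mulrC divfK ?pnatr_eq0 -?lt0n//; lra.
Qed.

Lemma cellP x i : `|x| <= 1 -> (grid i <= x < grid i.+1) = (i == cell x).
Proof.
rewrite ler_norml => x1; rewrite [RHS]eq_sym truncn_eq; last by rewrite divr_ge0 ?(ltW h0)//; lra.
rewrite ler_pdivlMr// ltr_pdivrMr// /grid.
by congr andb; apply/idP/idP; lra.
Qed.

Lemma cellw_le x y : `|x| <= 1 -> `|y| <= 1 -> x != y ->
  cellw (cell x) (cell y) <= ln 5 - ln `|x - y|.
Proof.
move=> x1 y1 xy; have d0 : 0 < `|x - y| by rewrite normr_gt0 subr_eq0.
have /andP[p0 _] := cellw_den (cell_lt x1) (cell_lt y1).
rewrite /cellw ln_div ?posrE// lerB// ler_ln ?posrE//.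
have := cellP (cell x) x1; have := cellP (cell y) y1; rewrite !eqxx.
rewrite /grid -!natr1 => /andP[b1 b2] /andP[b3 b4].
set u : R := (cell x)%:R in b3 b4 *; set v : R := (cell y)%:R in b1 b2 *.
have e : h * (`|u - v| + 1) = `|h * (u - v)| + h.
  by rewrite normrM (gtr0_norm h0); ring.
rewrite e; apply: (@le_trans _ _ (`|h * (u - v)| + `|x - y - h * (u - v)|)).
  have {1}-> : x - y = h * (u - v) + (x - y - h * (u - v)) by ring.
  exact: ler_normD.
rewrite lerD2l ler_norml; nra.
Qed.

(** This is [pair_energy] for the step kernel [cellw (cell x) (cell y)], which lies below the
    shifted logarithmic one; grouping points by cells turns the double sum into increments of
    [ecdf]. *)
Lemma emp_cells n : 0 <= M -> (0 < n)%N ->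
  \sum_(i < m) \sum_(j < m) cellw i j * (ecdf n (grid i.+1) - ecdf n (grid i)) *
     (ecdf n (grid j.+1) - ecdf n (grid j)) <= M + ln (5 / h) / n%:R.
Proof.
move=> M0 n0.
have n0' : 0 < n%:R :> R by rewrite ltr0n.
have gm i : grid i <= grid i.+1 by rewrite /grid lerD2l ler_pM2r// ler_nat.
pose c (i : nat) (x : R) : R := (grid i <= x < grid i.+1)%R%:R.
have cE i k : c i (t k) = (i == cell (t k))%:R by rewrite /c cellP.
have := @pair_energy (fun x y => cellw (cell x) (cell y)) (ln (5 / h)) n M0.
have pick1 (f : nat -> R) k : \sum_(i < m) f i * c i (t k) = f (cell (t k)).
  rewrite (bigD1 (Ordinal (cell_lt (t1 k))))//= cE eqxx mulr1 big1 ?addr0// => i ik.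
  by rewrite cE (_ : (_ == _) = false) ?mulr0//; apply/negbTE.
have -> : \sum_(k < n) \sum_(i < n) cellw (cell (t k)) (cell (t i)) =
  \sum_(i < m) \sum_(j < m) cellw i j * (\sum_(k < n) c i (t k)) * (\sum_(l < n) c j (t l)).
  transitivity (\sum_(k < n) \sum_(l < n) \sum_(i < m) \sum_(j < m) cellw i j * c i (t k) * c j (t l)).
    apply: eq_bigr => k _; apply: eq_bigr => l _.
    rewrite -(pick1 (fun i => cellw i (cell (t l))) k); apply: eq_bigr => i _.
    by rewrite -(pick1 (fun j => cellw i j) l) mulr_suml; apply: eq_bigr => j _; rewrite mulrAC.
  under eq_bigr do rewrite exchange_big/=.
  rewrite exchange_big/=; apply: eq_bigr => i _.
  under eq_bigr do rewrite exchange_big/=.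
  rewrite exchange_big/=; apply: eq_bigr => j _.
  rewrite -mulrA mulr_suml mulr_sumr; apply: eq_bigr => k _.
  by rewrite !mulr_sumr; apply: eq_bigr => l _; rewrite mulrA.
move=> H.
under eq_bigr => i _ do under eq_bigr => j _ do rewrite !(ecdf_sub _ (gm _)).
rewrite -(@ler_pM2r _ (n%:R ^+ 2)) ?exprn_gt0//.
have -> : (M + ln (5 / h) / n%:R) * n%:R ^+ 2 = M * n%:R ^+ 2 + ln (5 / h) * n%:R.
  by field; rewrite gt_eqF.
have -> : (\sum_(i < m) \sum_(j < m) cellw i j * ((\sum_(k < n) c i (t k)) / n%:R) *
   ((\sum_(k < n) c j (t k)) / n%:R)) * n%:R ^+ 2 = 
   \sum_(i < m) \sum_(j < m) cellw i j * (\sum_(k < n) c i (t k)) * (\sum_(l < n) c j (t l)).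
  rewrite mulr_suml; apply: eq_bigr => i _; rewrite mulr_suml; apply: eq_bigr => j _.
  by field; rewrite gt_eqF.
apply: H.
- by move=> x y; exact: cellw_sym.
- by move=> i; rewrite /cellw subrr normr0 add0r mulr1.
- by move=> i k ik; apply: cellw_le => //; rewrite eq_sym tinj.
Qed.

End EmpiricalEnergy.

(** * Limit of the counting measures along an ultrafilter *)

Section LimitMeasure.
Variables (R : realType) (E : set R).
Hypotheses (cE : compact E) (E1 : E `<=` [set x : R | -1 <= x <= 1]).
Variables (t : nat -> R) (M : R).
Hypotheses (M0 : 0 <= M) (tinj : forall i k, (i < k)%N -> t i != t k).
Hypothesis tE : forall i, E (t i).
Hypothesis tM : forall k, \sum_(i < k) (ln 5 - ln `|t k - t i|) <= k%:R * M.

Let t1 i : `|t i| <= 1. Proof. exact: (Knorm E1 (tE i)). Qed.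

Variables (U : set_system nat) (UU : UltraFilter U) (ooU : \oo `<=` U).

Let PU : ProperFilter U. Proof. exact: ultra_proper. Qed.

Lemma ultra_bounded_cvg (u : nat -> R) : (forall n, 0 <= u n <= 1) ->
  exists l : R, u @ U --> l.
Proof.
move=> u01.
have cpt := @segment_compact R 0 1.
have [|l [_ cl]] := cpt (u @ U) _.
  by apply: (@filterS _ U _ setT) => [n _|]; [rewrite /= in_itv/= u01|exact: filterT].
exists l => A Al.
have [//|UA] := in_ultra_setVsetC (u @^-1` A) UU.
by have [x [/= nA Ax]] := cl (~` A) A UA Al.
Qed.

Lemma ecdf_bounds x n : 0 <= ecdf t n x <= 1.
Proof. by rewrite ecdf_ge0 ecdf_le1. Qed.

(** An ultrafilter finer than [\oo] makes all bounded sequences converge at once, which replaces the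
    extraction of a subsequence valid for every [x]. *)
Definition limcdf x : R := projT1 (cid (ultra_bounded_cvg (ecdf_bounds x))).

Lemma limcdf_cvg x : (fun n => ecdf t n x) @ U --> limcdf x.
Proof. by rewrite /limcdf; case: cid. Qed.

Lemma ultra_le (u v : nat -> R) (a b : R) : u @ U --> a -> v @ U --> b ->
  (forall n, (0 < n)%N -> u n <= v n) -> a <= b.
Proof.
move=> ua vb uv; apply: (ler_cvg_to ua vb); apply: ooU.
by exists 1%N => // n /= n0; exact: uv.
Qed.

Lemma ultra_inv (c d : R) : (fun n => c + d / n%:R) @ U --> c.
Proof.
apply: cvg_trans; first by apply: cvg_app; exact: ooU.
rewrite -[X in _ --> X]addr0; apply: cvgD; first exact: cvg_cst.
rewrite -(mulr0 d); apply: cvgMl_tmp.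
rewrite -(cvg_shiftS (fun n : nat => (n%:R : R)^-1)); exact: cvg_harmonic.
Qed.

Lemma limcdf_mono x y : x <= y -> limcdf x <= limcdf y.
Proof.
move=> xy; apply: (ultra_le (@limcdf_cvg x) (@limcdf_cvg y)) => n _.
exact: ecdf_mono.
Qed.

Lemma limcdf_flat a b : a <= b -> (forall x, E x -> ~ (a <= x < b)) -> limcdf a = limcdf b.
Proof.
move=> ab h; have e n : ecdf t n a = ecdf t n b.
  by apply: ecdf_out => // i; apply: h; exact: tE.
apply: le_anti; rewrite limcdf_mono//=.
by apply: (ultra_le (@limcdf_cvg b) (@limcdf_cvg a)) => n _; rewrite e.
Qed.

Lemma limcdf0 x : x <= -1 -> limcdf x = 0.
Proof.
move=> x1; have e n : ecdf t n x = 0.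
  rewrite /ecdf big1 ?mul0r// => i _; have := t1 i; rewrite ler_norml => h.
  by case: ltP => // h'; lra.
apply: le_anti; apply/andP; split.
  by apply: (ultra_le (@limcdf_cvg x) (cvg_cst (0 : R))) => n _; rewrite e.
by apply: (ultra_le (cvg_cst (0 : R)) (@limcdf_cvg x)) => n _; rewrite e.
Qed.

Lemma limcdf1 x : 1 < x -> limcdf x = 1.
Proof.
move=> x1; have e n : (0 < n)%N -> ecdf t n x = 1.
  move=> n0; rewrite /ecdf (eq_bigr (fun=> 1)); last first.
    move=> i _; have := t1 i; rewrite ler_norml => h.
    by case: ltP => // h'; lra.
  by rewrite sumr_const card_ord divff// pnatr_eq0 -lt0n.
apply: le_anti; apply/andP; split.
  by apply: (ultra_le (@limcdf_cvg x) (cvg_cst (1 : R))) => n n0; rewrite e.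
by apply: (ultra_le (cvg_cst (1 : R)) (@limcdf_cvg x)) => n n0; rewrite e.
Qed.

Lemma limcdf_modulus a b : a < b -> b - a <= 5 ->
  (limcdf b - limcdf a) ^+ 2 * ln (5 / (b - a)) <= M.
Proof.
move=> ab ba5.
apply: (ultra_le (u := fun n => (ecdf t n b - ecdf t n a) ^+ 2 * ln (5 / (b - a)))
  (v := fun n => M + ln (5 / (b - a)) / n%:R)).
- apply: cvgMr_tmp; apply: (@continuous_cvg _ _ _ _ _ (fun n => ecdf t n b - ecdf t n a) (fun x : R => x ^+ 2)).
    exact: exprn_continuous.
  by apply: cvgB; exact: limcdf_cvg.
- exact: ultra_inv.
- by move=> n n0; exact: ecdf_modulus.
Qed.

Lemma limcdf_cells m : (0 < m)%N ->
  \sum_(i < m) \sum_(j < m) cellw R m i j * (limcdf (grid R m i.+1) - limcdf (grid R m i)) *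
     (limcdf (grid R m j.+1) - limcdf (grid R m j)) <= M.
Proof.
move=> m0.
apply: (ultra_le (u := fun n => \sum_(i < m) \sum_(j < m) cellw R m i j *
   (ecdf t n (grid R m i.+1) - ecdf t n (grid R m i)) *
   (ecdf t n (grid R m j.+1) - ecdf t n (grid R m j)))
  (v := fun n => M + ln (5 / (4 / m%:R)) / n%:R)).
- apply: cvg_big => [|i _]; first exact: add_continuous.
  apply: cvg_big => [|j _]; first exact: add_continuous.
  apply: cvgM; last by apply: cvgB; exact: limcdf_cvg.
  by apply: cvgMl_tmp; apply: cvgB; exact: limcdf_cvg.
- exact: ultra_inv.
- by move=> n n0; exact: emp_cells.
Qed.

(** From [limcdf_modulus]: the radius is chosen so that [ln (5 / (x - a)) >= M / e^2 + 1], and an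
    increment of at least [e] would then give [M + e^2 <= M]. *)
Lemma limcdf_rc : right_continuous limcdf.
Proof.
move=> a; apply/cvgrPdist_lt => e e0.
pose d := Num.min 1 (5 * expR (- (M / e ^+ 2 + 1))).
have d0 : 0 < d by rewrite lt_min ltr01/= mulr_gt0// expR_gt0.
near=> x.
have ax : a < x by near: x; exact: nbhs_right_gt.
have xd : x < a + d by near: x; apply: nbhs_right_lt; rewrite ltrDl.
have [d1 d2] : d <= 1 /\ d <= 5 * expR (- (M / e ^+ 2 + 1)).
  by rewrite /d !ge_min !lexx orbT.
have xa0 : 0 < x - a by rewrite subr_gt0.
have xa5 : x - a <= 5 by lra.
have h := limcdf_modulus ax xa5.
have hl : M / e ^+ 2 + 1 <= ln (5 / (x - a)).
  rewrite -[leLHS]expRK ler_ln ?posrE ?expR_gt0 ?divr_gt0//.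
  rewrite ler_pdivlMr// -ler_pdivlMl ?expR_gt0// mulrC -expRN; lra.
have e2 : 0 < e ^+ 2 by rewrite exprn_gt0.
have D0 : 0 <= limcdf x - limcdf a by rewrite subr_ge0 limcdf_mono// ltW.
rewrite distrC ger0_norm// -(@ltr_pXn2r _ 2) ?nnegrE// ?ltW//.
rewrite ltNge; apply/negP => hh.
have : e ^+ 2 * (M / e ^+ 2 + 1) <= M.
  apply: le_trans h; apply: (@le_trans _ _ (e ^+ 2 * ln (5 / (x - a)))).
    by rewrite ler_pM2l.
  rewrite ler_wpM2r//; apply: le_trans hl; rewrite addr_ge0// divr_ge0// ltW//.
rewrite mulrDr mulr1 mulrC divfK ?gt_eqF//; lra.
Unshelve. all: by end_near. Qed.

Lemma limcdf_ny : limcdf x @[x --> -oo] --> (0 : R).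
Proof.
apply: cvg_near_cst; near=> x; apply: limcdf0.
by near: x; exact: nbhs_ninfty_le.
Unshelve. all: by end_near. Qed.

Lemma limcdf_y : limcdf x @[x --> +oo] --> (1 : R).
Proof.
apply: cvg_near_cst; near=> x; apply: limcdf1.
by near: x; exact: nbhs_pinfty_gt.
Unshelve. all: by end_near. Qed.

HB.instance Definition _ := isCumulative.Build R _ R limcdf limcdf_mono limcdf_rc.
HB.instance Definition _ := isCumulativeBounded.Build R 0 1 limcdf limcdf_ny limcdf_y.

Definition limF : cumulativeBounded 0 1 := limcdf.
Local Open Scope ereal_scope.

Definition limmeas (A : set R) : \bar R := lebesgue_stieltjes_measure limF A.

Let limmeas0 : limmeas set0 = 0. Proof. exact: measure0. Qed.
Let limmeas_ge0 A : 0 <= limmeas A. Proof. exact: measure_ge0. Qed.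
Let limmeas_sigma : semi_sigma_additive limmeas.
Proof.
by move=> F mF tF mUF; exact: (@measure_semi_sigma_additive _ _ _ (lebesgue_stieltjes_measure limF) F).
Qed.

HB.instance Definition _ := isMeasure.Build _ R R limmeas limmeas0 limmeas_ge0 limmeas_sigma.

Lemma limmeasT : limmeas setT = 1.
Proof. exact: (probability_setT (lebesgue_stieltjes_measure limF)). Qed.

Definition limprob : probability R R := as_prob limmeasT.

Lemma limprob_itv (a b : R) : (a <= b)%R ->
  limprob `]a, b]%classic = (limcdf b - limcdf a)%:E.
Proof.
move=> ab; transitivity (lebesgue_stieltjes_measure limF `]a, b]%classic) => //.
rewrite /lebesgue_stieltjes_measure /measure_extension/=.
by rewrite measurable_mu_extE/= ?wlength_itv_bnd//; exact: is_ocitv.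
Qed.

(** The complement of the closed set [E] is covered by countably many intervals with rational ends
    whose closures miss [E], and [limcdf] takes equal values at the two ends of each. *)
Lemma limprob_on : prob_on E limprob.
Proof.
split; first exact: limmeasT.
have oE : open (~` E) by apply: closed_openC; apply: compact_closed.
pose A (k : nat) : set R := if unpickle k is Some (p, q) then
  (if `[< `[ratr p : R, ratr q]%classic `<=` ~` E >] then `]ratr p, ratr q]%classic else set0) else set0.
have A0 k : limprob.-negligible (A k).
  rewrite /A; case: (unpickle k) => [[p q]|]; last exact: negligible_set0.
  case: asboolP => [sub|_]; last exact: negligible_set0.
  exists `]ratr p, ratr q]%classic; split => //.
  have [pq|qp] := leP (ratr p : R) (ratr q); last first.
    by rewrite set_itv_ge ?measure0// bnd_simp -leNgt ltW.
  rewrite limprob_itv// (@limcdf_flat (ratr p) (ratr q)) ?subrr// => x Ex /andP[px xq].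
  by apply: (sub x) => //=; rewrite in_itv/= px ltW.
have h := negligible_bigcup A0.
apply: measure_negligible; first by apply: measurableC; exact: mK.
apply: negligibleS h => x nEx.
have /nbhs_ballP[e /= e0 he] := open_nbhs_nbhs (conj oE nEx).
have /rat_in_itvoo[p] : (x - e < x)%R by rewrite ltrBlDr ltrDl.
rewrite in_itv/= => /andP[p1 p2].
have /rat_in_itvoo[q] : (x < x + e)%R by rewrite ltrDl.
rewrite in_itv/= => /andP[q1 q2].
have Apq : A (pickle (p, q)) = if `[< `[ratr p : R, ratr q]%classic `<=` ~` E >] then `]ratr p, ratr q]%classic else set0.
  by rewrite /A pickleK.
exists (pickle (p, q)); first exact: Logic.I.
rewrite Apq {Apq}.
case: asboolP => [_|]; first by rewrite /= in_itv/= p2 ltW.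
case=> y /=; rewrite in_itv/= => /andP[py yq]; apply: he.
by rewrite -ball_normE/= ltr_norml; lra.
Qed.

Lemma integral_simple m (I : 'I_m -> set R) (c v : 'I_m -> R) :
  (forall i, measurable (I i)) -> (forall i, (0 <= c i)%R) ->
  (forall i, limprob (I i) = (v i)%:E) ->
  \int[limprob]_x (\sum_(i < m) c i * \1_(I i) x)%:E = (\sum_(i < m) c i * v i)%:E.
Proof.
move=> mI c0 Iv.
under eq_integral do rewrite -sumEFin.
rewrite ge0_integral_sum//.
- rewrite -sumEFin; apply: eq_bigr => i _.
  under eq_integral do rewrite EFinM.
  rewrite ge0_integralZl_EFin//.
  + rewrite integral_indic// setIT EFinM; congr (_ * _); exact: Iv.
  by apply/measurable_EFinP; exact: measurable_indic.
- by move=> i; apply/measurable_EFinP; apply: measurable_funM => //; exact: measurable_indic.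
- by move=> i x _; rewrite lee_fin mulr_ge0.
Qed.

Lemma grid_cover m x : (0 < m)%N -> (`|x| <= 1)%R ->
  exists i : 'I_m, `]grid R m i, grid R m i.+1]%classic x.
Proof.
move=> m0 x1; have ex : exists i, (x <= grid R m i.+1)%R.
  exists m.-1; rewrite prednK// /grid mulrCA divff ?pnatr_eq0 -?lt0n//.
  by move: x1; rewrite ler_norml; lra.
pose i := ex_minn ex.
have [hi him] : (x <= grid R m i.+1)%R /\ forall j, (x <= grid R m j.+1)%R -> (i <= j)%N.
  by rewrite /i; case: ex_minnP.
have im : (i < m)%N.
  rewrite -(prednK m0) ltnS; apply: him.
  rewrite prednK// /grid mulrCA divff ?pnatr_eq0 -?lt0n//.
  by move: x1; rewrite ler_norml; lra.
exists (Ordinal im); rewrite /= in_itv/= hi andbT.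
case: (i) hi him => [|j] hi him.
  by rewrite /grid mul0r addr0; move: x1; rewrite ler_norml; lra.
by rewrite ltNge; apply/negP => /him; rewrite ltnn.
Qed.

(** The height absorbs the error of the discretisation. With [d = |i - j|], [(h (d + 1))^2 = (h (d -
    1))^2 + 4 h (h d)]; for [d >= 1] one has [h (d - 1) <= |x - y|], and [h d <= 4] leaves an error
    of [16 h = 64 / m <= s]. *)
Lemma lk_cell m s x y (i j : 'I_m) : (0 < m)%N -> (0 < s)%R -> (64 / m%:R <= s)%R ->
  `]grid R m i, grid R m i.+1]%classic x -> `]grid R m j, grid R m j.+1]%classic y ->
  lk x s y + (shift4 R)%:E <= (cellw R m i j)%:E.
Proof.
move=> m0 s0 ms; rewrite /= !in_itv/= => /andP[x1 x2] /andP[y1 y2].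
have /andP[p0 p4] := cellw_den R m0 (ltn_ord i) (ltn_ord j).
have gS k : (grid R m k.+1 = -2 + (k%:R + 1) * (4 / m%:R))%R by rewrite /grid natr1.
move: p0 p4 x1 x2 y1 y2; rewrite !gS /cellw /grid.
set h := (4 / m%:R)%R.
have hm : (h * m%:R = 4)%R by rewrite /h divfK// pnatr_eq0 -lt0n.
have h0 : (0 < h)%R by rewrite divr_gt0// ltr0n.
have hs : (16 * h <= s)%R by move: ms; rewrite /h; lra.
have m1 : (1 <= m%:R :> R)%R by rewrite ler1n.
have h4 : (h <= 4)%R by nra.
move=> p0 p4 x1 x2 y1 y2.
set d : R := `|(i%:R : R) - j%:R|%R in p0 p4 *.
have d0 : (0 <= d)%R by exact: normr_ge0.
have : lk x s y <= (- ln (h * (d + 1)))%:E.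
  apply: lk_le => //; first exact: ltW.
  have -> : ((h * (d + 1)) ^+ 2 = (h * (d - 1)) ^+ 2 + 4 * h * (h * d))%R by ring.
  have [d1|d1] := leP 1%R d; last first.
    have dz : d = 0%R.
      move: d1; rewrite /d; case: (ltngtP i j) => ij.
      - have : (i%:R + 1 <= j%:R :> R)%R by rewrite natr1 ler_nat.
        by move=> hh; rewrite ltr0_norm ?subr_lt0 ?ltr_nat//; lra.
      - have : (j%:R + 1 <= i%:R :> R)%R by rewrite natr1 ler_nat.
        by move=> hh; rewrite gtr0_norm ?subr_gt0 ?ltr_nat//; lra.
      - by move=> _; rewrite ij subrr normr0.
    rewrite dz; have := sqr_ge0 (x - y)%R; nra.
  have dd : (h * (d - 1) <= `|x - y|)%R.
    have -> : (h * (d - 1) = `|h * (i%:R - j%:R)| - h)%R.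
      by rewrite normrM (gtr0_norm h0) -/d; ring.
    rewrite lerBlDr; apply: (@le_trans _ _ (`|x - y| + `|h * (i%:R - j%:R) - (x - y)|)%R).
      have {1}-> : (h * (i%:R - j%:R) = (x - y) + (h * (i%:R - j%:R) - (x - y)))%R by ring.
      exact: ler_normD.
    rewrite lerD2l ler_norml; nra.
  have dd2 : ((h * (d - 1)) ^+ 2 <= (x - y) ^+ 2)%R.
    rewrite -(real_normK (num_real (x - y)%R)) ler_pXn2r ?nnegrE//.
    by rewrite mulr_ge0 ?subr_ge0// ltW.
  have : (h * d <= 4)%R by nra.
  nra.
rewrite ln_div ?posrE//.
case: (lk x s y) => [r| |]//; last by move=> _; rewrite leNye.
by rewrite -EFinD !lee_fin /shift4; lra.
Qed.

Lemma limprob_pot s : (0 < s <= 1)%R ->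
  \int[limprob]_(x in E) (pot E limprob x s + (shift4 R)%:E) <= M%:E.
Proof.
move=> /andP[s0 s1]; pose m := (Num.truncn (64 / s)).+1.
have m0 : (0 < m)%N by [].
have ms : (64 / m%:R <= s)%R.
  rewrite ler_pdivrMr ?ltr0n// mulrC -ler_pdivrMr//.
  exact: ltW (truncnS_gt _).
pose I (i : 'I_m) : set R := `]grid R m i, grid R m i.+1]%classic.
pose v (i : 'I_m) := (limcdf (grid R m i.+1) - limcdf (grid R m i))%R.
have gm i : (grid R m i <= grid R m i.+1)%R.
  by rewrite /grid lerD2l ler_wpM2r ?ler_nat// divr_ge0.
have mI i : measurable (I i) by exact: measurable_itv.
have Iv i : limprob (I i) = (v i)%:E by exact: limprob_itv.
have w0 (i j : 'I_m) : (0 <= cellw R m i j)%R by exact: cellw_ge0.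
have v0 i : (0 <= v i)%R by rewrite subr_ge0 limcdf_mono.
have nK := limprob_on.
have inner x : E x -> pot E limprob x s + (shift4 R)%:E <=
  (\sum_(i < m) (\sum_(j < m) cellw R m i j * v j) * \1_(I i) x)%:E.
  move=> Ex; have x1 := Knorm E1 Ex.
  rewrite -(pot_shift cE E1 nK); [|lra|lra].
  pose c (j : 'I_m) := (\sum_(i < m) cellw R m i j * \1_(I i) x)%R.
  have c0 j : (0 <= c j)%R by apply: sumr_ge0 => i _; rewrite mulr_ge0.
  have -> : (\sum_(i < m) (\sum_(j < m) cellw R m i j * v j) * \1_(I i) x)%R =
    (\sum_(j < m) c j * v j)%R.
    under eq_bigr do rewrite mulr_suml.
    rewrite exchange_big/=; apply: eq_bigr => j _; rewrite /c mulr_suml.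
    by apply: eq_bigr => i _; rewrite mulrAC.
  rewrite -(integral_simple mI c0 Iv).
  rewrite [leRHS](integral_onK cE nK); last first.
    apply/measurable_EFinP; apply: measurable_sum => j; apply: measurable_funM => //; exact: measurable_indic.
  apply: le_integral_nomeas => y Ey; have y1 := Knorm E1 Ey.
  have [i xi] := grid_cover m0 x1; have [j yj] := grid_cover m0 y1.
  apply: (le_trans (lk_cell m0 s0 ms xi yj)); rewrite lee_fin.
  rewrite (bigD1 j)//= indicE mem_set// mulr1 /c (bigD1 i)//= indicE mem_set// mulr1.
  rewrite -addrA lerDl addr_ge0// sumr_ge0// => k _; rewrite mulr_ge0//.
  exact: c0.
have c0 (i : 'I_m) : (0 <= \sum_(j < m) cellw R m i j * v j)%R.
  by apply: sumr_ge0 => j _; rewrite mulr_ge0.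
apply: (@le_trans _ _ (\int[limprob]_(x in E)
  (\sum_(i < m) (\sum_(j < m) cellw R m i j * v j) * \1_(I i) x)%:E)).
  exact: le_integral_nomeas.
rewrite -(integral_onK cE nK); last first.
  apply/measurable_EFinP; apply: measurable_sum => j; apply: measurable_funM => //; exact: measurable_indic.
rewrite (integral_simple mI c0 Iv) lee_fin.
apply: le_trans (limcdf_cells m0); apply: ler_sum => i _.
by rewrite mulr_suml; apply: ler_sum => j _; rewrite -!mulrA [(v j * _)%R]mulrC.
Qed.

(** The bound of [limprob_pot] is uniform in [s]; monotone convergence as [s -> 0] is applied to the
    inner integral and then to the outer one. *)
Lemma limprob_energy : energy limprob limprob <= M%:E.
Proof.
have nK := limprob_on.
rewrite /energy (integral_onK cE nK (measurable_potkn limprob)).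
pose g (n : nat) x := pot E limprob x (n.+1%:R^-1) + (shift4 R)%:E.
have s9 n : (0 <= (n.+1%:R^-1 : R) <= 9)%R.
  rewrite invr_ge0 ler0n/= (@le_trans _ _ 1%R)// ?invf_le1//; last by lra.
  by rewrite ler1n.
have s1 n : (0 < (n.+1%:R^-1 : R) <= 1)%R.
  by rewrite invr_gt0 ltr0n/= invf_le1// ler1n.
have gE n x : (`|x| <= 3)%R -> g n x = \int[limprob]_(t in E) (lk x (n.+1%:R^-1) t + (shift4 R)%:E).
  by move=> x3; rewrite /g pot_shift.
have E3 x : E x -> (`|x| <= 3)%R by move=> /(Knorm E1); lra.
have mlk x s : measurable_fun E (lk x s) by apply: measurable_funTS; exact: measurable_lk.
have mg n : measurable_fun E (g n).
  pose k (z : R * R) := maxe 0 (lk z.1 (n.+1%:R^-1) z.2 + (shift4 R)%:E).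
  have mk : measurable_fun setT k.
    by apply: measurable_maxe => //; apply: emeasurable_funD => //; exact: measurable_lk2.
  have k0 z : 0 <= k z by rewrite /k le_max lexx.
  apply: (@eq_measurable_fun _ _ _ _ E (fun x => \int[limprob]_y k (x, y))).
    move=> x /set_mem Ex; rewrite (integral_onK cE nK); last first.
      exact: (measurableT_comp mk (measurable_pair1 x)).
    rewrite gE; last exact: E3.
    apply: eq_integral => y /set_mem Ey; rewrite /k max_r//.
    by apply: lk_shift_ge0 => //; [exact: E3|exact: Knorm Ey].
  exact: measurable_funTS (measurable_fun_fubini_tonelli_F k mk k0).
have g0 n x : E x -> 0 <= g n x.
  move=> Ex; rewrite gE; last exact: E3.
  by apply: integral_ge0 => y Ey; apply: lk_shift_ge0 => //; [exact: E3|exact: Knorm Ey].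
have gnd x : E x -> {homo g^~ x : n m / (n <= m)%N >-> n <= m}.
  move=> _ n m nm; rewrite /g leeD2r// pot_decr ?invr_ge0//.
  by rewrite lef_pV2 ?posrE// ler_nat ltnS.
have cv := cvg_monotone_convergence (mK cE) mg g0 gnd (mu := limprob).
have -> : \int[limprob]_(x in E) \int[limprob]_y nonneg_kernel (x, y) =
  \int[limprob]_(x in E) limn (g^~ x).
  apply: eq_integral => x /set_mem Ex; rewrite (potkn_pot cE E1 nK (E3 _ Ex)).
  apply/esym/cvg_lim => //.
  rewrite -(pot_shift cE E1 nK (E3 _ Ex)); last by lra.
  have -> : g^~ x = fun n => \int[limprob]_(t in E) (lk x (n.+1%:R^-1) t + (shift4 R)%:E).
    by apply/funext => n; rewrite gE//; exact: E3.
  have -> : \int[limprob]_(t in E) (lk x 0 t + (shift4 R)%:E) =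
     \int[limprob]_(t in E) limn (fun n => lk x (n.+1%:R^-1) t + (shift4 R)%:E).
    apply: eq_integral => t' _; apply/esym/cvg_lim => //.
    apply: cvgeD; [|exact: lk_cvg|exact: cvg_cst].
    by rewrite fin_num_adde_defl.
  apply: cvg_monotone_convergence.
  - exact: mK.
  - by move=> n; apply: emeasurable_funD.
  - by move=> n y Ey; apply: lk_shift_ge0 => //; [exact: E3|exact: Knorm Ey].
  - move=> y _ n m nm; rewrite leeD2r// lk_decr ?invr_ge0//.
    by rewrite lef_pV2 ?posrE// ler_nat ltnS.
apply: (cvge_to_le cv); apply: nearW => n; exact: limprob_pot.
Qed.

End LimitMeasure.

(* Points chosen greedily so that no product of distances is small have bounded
   energy, and so does a weak limit of their counting measures. *)
Lemma polar_small_products (R : realType) (E : set R) : compact E ->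
  E `<=` [set x : R | -1 <= x <= 1] -> E !=set0 ->
  (forall nu : probability R R, prob_on E nu -> energy nu nu = +oo%E) ->
  forall M : R, exists n (t : nat -> R), [/\ (0 < n)%N, forall i, E (t i) &
    forall x, E x -> \prod_(i < n) `|x - t i| <= expR (- (n%:R * M))].
Proof.
move=> cE E1 [e0 Ee0] Einf M; apply: contrapT => no.
wlog M0 : M no / 0 <= M.
  move=> H; apply: (H (Num.max 0 M)) => [[n [t [n0 tE h]]]|]; last by rewrite le_max lexx.
  apply: no; exists n, t; split => // x Ex; apply: (le_trans (h x Ex)).
  by rewrite ler_expR lerN2 ler_wpM2l// le_max lexx orbT.
(* If every point of [E] had a small product of distances to the points of [s], then [s] itself
   would prove the claim. The empty list is exempt since the claim asks for [0 < n]. *)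
have next (s : seq R) : exists x, E x /\ ((forall y, y \in s -> E y) -> s != [::] ->
    expR (- ((size s)%:R * M)) < \prod_(y <- s) `|x - y|).
  have [sE|nsE] := pselect (forall y, y \in s -> E y); last by exists e0; split.
  have [->|sn] := eqVneq s [::]; first by exists e0; split.
  apply: contrapT => nx; apply: no; exists (size s), (fun i => if (i < size s)%N then nth e0 s i else e0).
  split; [by rewrite lt0n size_eq0| |].
    by move=> i; case: ifPn => // hi; apply: sE; exact: mem_nth.
  move=> x Ex; rewrite leNgt; apply/negP => h; apply: nx; exists x; split => // _ _.
  rewrite (big_nth e0) big_mkord; apply: (lt_le_trans h).
  by rewrite le_eqVlt; apply/orP; left; apply/eqP; apply: eq_bigr => i _; rewrite ltn_ord.
pose nx s := projT1 (cid (next s)).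
have nxE s : E (nx s) by rewrite /nx; case: cid => x [].
have nxP (s : seq R) : (forall y, y \in s -> E y) -> s != [::] ->
    expR (- ((size s)%:R * M)) < \prod_(y <- s) `|nx s - y|.
  by rewrite /nx; case: cid => x [].
pose sq := fix sq n := if n is n'.+1 then rcons (sq n') (nx (sq n')) else [::].
pose t n := nx (sq n).
have sqE n : sq n = [seq t i | i <- iota 0 n].
  elim: n => // n IH; rewrite -[in RHS]addn1 iotaD add0n map_cat/= cats1 -IH//.
have sqin n y : y \in sq n -> E y by rewrite sqE => /mapP[i _ ->]; exact: nxE.
have ssz n : size (sq n) = n by rewrite sqE size_map size_iota.
have tP n : (0 < n)%N -> expR (- (n%:R * M)) < \prod_(i < n) `|t n - t i|.
  move=> n0; have e z : \prod_(y <- sq n) `|z - y| = \prod_(i < n) `|z - t i|.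
    by rewrite sqE big_map -(big_mkord xpredT (fun i => `|z - t i|)) /index_iota subn0.
  have := @nxP (sq n) (@sqin n); rewrite ssz -/(t n) e; apply.
  by rewrite -size_eq0 ssz -lt0n.
have tn0 n : (0 < n)%N -> forall i : 'I_n, 0 < `|t n - t i|.
  move=> n0 i; rewrite lt_neqAle normr_ge0 andbT; apply/eqP => h.
  have := tP n n0; rewrite (bigD1 i)//= -h mul0r; apply/negP; rewrite -leNgt.
  exact: expR_ge0.
have tinj i k : (i < k)%N -> t i != t k.
  move=> ik; have := tn0 k (leq_ltn_trans (leq0n i) ik) (Ordinal ik).
  by rewrite normr_gt0 subr_eq0 eq_sym.
have tM k : \sum_(i < k) (ln 5 - ln `|t k - t i|) <= k%:R * (M + ln 5).
  have [->|k0] := eqVneq k 0%N; first by rewrite big_ord0 mul0r.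
  have {}k0 : (0 < k)%N by rewrite lt0n.
  rewrite sumrB sumr_const card_ord -[ln 5 *+ k]mulr_natl mulrDr addrC lerD2r.
  rewrite lerNl -[leLHS]expRK.
  have -> : \sum_(i < k) ln `|t k - t i| = ln (\prod_(i < k) `|t k - t i|).
    by rewrite ln_prod// => i; exact: tn0.
  rewrite ler_ln ?posrE ?expR_gt0 ?prodr_gt0// => [|i _]; last exact: tn0.
  exact: ltW (tP k k0).
have [U [UU ooU]] := @ultraFilterLemma nat \oo _.
have M5 : 0 <= M + ln 5 by rewrite addr_ge0// ln_ge0//; lra.
have := limprob_energy cE E1 M5 tinj (fun i => nxE (sq i)) tM UU ooU.
by rewrite Einf ?leye_eq//; exact: limprob_on.
Qed.

(** * Maximum principle and barriers *)

(** The derivative of [ln (1 + x) - x + x^2 / 2] is [x^2 / (1 + x)], which lies between 0 and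
    [2 x^2] here; the mean value theorem concludes. *)
Lemma ln_taylor2 (R : realType) (u : R) : `|u| <= 1 / 2 ->
  u - u ^+ 2 / 2 - 2 * `|u| ^+ 3 <= ln (1 + u).
Proof.
rewrite ler_norml => /andP[u1 u2].
pose f (x : R) := ln (1 + x) - x + x ^+ 2 / 2.
pose df (x : R) := x ^+ 2 / (1 + x).
have fdf (x : R) : - (1 / 2) <= x -> is_derive x 1 f (df x).
  move=> x1; have x0 : 0 < 1 + x by lra.
  have h1 : is_derive x 1 (fun y : R => ln (1 + y)) ((1 + x)^-1).
    have := @is_derive1_comp R (@ln R) (fun y => 1 + y) x _ _ (is_derive1_ln x0) _.
    move=> /(_ 1); rewrite mulr1; apply; apply: is_derive_eq.
    by rewrite add0r mulr1.
  apply: is_derive_eq; rewrite /df scaler1 /GRing.scale/=.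
  by field; rewrite gt_eqF.
have cont a b : - (1 / 2) <= a -> {within `[a, b], continuous f}.
  move=> a1; apply: continuous_in_subspaceT => x /set_mem /=; rewrite in_itv/= => /andP[ax _].
  apply: differentiable_continuous; apply/derivable1_diffP.
  by have [] := fdf x (le_trans a1 ax).
have f0 : f 0 = 0 by rewrite /f addr0 ln1 expr0n/= mul0r addr0 subr0.
have bound c : - (1 / 2) <= c <= 1 / 2 -> 0 <= df c <= 2 * c ^+ 2.
  move=> /andP[c1 c2]; have c0 : 0 < 1 + c by lra.
  apply/andP; split; first exact: divr_ge0 (sqr_ge0 _) (ltW c0).
  rewrite /df ler_pdivrMr//.
  by have := sqr_ge0 c; nra.
have [u0|u0] := leP 0 u.
  have fd x : x \in `]0, u[%R -> is_derive (x : R) 1 f (df x).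
    by rewrite in_itv/= => /andP[x0 _]; apply: fdf; lra.
  have c0u : {within `[0, u], continuous f} by apply: cont; lra.
  have [c] := MVT_segment u0 fd c0u.
  rewrite in_itv/= => /andP[c0 cu]; rewrite f0 !subr0 => fu.
  have cb : - (1 / 2) <= c <= 1 / 2 by lra.
  have /andP[b0 b1] := bound c cb.
  have : 0 <= f u by rewrite fu mulr_ge0.
  rewrite /f; have : 0 <= `|u| ^+ 3 by rewrite exprn_ge0.
  lra.
have fd x : x \in `]u, 0[%R -> is_derive (x : R) 1 f (df x).
  by rewrite in_itv/= => /andP[x0 _]; apply: fdf; lra.
have [c] := MVT_segment (ltW u0) fd (cont u 0 u1).
rewrite in_itv/= => /andP[cu c0]; rewrite f0 !sub0r => fu.
have cb : - (1 / 2) <= c <= 1 / 2 by lra.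
have /andP[b0 b1] := bound c cb.
have c2 : c ^+ 2 <= u ^+ 2 by nra.
have : df c * - u <= 2 * u ^+ 2 * - u by rewrite ler_wpM2r//; lra.
have -> : 2 * u ^+ 2 * - u = 2 * `|u| ^+ 3 by rewrite ltr0_norm//; ring.
by rewrite /f in fu *; lra.
Qed.

(** The integrand is the Taylor polynomial of [subtaylor] on a circle: all its terms but the
    constant have periodic primitives. *)
Lemma trig_mean (R : realType) (k a b c d : R) :
  (((2 * pi)^-1)%:E * \int[lebesgue_measure]_(t in `[0%R, (2 * pi)%R])
    (k + a * cos t + b * sin t + c * (cos t ^+ 2 - sin t ^+ 2) + d * (cos t * sin t))%:E)%E = k%:E.
Proof.
have p0 : 0 < 2 * pi :> R by rewrite mulr_gt0// pi_gt0.
pose F (t : R) : R := k * t + a * sin t - b * cos t + c * (sin t * cos t) + d / 2 * sin t ^+ 2.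
pose f (t : R) : R := k + a * cos t + b * sin t + c * (cos t ^+ 2 - sin t ^+ 2) + d * (cos t * sin t).
have Ff (t : R) : is_derive t 1 F (f t).
  apply: is_derive_eq; by rewrite /f /GRing.scale/=; field.
have dF (t : R) : derivable F t 1 by have [] := Ff t.
have cF (t : R) : {for t, continuous F}.
  by apply: differentiable_continuous; apply/derivable1_diffP.
have cf : continuous f.
  have df (t : R) : derivable f t 1 by rewrite /f; exact: ex_derive.
  by move=> t; apply: differentiable_continuous; apply/derivable1_diffP.
rewrite (@continuous_FTC2 R f F 0 (2 * pi) p0).
- rewrite -EFinB -EFinM; congr EFin; rewrite /F.
  rewrite mulr_natl sin2pi cos2pi sin0 cos0 -mulr_natl.
  have : (pi : R) != 0 by rewrite gt_eqF// pi_gt0.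
  by move: (pi : R) => p pn; field.
- exact: continuous_subspaceT.
- split => //; [by apply: cvg_at_right_filter; exact: cF|by apply: cvg_at_left_filter; exact: cF].
- by move=> t _; rewrite derive1E; have := Ff t; move=> ft; rewrite derive_val.
Qed.

Lemma ereal_dense (R : realType) (x y : \bar R) : (x < y)%E ->
  exists2 r : R, (x < r%:E)%E & (r%:E < y)%E.
Proof.
case: x y => [x| |] [y| |] //; rewrite ?lte_fin => xy.
- by exists ((x + y) / 2); rewrite lte_fin; lra.
- by exists (x + 1); [rewrite lte_fin ltrDl|exact: ltry].
- by exists (y - 1); [exact: ltNyr|rewrite lte_fin gtrDl ltrN10].
- by exists 0; [exact: ltNyr|exact: ltry].
Qed.

(** The set [D] need not be closed: only levels above [L] are considered, and at a point of [Q]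
    outside [D] the hypothesis says that [F] has upper limit at most [L] there. So the supremum,
    which exceeds [L], cannot be approached only along the missing points. *)
Lemma usc_max (R : realType) (Q D : set (R * R)) (F : R * R -> \bar R) (L : \bar R) :
  compact Q ->
  (forall p, Q p -> forall c, (L < c)%E -> (D p -> (F p < c)%E) ->
     \forall z \near p, Q z -> D z -> (F z < c)%E) ->
  (exists2 z, Q z /\ D z & (L < F z)%E) ->
  exists2 w, Q w /\ D w & (L < F w)%E /\ forall z, Q z -> D z -> (F z <= F w)%E.
Proof.
move=> cQ usc [z0 [Qz0 Dz0] Lz0].
pose S := [set F z | z in Q `&` D].
pose m := ereal_sup S.
have Fm z : Q z -> D z -> (F z <= m)%E by move=> Qz Dz; apply: ereal_sup_ubound; exists z.
have Lm : (L < m)%E by exact: lt_le_trans Lz0 (Fm _ Qz0 Dz0).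
apply: contrapT => no.
have lt z : Q z -> D z -> (F z < m)%E.
  move=> Qz Dz; rewrite lt_neqAle Fm// andbT; apply/eqP => e.
  by apply: no; exists z => //; split; [rewrite e|move=> y Qy Dy; rewrite e; exact: Fm].
(* Levels increasing to the supremum [m]. If [m] were not attained, each point would have a
   neighbourhood below some level [< m], and compactness in its near-covering form yields a common
   one. *)
pose G : set_system (\bar R) := filter_from [set c | (L <= c < m)%E] (fun c => [set c' | (c <= c' < m)%E]).
have FG : Filter G.
  apply: filter_from_filter; first by exists L; rewrite /= lexx Lm.
  move=> i j /= /andP[i1 i2] /andP[j1 j2]; exists (maxe i j).
    by rewrite /= le_max i1/= gt_max i2.
  by move=> c /= /andP[]; rewrite ge_max => /andP[h1 h2] h3; rewrite h1 h2 h3.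
have PG : ProperFilter G.
  by apply: filter_from_proper => i /= /andP[i1 i2]; exists i; rewrite /= lexx i2.
have := (@compact_near_coveringP _ Q).1 cQ _ G (fun c z => Q z -> D z -> (F z < c)%E) FG.
case.
  move=> p Qp.
  have [c0 [Lc0 c0m] Fc0] : exists2 c0, (L < c0)%E /\ (c0 < m)%E & (D p -> (F p < c0)%E).
    have [Dp|nDp] := pselect (D p); last first.
      have [c c1 c2] := ereal_dense Lm.
      by exists c%:E.
    have : (maxe L (F p) < m)%E by rewrite gt_max Lm lt.
    move=> /ereal_dense[c]; rewrite gt_max => /andP[c1 c2] c3.
    by exists c%:E.
  have h := usc p Qp c0 Lc0 Fc0.
  exists ([set z | Q z -> D z -> (F z < c0)%E], [set c' | (c0 <= c' < m)%E]).
    by split => //=; exists c0 => //=; rewrite (ltW Lc0) c0m.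
  move=> [z c] /= [hz /andP[c0c cm]] Qz Dz.
  exact: lt_le_trans (hz Qz Dz) c0c.
move=> c /= /andP[Lc cm] h.
have {}h : forall z, Q z -> D z -> (F z < c)%E.
  by move=> z Qz Dz; apply: (h c) => //=; rewrite cm andbT.
have : (m <= c)%E by apply: ge_ereal_sup => _ [z [Qz Dz] <-]; exact/ltW/h.
by rewrite leNgt cm.
Qed.

Section ComplexPlane.
Variable R : realType.
Implicit Types (K : set R) (h : R -> R -> R).

Definition off K (x y : R) : Prop := ~ (y = 0 /\ K x).

(* Second-order lower Taylor bound whose polynomial part has no mean over circles,
   up to the term [e r^2]: this is all that the maximum principle below uses of
   (sub)harmonicity. *)
Definition subtaylor (e : R) h (x y : R) : Prop :=
  exists a b c d C rho, [/\ 0 < rho, 0 <= C & forall r u v,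
    0 <= r <= rho -> u ^+ 2 + v ^+ 2 = r ^+ 2 ->
    h x y + a * u + b * v + c * (u ^+ 2 - v ^+ 2) + d * (u * v) + e * r ^+ 2 - C * r ^+ 3
      <= h (x + u) (y + v)].

Lemma subtaylorD e1 e2 h1 h2 x y : subtaylor e1 h1 x y -> subtaylor e2 h2 x y ->
  subtaylor (e1 + e2) (fun x y => h1 x y + h2 x y) x y.
Proof.
move=> [a1 [b1 [c1 [d1 [C1 [p1 [p10 C10 H1]]]]]]] [a2 [b2 [c2 [d2 [C2 [p2 [p20 C20 H2]]]]]]].
exists (a1 + a2), (b1 + b2), (c1 + c2), (d1 + d2), (C1 + C2), (Num.min p1 p2).
split; [by rewrite lt_min p10|exact: addr_ge0|].
move=> r u v /andP[r0]; rewrite le_min => /andP[rp1 rp2] uv.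
have h1' := H1 r u v; have h2' := H2 r u v.
rewrite r0 rp1 in h1'; rewrite r0 rp2 in h2'.
have := lerD (h1' erefl uv) (h2' erefl uv).
apply: le_trans; rewrite le_eqVlt; apply/orP; left; apply/eqP; ring.
Qed.

Lemma subtaylorZ k e h x y : 0 <= k -> subtaylor e h x y ->
  subtaylor (k * e) (fun x y => k * h x y) x y.
Proof.
move=> k0 [a [b [c [d [C [p [p0 C0 H]]]]]]].
exists (k * a), (k * b), (k * c), (k * d), (k * C), p; split => //; first exact: mulr_ge0.
move=> r u v rp uv; have := ler_wpM2l k0 (H r u v rp uv).
apply: le_trans; rewrite le_eqVlt; apply/orP; left; apply/eqP; ring.
Qed.

Lemma subtaylor_cst k x y : subtaylor 0 (fun _ _ => k) x y.
Proof.
exists 0, 0, 0, 0, 0, 1; split => // r u v _ _.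
by rewrite !mul0r !addr0 subr0.
Qed.

Lemma subtaylor_saddle z k x y : subtaylor 0 (fun x y => k * ((x - z) ^+ 2 - y ^+ 2)) x y.
Proof.
exists (k * (2 * (x - z))), (- (k * (2 * y))), k, 0, 0, 1; split => // r u v _ _.
by rewrite le_eqVlt; apply/orP; left; apply/eqP; ring.
Qed.

Lemma subtaylor_sqr z k x y : subtaylor k (fun x y => k * ((x - z) ^+ 2 + y ^+ 2)) x y.
Proof.
exists (k * (2 * (x - z))), (k * (2 * y)), 0, 0, 0, 1; split => // r u v _ uv.
by rewrite -uv le_eqVlt; apply/orP; left; apply/eqP; ring.
Qed.

Definition logd (t x y : R) : R := ln ((x - t) ^+ 2 + y ^+ 2) / 2.

(** With [p + i q = (u + i v) / (x - t + i y)] the squared distance is multiplied by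
    [1 + 2 p + p^2 + q^2], and the logarithm of its square root is [p + (q^2 - p^2) / 2] up to a
    cubic term in [r / delta]. *)
Lemma logd_taylor (delta t x y r u v P : R) : 0 < delta -> P = (x - t) ^+ 2 + y ^+ 2 ->
  delta ^+ 2 <= P -> 0 <= r <= delta / 8 -> u ^+ 2 + v ^+ 2 = r ^+ 2 ->
  logd t x y + (x - t) / P * u + y / P * v
    + - ((x - t) ^+ 2 - y ^+ 2) / (2 * P ^+ 2) * (u ^+ 2 - v ^+ 2)
    + - (2 * (x - t) * y) / P ^+ 2 * (u * v) - 16 / delta ^+ 3 * r ^+ 3
  <= logd t (x + u) (y + v).
Proof.
move=> d0 PE dP /andP[r0 rd] uv; set X := x - t in PE *.
have P0 : 0 < P by rewrite (lt_le_trans _ dP)// exprn_gt0.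
pose p := (X * u + y * v) / P.
pose q := (X * v - y * u) / P.
pose k := r / delta.
have k0 : 0 <= k by rewrite divr_ge0// ltW.
have k8 : k <= 1 / 8 by rewrite ler_pdivrMr//; lra.
have pq : p ^+ 2 + q ^+ 2 <= k ^+ 2.
  have -> : p ^+ 2 + q ^+ 2 = r ^+ 2 / P.
    by rewrite -uv /p /q PE; field; rewrite -PE gt_eqF.
  rewrite /k exprMn exprVn ler_wpM2l ?sqr_ge0// lef_pV2 ?posrE ?exprn_gt0//.
have ap : `|p| <= k.
  rewrite -(@ler_pXn2r _ 2) ?nnegrE// real_normK ?num_real//.
  by have := sqr_ge0 q; lra.
pose w := 2 * p + (p ^+ 2 + q ^+ 2).
have p2 : 0 <= p ^+ 2 + q ^+ 2 by rewrite addr_ge0 ?sqr_ge0.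
have kk : k ^+ 2 <= k / 8 by rewrite expr2 -subr_ge0; nra.
have wk : `|w| <= 17 / 8 * k.
  move: ap; rewrite !ler_norml /w; lra.
have w2 : `|w| <= 1 / 2 by apply: (le_trans wk); lra.
have lw : logd t (x + u) (y + v) = logd t x y + ln (1 + w) / 2.
  rewrite /logd -/X -PE -mulrDl -lnM ?posrE//; last by move: w2; rewrite ler_norml; lra.
  congr (ln _ / 2); rewrite /w.
  have -> : p ^+ 2 + q ^+ 2 = (u ^+ 2 + v ^+ 2) / P.
    by rewrite /p /q PE; field; rewrite -PE gt_eqF.
  rewrite /p; have -> : x + u - t = X + u by rewrite /X; ring.
  by rewrite PE; field; rewrite -PE gt_eqF.
have wE : w = 2 * p + (p ^+ 2 + q ^+ 2) by [].
clearbody w; rewrite lw -[leLHS]addrA -!addrA lerD2l !addrA.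
have e1 : X / P * u + y / P * v = p by rewrite /p; field; rewrite gt_eqF.
have e2 : - (X ^+ 2 - y ^+ 2) / (2 * P ^+ 2) * (u ^+ 2 - v ^+ 2)
    + - (2 * X * y) / P ^+ 2 * (u * v) = (q ^+ 2 - p ^+ 2) / 2.
  by rewrite /p /q; field; rewrite gt_eqF.
have e3 : 16 / delta ^+ 3 * r ^+ 3 = 16 * k ^+ 3.
  by rewrite /k; field; rewrite gt_eqF.
rewrite e3 e1 -[X in X - _]addrA e2.
have lt := ln_taylor2 w2.
have w3 : `|w| ^+ 3 <= (17 / 8 * k) ^+ 3 by rewrite lerXn2r// ?nnegrE// mulr_ge0//; lra.
have k3 : 0 <= k ^+ 3 by rewrite exprn_ge0.
have s2 : p ^+ 2 + q ^+ 2 <= k ^+ 2 by [].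
have b1 : `|p * (p ^+ 2 + q ^+ 2)| <= k ^+ 3.
  rewrite normrM (ger0_norm p2); have -> : k ^+ 3 = k * k ^+ 2 by ring.
  by apply: ler_pM.
have b2 : (p ^+ 2 + q ^+ 2) ^+ 2 <= k ^+ 3 / 8.
  apply: (@le_trans _ _ ((k ^+ 2) ^+ 2)); first by rewrite ler_pXn2r ?nnegrE// sqr_ge0.
  rewrite -exprM exprSr; have := mulr_ge0 k3 k0; nra.
have ew : w - w ^+ 2 / 2 = 2 * p + (q ^+ 2 - p ^+ 2) - 2 * (p * (p ^+ 2 + q ^+ 2)) - (p ^+ 2 + q ^+ 2) ^+ 2 / 2.
  by rewrite wE; field.
rewrite ew in lt; move: b1; rewrite ler_norml => /andP[b3 b4].
have e17 : (17 / 8 * k) ^+ 3 = 4913 / 512 * k ^+ 3 by field.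
rewrite e17 in w3.
clear -lt w3 b2 b3 b4 k3; lra.
Qed.

End ComplexPlane.

Section MaximumPrinciple.
Variable R : realType.
Local Open Scope ereal_scope.

Lemma circle_integral_le (b : complex R -> \bar R) (w : complex R) (r k a1 b1 c1 d1 : R) :
  (forall u v : R, (u ^+ 2 + v ^+ 2 = r ^+ 2)%R ->
     b (w + Complex u v)%R <= (k + a1 * u + b1 * v + c1 * (u ^+ 2 - v ^+ 2) + d1 * (u * v))%:E) ->
  ((2 * pi)^-1)%:E * \int[lebesgue_measure]_(t in `[0%R, (2 * pi)%R]) b (circ_pt w r t) <= k%:E.
Proof.
move=> H.
rewrite -(trig_mean k (a1 * r) (b1 * r) (c1 * r ^+ 2) (d1 * r ^+ 2)).
apply: lee_wpmul2l; first by rewrite lee_fin invr_ge0 mulr_ge0// pi_ge0.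
apply: le_integral_nomeas => t _; rewrite /circ_pt.
apply: (le_trans (H _ _ _)).
  by rewrite !exprMn -mulrDr cos2Dsin2 mulr1.
rewrite lee_fin le_eqVlt; apply/orP; left; apply/eqP; ring.
Qed.

Variables (K : set R) (U : set (complex R)) (b : complex R -> \bar R).
Hypotheses (UK : forall z, U z -> off K (complex.Re z) (complex.Im z)).
Hypothesis bneg : forall z, U z -> b z < 0.
Hypothesis busc : usc_on U b.
Hypothesis bsub : submean_on U b.

Variables (q0 r0 : R).
Definition square (z : R * R) : Prop := (`|z.1 - q0| <= r0 /\ `|z.2| <= r0)%R.

Lemma compact_square : compact square.
Proof.
have -> : square = `[(q0 - r0)%R, (q0 + r0)%R]%classic `*` `[(- r0)%R, r0]%classic.
  by apply/seteqP; split => [[x y]|[x y]]; rewrite /square /= !in_itv/= !ler_norml => -[h1 h2]; split; lra.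
by apply: compact_setX; exact: segment_compact.
Qed.

Hypothesis QU : forall x y, square (x, y) -> off K x y -> U (Complex x y).

Lemma cmod_le_sum (x y : R) : (cmod (Complex x y) <= `|x| + `|y|)%R.
Proof.
rewrite /cmod/= -(@ler_pXn2r _ 2) ?nnegrE ?sqrtr_ge0 ?addr_ge0//.
rewrite sqr_sqrtr ?addr_ge0 ?sqr_ge0// sqrrD !real_normK ?num_real//.
have : (0 <= `|x| * `|y|)%R by rewrite mulr_ge0.
rewrite -mulr_natl; lra.
Qed.

Variables (Phi : R -> R -> R) (A e L : R).
Hypotheses (A0 : (0 < A)%R) (e0 : (0 < e)%R).
Hypothesis Phi_strict : forall x y, square (x, y) -> off K x y -> subtaylor e Phi x y.
Hypothesis Phi_usc : forall x y, square (x, y) -> off K x y -> forall c : R, (Phi x y < c)%R ->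
  exists2 d : R, (0 < d)%R & forall x' y', (`|x - x'| < d)%R -> (`|y - y'| < d)%R ->
    off K x' y' -> (Phi x' y' < c)%R.
Hypothesis Phi_K : forall x, square (x, 0%R) -> K x -> forall c : R, (L < c)%R ->
  exists2 d : R, (0 < d)%R & forall x' y', (`|x - x'| < d)%R -> (`|0 - y'| < d)%R ->
    off K x' y' -> (Phi x' y' < c)%R.
Hypothesis bdry : forall x y, square (x, y) -> off K x y ->
  (`|x - q0| = r0 \/ `|y| = r0)%R ->
  (Phi x y)%:E + A%:E * b (Complex x y) <= L%:E.

(** At an interior maximum [w] of [Phi + A b], the Taylor bound for [Phi] bounds [b] on a small
    circle above by a polynomial of mean [b w - (e r^2 - C r^3) / A]. This is less than [b w],
    against the submean inequality. *)
Lemma maximum_principle x y : square (x, y) -> off K x y ->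
  (Phi x y)%:E + A%:E * b (Complex x y) <= L%:E.
Proof.
move=> Qxy oxy; rewrite leNgt; apply/negP => Lxy.
pose F (z : R * R) := (Phi z.1 z.2)%:E + A%:E * b (Complex z.1 z.2).
pose D (z : R * R) := off K z.1 z.2.
have A0' : (0 <= A%:E :> \bar R) by rewrite lee_fin ltW.
have [||[wx wy] [/= Qw Dw] [Lw wmax]] := @usc_max R square D F L%:E compact_square; last first.
- have Uw := QU Qw Dw.
  have bw0 := bneg Uw.
  have [bw bwE] : exists bw : R, b (Complex wx wy) = bw%:E.
    move: Lw bw0; rewrite /F/=; case: (b (Complex wx wy)) => [r| |]//; first by exists r.
    by rewrite gt0_muleNy ?lte_fin// addeNy.
  have Fw : F (wx, wy) = (Phi wx wy + A * bw)%:E by rewrite /F/= bwE -EFinM -EFinD.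
  have nb : (`|wx - q0| < r0 /\ `|wy| < r0)%R.
    case: (Qw) => /= q1 q2; split; rewrite lt_neqAle ?q1 ?q2 andbT; apply/eqP => h.
      by have := bdry Qw Dw (or_introl h); rewrite leNgt Lw.
    by have := bdry Qw Dw (or_intror h); rewrite leNgt Lw.
  have [rho rho0 [rhoU sub]] := bsub Uw.
  have [a [b1 [c [d [C [p [p0 C0 T]]]]]]] := Phi_strict Qw Dw.
  (* The circle must lie in the disc of the submean inequality, in the range of the Taylor bound and
     in the square, and must satisfy [C r < e]. *)
  pose s := Num.min rho (Num.min p (Num.min (r0 - `|wx - q0|) (Num.min (r0 - `|wy|) (e / (C + 1)))))%R.
  have C1 : (0 < C + 1)%R by lra.
  have s0 : (0 < s)%R by rewrite /s !lt_min rho0 p0 !subr_gt0 nb.1 nb.2 divr_gt0.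
  pose r := (s / 2)%R.
  have r_gt0 : (0 < r)%R by rewrite divr_gt0.
  have rs : (r < s)%R by rewrite ltr_pdivrMr//; lra.
  have := rs; rewrite {1}/s !lt_min => /and5P[r1 r2 r3 r4 r5].
  have := sub r (ltW r_gt0) r1; rewrite bwE.
  apply/negP; rewrite -ltNge.
  have eC : (e * r ^+ 2 - C * r ^+ 3 > 0)%R.
    move: r5; rewrite ltr_pdivlMr// => r5.
    have : (0 < r ^+ 2)%R by rewrite exprn_gt0.
    have -> : (e * r ^+ 2 - C * r ^+ 3 = r ^+ 2 * (e - r * C))%R by ring.
    by move=> r20; rewrite mulr_gt0//; lra.
  pose k := (bw - (e * r ^+ 2 - C * r ^+ 3) / A)%R.
  apply: (@le_lt_trans _ _ k%:E); last by rewrite lte_fin /k ltrBlDr ltrDl divr_gt0.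
  apply: (@circle_integral_le b _ r k (- a / A) (- b1 / A) (- c / A) (- d / A)) => u v uv.
  have ur : (`|u| <= r)%R.
    rewrite -(@ler_pXn2r _ 2) ?nnegrE// ?(ltW r_gt0)// real_normK ?num_real//.
    by rewrite -uv lerDl sqr_ge0.
  have vr : (`|v| <= r)%R.
    rewrite -(@ler_pXn2r _ 2) ?nnegrE// ?(ltW r_gt0)// real_normK ?num_real//.
    by rewrite -uv lerDr sqr_ge0.
  have zE : (Complex wx wy + Complex u v = Complex (wx + u) (wy + v))%R by [].
  rewrite zE.
  have Uz : U (Complex (wx + u)%R (wy + v)%R).
    apply: rhoU; rewrite /cmod/=.
    have -> : (wx + u - wx = u)%R by ring. have -> : (wy + v - wy = v)%R by ring.
    by rewrite uv sqrtr_sqr gtr0_norm.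
  have oz := UK Uz; rewrite /= in oz.
  have Qz : square (wx + u, wy + v)%R.
    split => /=.
      have -> : (wx + u - q0 = (wx - q0) + u)%R by ring.
      by rewrite (le_trans (ler_normD _ _))//; lra.
    by rewrite (le_trans (ler_normD _ _))//; lra.
  have := wmax _ Qz oz; rewrite Fw /F/=.
  have Tz := T r u v; rewrite (ltW r_gt0) (ltW r2) in Tz.
  have {}Tz := Tz erefl uv.
  case: (b (Complex (wx + u)%R (wy + v)%R)) => [bz| |].
  + rewrite -EFinM -EFinD !lee_fin => h.
    rewrite /k -(@ler_pM2l _ A)// !mulrDr mulrN.
    have f1 g : (A * (- g / A) = - g)%R by field; rewrite gt_eqF.
    have f2 g z : (A * (- g / A * z) = - g * z)%R by field; rewrite gt_eqF.
    have f3 g : (A * (g / A) = g)%R by field; rewrite gt_eqF.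
    rewrite !f2 f3; lra.
  + by rewrite gt0_muley ?lte_fin// addey.
  + by rewrite leNye.
- by exists (x, y).
move=> [px py] Qp c Lc Fc /=.
have nearby (d : R) : (0 < d)%R -> (forall x' y', (`|px - x'| < d)%R -> (`|py - y'| < d)%R ->
    square (x', y') -> off K x' y' -> F (x', y') < c) ->
    \forall z \near (px, py), square z -> D z -> F z < c.
  move=> d0 h; apply/nbhs_ballP; exists d => //= -[x' y'] [/= h1 h2] Qz Dz.
  by apply: h.
have [Dp|nDp] := pselect (D (px, py)); last first.
  have [py0 Kp] : py = 0%R /\ K px by exact: contrapT.
  have [c' Lc' cc'] := ereal_dense Lc.
  rewrite py0 in Qp.
  have [d d0 hd] := Phi_K Qp Kp Lc'.
  apply: (nearby d d0) => x' y' h1 h2 Qz Dz.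
  rewrite py0 in h2; have Uz := QU Qz Dz.
  apply: le_lt_trans cc'; rewrite /F/=.
  apply: (@le_trans _ _ (Phi x' y')%:E); last by rewrite lee_fin ltW// hd.
  rewrite -[leRHS]adde0 leeD2l//.
  by rewrite mule_ge0_le0// ltW// bneg.
have Up := QU Qp Dp.
have {}Fc := Fc Dp.
have [c1 c1P [c2 [h2 h3]]] : exists2 c1 : R, (Phi px py < c1)%R &
  exists c2 : R, b (Complex px py) < c2%:E /\ (c1 + A * c2)%:E < c.
  move: Fc (bneg Up); rewrite /F/=; case: (b (Complex px py)) => [r| |]//.
    rewrite -EFinM -EFinD => /ereal_dense[c' c1' c2'] _.
    rewrite lte_fin in c1'; set g := (c' - (Phi px py + A * r))%R.
    have g0 : (0 < g)%R by rewrite subr_gt0.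
    exists (Phi px py + g / 2)%R; first by rewrite ltrDl divr_gt0.
    exists (r + g / (2 * A))%R; rewrite lte_fin ltrDl divr_gt0 ?mulr_gt0//; split => //.
    have -> : (Phi px py + g / 2 + A * (r + g / (2 * A)) = c')%R.
      by rewrite /g; field; rewrite gt_eqF.
    exact: c2'.
  move=> _ _; have [c' c1' c2'] := ereal_dense Lc.
  exists (Phi px py + 1)%R; first by rewrite ltrDl.
  exists ((c' - (Phi px py + 1)) / A)%R; rewrite ltNyr; split => //.
  have -> : (Phi px py + 1 + A * ((c' - (Phi px py + 1)) / A) = c')%R.
    by field; rewrite gt_eqF.
  exact: c2'.
have [d1 d10 hd1] := Phi_usc Qp Dp c1P.
have [d2 d20 hd2] := busc Up h2.
apply: (nearby (Num.min d1 (d2 / 2))%R); first by rewrite lt_min d10 divr_gt0.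
move=> x' y'; rewrite !lt_min => /andP[x1 x2] /andP[y1 y2] Qz Dz.
have Uz := QU Qz Dz.
have p1 := hd1 x' y' x1 y1 Dz.
have p2 : b (Complex x' y') < c2%:E.
  apply: hd2 => //; apply: (le_lt_trans (cmod_le_sum _ _)).
  by rewrite distrC [`|y' - py|%R]distrC; lra.
apply: (lt_trans _ h3); rewrite /F/= EFinD EFinM lteD ?lte_fin//.
by rewrite lte_pmul2l.
Qed.

End MaximumPrinciple.

(** * Comparison with a barrier near a point of [K] *)

Section BarrierComparison.
Variable R : realType.
Implicit Types (x y : R).

Lemma subtaylor_logd (K : set R) (t x y : R) : K t -> off K x y -> subtaylor 0 (logd t) x y.
Proof.
move=> Kt oxy; set P := (x - t) ^+ 2 + y ^+ 2.
have P0 : 0 < P.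
  rewrite lt_neqAle addr_ge0 ?sqr_ge0// andbT eq_sym.
  apply/negP; rewrite paddr_eq0 ?sqr_ge0// !sqrf_eq0 subr_eq0 => /andP[/eqP xt /eqP y0].
  by apply: oxy; rewrite xt.
have d0 : 0 < Num.sqrt P by rewrite sqrtr_gt0.
exists ((x - t) / P), (y / P), (- ((x - t) ^+ 2 - y ^+ 2) / (2 * P ^+ 2)),
  (- (2 * (x - t) * y) / P ^+ 2), (16 / Num.sqrt P ^+ 3), (Num.sqrt P / 8).
split; [by rewrite divr_gt0|by rewrite divr_ge0// exprn_ge0// ltW|].
move=> r u v rd uv; rewrite mul0r addr0.
by apply: logd_taylor => //; rewrite sqr_sqrtr// ltW.
Qed.

Lemma subtaylor_sum (f : nat -> R -> R -> R) n x y :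
  (forall i, subtaylor 0 (f i) x y) ->
  subtaylor 0 (fun x y => \sum_(i < n) f i x y) x y.
Proof.
move=> H; elim: n => [|n IH].
  have -> : (fun x y : R => \sum_(i < 0) f i x y) = fun _ _ => 0.
    by apply/funext => u; apply/funext => v; rewrite big_ord0.
  exact: subtaylor_cst.
have -> : (fun x y : R => \sum_(i < n.+1) f i x y) = fun x y => \sum_(i < n) f i x y + f n x y.
  by apply/funext => u; apply/funext => v; rewrite big_ord_recr.
by have := subtaylorD IH (H n); rewrite addr0.
Qed.

Definition uscL (f : R -> R -> R) x y : Prop := exists2 C : R, 0 <= C &
  forall x' y', `|x - x'| <= 1 -> `|y - y'| <= 1 ->
    f x' y' <= f x y + C * (`|x - x'| + `|y - y'|).

Lemma uscLD f g x y : uscL f x y -> uscL g x y -> uscL (fun x y => f x y + g x y) x y.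
Proof.
move=> [C C0 H] [C' C'0 H']; exists (C + C'); first exact: addr_ge0.
by move=> x' y' h1 h2; have := H _ _ h1 h2; have := H' _ _ h1 h2; lra.
Qed.

Lemma uscL_cst k x y : uscL (fun _ _ => k) x y.
Proof. by exists 0 => // x' y' _ _; rewrite mul0r addr0. Qed.

Lemma uscL_quad z k l x y : uscL (fun x y => k * (x - z) ^+ 2 + l * y ^+ 2) x y.
Proof.
exists (`|k| * (2 * `|x - z| + 1) + `|l| * (2 * `|y| + 1)).
  by rewrite addr_ge0// mulr_ge0// addr_ge0// mulr_ge0.
move=> x' y' h1 h2.
have key (m a a' : R) : `|a - a'| <= 1 ->
    m * a' ^+ 2 <= m * a ^+ 2 + `|m| * (2 * `|a| + 1) * `|a - a'|.
  move=> h; rewrite -lerBlDl -mulrBr.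
  apply: (le_trans (ler_norm _)); rewrite normrM -mulrA ler_wpM2l//.
  have -> : a' ^+ 2 - a ^+ 2 = (a' - a) * (2 * a + (a' - a)) by ring.
  rewrite normrM distrC mulrC ler_wpM2r//.
  apply: (le_trans (ler_normD _ _)); rewrite normrM ger0_norm// lerD2l distrC//.
have e : x - x' = (x - z) - (x' - z) by ring.
have := key k (x - z) (x' - z); rewrite -e => /(_ h1).
have := key l y y' h2.
set X := `|x - x'|; set Y := `|y - y'|; set a := `|k| * _; set b := `|l| * _.
have X0 : 0 <= X by exact: normr_ge0. have Y0 : 0 <= Y by exact: normr_ge0.
have a0 : 0 <= a by rewrite mulr_ge0// addr_ge0// mulr_ge0.
have b0 : 0 <= b by rewrite mulr_ge0// addr_ge0// mulr_ge0.
have := mulr_ge0 a0 Y0; have := mulr_ge0 b0 X0; lra.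
Qed.

Lemma off_dist_gt0 (K : set R) (t x y : R) : K t -> off K x y -> 0 < (x - t) ^+ 2 + y ^+ 2.
Proof.
move=> Kt oxy; rewrite lt_neqAle addr_ge0 ?sqr_ge0// andbT eq_sym.
apply/negP; rewrite paddr_eq0 ?sqr_ge0// !sqrf_eq0 subr_eq0 => /andP[/eqP xt /eqP y0].
by apply: oxy; rewrite xt.
Qed.

Lemma logd_usc (K : set R) (t x y : R) : K t -> off K x y -> exists2 C : R, 0 <= C &
  forall x' y', off K x' y' -> `|x - x'| <= 1 -> `|y - y'| <= 1 ->
    logd t x' y' <= logd t x y + C * (`|x - x'| + `|y - y'|).
Proof.
move=> Kt oxy; have P0 := off_dist_gt0 Kt oxy.
have [C C0 H] := uscL_quad t 1 1 x y.
exists (C / ((x - t) ^+ 2 + y ^+ 2) / 2); first by rewrite !divr_ge0// ltW.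
move=> x' y' oxy' h1 h2; have P0' := off_dist_gt0 Kt oxy'.
have := H x' y' h1 h2; rewrite !mul1r /logd => hh.
have := ln_le_tangent P0' P0.
set P := (x - t) ^+ 2 + y ^+ 2 in P0 hh *; set P' := (x' - t) ^+ 2 + y' ^+ 2 in P0' hh *.
set D := `|x - x'| + `|y - y'| in hh *.
have : P' / P - 1 <= C / P * D.
  rewrite lerBlDr ler_pdivrMr//.
  have -> : (C / P * D + 1) * P = C * D + P by field; rewrite gt_eqF.
  lra.
lra.
Qed.

Variables (K : set R) (q0 : R).
Hypotheses (K1 : K `<=` [set x : R | -1 <= x <= 1]) (Kq0 : K q0).
Variables (N : set (complex R)) (b : complex R -> \bar R).
Hypotheses (oN : Defs.openC N) (Nq0 : N (cR q0)).
Let U := N `&` compl_C K.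
Hypotheses (bsub : subharmonic_on U b) (bneg : forall z, U z -> (b z < 0)%E).
Hypothesis blim : forall e : R, 0 < e -> exists2 d : R, 0 < d &
  forall z, U z -> cmod (z - cR q0) < d -> ((- e)%:E < b z)%E.

Variables (h : R -> R -> R) (Mh eta : R).
Hypotheses (Mh0 : 0 <= Mh) (eta0 : 0 <= eta).
Hypothesis h_taylor : forall x y, off K x y -> subtaylor 0 h x y.
Hypothesis h_usc : forall x y, off K x y -> forall c : R, h x y < c ->
  exists2 d : R, 0 < d & forall x' y', `|x - x'| < d -> `|y - y'| < d ->
    off K x' y' -> h x' y' < c.
Hypothesis h_bound : forall x y, `|x - q0| <= 1 -> `|y| <= 1 -> off K x y -> h x y <= Mh.
Variable E : set R.
Hypothesis E_polar : forall M : R, exists n (t : nat -> R), [/\ (0 < n)%N, forall i, K (t i) &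
    forall x, E x -> \prod_(i < n) `|x - t i| <= expR (- (n%:R * M))].
Hypothesis h_K : forall x, K x -> ~ E x -> exists2 d : R, 0 < d &
  forall x' y', `|x - x'| < d -> `|y'| < d -> off K x' y' -> h x' y' <= eta.

Lemma barrier_radius : exists2 r0 : R, 0 < r0 <= 1 / 2 &
  forall x y, square q0 r0 (x, y) -> off K x y -> U (Complex x y).
Proof.
have [d d0 hd] := oN Nq0.
exists (Num.min (1 / 2) (d / 3)); first by rewrite lt_min ge_min lexx/= !divr_gt0.
move=> x y [/= h1 h2] oxy; split => //; apply: hd.
rewrite /cR; apply: (le_lt_trans (cmod_le_sum _ _)).
move: h1 h2; rewrite !le_min => /andP[_ h1] /andP[_ h2]; rewrite oppr0 addr0; lra.
Qed.

(** The part of the square with [|y| >= r0 / 2] is compact and avoids the line, so the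
    semicontinuous [b] attains there a negative maximum. If [b] is [-oo] throughout, any constant
    serves. *)
Lemma barrier_bound r0 : 0 < r0 -> (forall x y, square q0 r0 (x, y) -> off K x y -> U (Complex x y)) ->
  exists2 m0 : R, 0 < m0 & forall x y, square q0 r0 (x, y) -> r0 / 2 <= `|y| ->
    (b (Complex x y) <= (- m0)%:E)%E.
Proof.
move=> r00 QU.
pose Q' : set (R * R) := [set z | square q0 r0 z /\ r0 / 2 <= `|z.2|].
have offQ z : Q' z -> off K z.1 z.2.
  by move=> [_ yz] [y0 _]; move: yz; rewrite y0 normr0; lra.
have UQ z : Q' z -> U (Complex z.1 z.2).
  by move=> Qz; apply: QU; [case: z Qz => x y [] |exact: offQ].
have cQ' : compact Q'.
  apply: (@subclosed_compact _ Q' (square q0 r0)); last by move=> z [].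
    have -> : Q' = square q0 r0 `&` (fun z : R * R => `|z.2|) @^-1` [set y | r0 / 2 <= y] by [].
    apply: closedI; first by apply: compact_closed => //; exact: compact_square.
    apply: closed_comp; last exact: closed_ge.
    by move=> z _; apply: continuous_comp; [exact: cvg_snd|exact: norm_continuous].
  exact: compact_square.
have [[z1 [Qz1 hz1]]|no] := pselect (exists z, Q' z /\ (-oo < b (Complex z.1 z.2))%E); last first.
  exists 1 => // x y Qxy yr; suff -> : b (Complex x y) = -oo%E by rewrite leNye.
  apply/eqP; rewrite -leeNy_eq leNgt; apply/negP => hb; apply: no.
  by exists (x, y).
have [||w [Qw _] [Lw wmax]] := @usc_max R Q' setT (fun z => b (Complex z.1 z.2)) -oo%E cQ'.
- move=> [px py] Qp c _ /(_ Logic.I) /= bc.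
  have [c' bc' c'c] := ereal_dense bc.
  have [d d0 hd] := (bsub.2.2.1) _ (UQ _ Qp) c' bc'.
  apply/nbhs_ballP; exists (d / 2); first by rewrite /= divr_gt0.
  move=> [x' y'] [/= h1 h2] Qz _; apply: lt_trans c'c; apply: hd; first exact: (UQ _ Qz).
  apply: (le_lt_trans (cmod_le_sum _ _)).
  by rewrite distrC [`|y' - py|]distrC; move: h1 h2; rewrite /ball/=; lra.
- by exists z1.
have bw := bneg (UQ _ Qw).
exists (- fine (b (Complex w.1 w.2))).
  by move: bw Lw; case: (b _) => [r| |]//=; rewrite lte_fin oppr_gt0.
move=> x y Qxy yr; rewrite opprK fineK; first exact: (wmax (x, y)).
by move: bw Lw; case: (b _) => [r| |].
Qed.

Section eps.
Variables (r0 m0 A B e1 e2 : R).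
Hypotheses (r00 : 0 < r0) (r01 : r0 <= 1 / 2) (m00 : 0 < m0) (A0 : 0 < A) (B0 : 0 <= B).
Hypothesis QU : forall x y, square q0 r0 (x, y) -> off K x y -> U (Complex x y).
Hypothesis bm : forall x y, square q0 r0 (x, y) -> r0 / 2 <= `|y| ->
    (b (Complex x y) <= (- m0)%:E)%E.
Hypothesis AP : Mh + B * r0 ^+ 2 <= A * m0.
Hypothesis BP : Mh <= B * (3 / 4 * r0 ^+ 2).
Hypotheses (e10 : 0 < e1) (e20 : 0 < e2).
Variables (n : nat) (t : nat -> R).
Hypotheses (n0 : (0 < n)%N) (Kt : forall i, K (t i)).
Hypothesis tE : forall x, E x ->
  \prod_(i < n) `|x - t i| <= expR (- (n%:R * (2 + (Mh + B + 2 * e2) / e1))).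

Let logs x y := (e1 / n%:R) * \sum_(i < n) logd (t i) x y.
Let quad x y := (e2 - B) * (x - q0) ^+ 2 + (e2 + B) * y ^+ 2.
(** To [h] are added a small logarithmic potential, lowered by [e1 ln 4] so as to be nonpositive on
    the square, the saddle [- B ((x - q0)^2 - y^2)], and [e2 |z - q0|^2], which supplies the strict
    subharmonicity required by [maximum_principle]. *)
Let Phi x y := h x y + (logs x y + (- (e1 * ln 4) + quad x y)).

Let n0' : 0 < n%:R :> R. Proof. by rewrite ltr0n. Qed.

Lemma Phi_taylor x y : off K x y -> subtaylor e2 Phi x y.
Proof.
move=> oxy.
have q1 : subtaylor e2 quad x y.
  have -> : quad = fun u v => - B * ((u - q0) ^+ 2 - v ^+ 2) + e2 * ((u - q0) ^+ 2 + v ^+ 2).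
    by apply/funext => u; apply/funext => v; rewrite /quad; ring.
  by have := subtaylorD (subtaylor_saddle q0 (- B) x y) (subtaylor_sqr q0 e2 x y); rewrite add0r.
have l1 : subtaylor 0 logs x y.
  have := @subtaylorZ _ (e1 / n%:R) 0 _ x y _ (@subtaylor_sum (fun i => logd (t i)) n x y _).
  rewrite mulr0; apply; first by rewrite divr_ge0// ltW.
  by move=> i; exact: subtaylor_logd (Kt i) oxy.
have := subtaylorD (h_taylor oxy) (subtaylorD l1 (subtaylorD (subtaylor_cst (- (e1 * ln 4)) x y) q1)).
by rewrite !add0r.
Qed.

Lemma logs_le x y : off K x y -> `|x - q0| <= 1 -> `|y| <= 1 -> logs x y <= e1 * ln 4.
Proof.
move=> oxy x1 y1; rewrite /logs -mulrA ler_pM2l// mulrC ler_pdivrMr//.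
rewrite -[leRHS](_ : \sum_(i < n) ln 4 = _); last by rewrite sumr_const card_ord mulr_natr.
apply: ler_sum => i _; rewrite /logd ler_pdivrMr// mulr_natr -lnXn// ler_ln ?posrE ?exprn_gt0//; last first.
  exact: (off_dist_gt0 (Kt i) oxy).
have -> : (4 : R) ^+ 2 = 16 by rewrite expr2; ring.
have t1 := K1 (Kt i); have q1 := K1 Kq0; rewrite /= in t1 q1.
rewrite ler_norml in x1; rewrite ler_norml in y1.
have a1 : (x - t i) ^+ 2 <= 3 ^+ 2.
  by rewrite -(real_normK (num_real (x - t i))) ler_pXn2r ?nnegrE// ler_norml; lra.
have a2 : y ^+ 2 <= 1 ^+ 2.
  by rewrite -(real_normK (num_real y)) ler_pXn2r ?nnegrE// ler_norml; lra.
lra.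
Qed.

Lemma logs_lip x y : off K x y -> exists2 C : R, 0 <= C &
  forall x' y', off K x' y' -> `|x - x'| <= 1 -> `|y - y'| <= 1 ->
    logs x' y' <= logs x y + C * (`|x - x'| + `|y - y'|).
Proof.
move=> oxy; rewrite /logs; have e0 : 0 <= e1 / n%:R by rewrite divr_ge0// ltW.
set e := e1 / n%:R in e0 *.
elim: (n) => [|k [C C0 IH]].
  by exists 0 => // x' y' _ _ _; rewrite !big_ord0 !mul0r !addr0.
have [C' C'0 H'] := logd_usc (Kt k) oxy.
exists (C + e * C'); first by rewrite addr_ge0// mulr_ge0.
move=> x' y' o' h1 h2; rewrite !big_ord_recr/= !mulrDr.
have := ler_wpM2l e0 (H' _ _ o' h1 h2); have := IH _ _ o' h1 h2.
lra.
Qed.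

Lemma square_region x y : square q0 r0 (x, y) -> `|x - q0| <= 1 /\ `|y| <= 1.
Proof. by move=> [/=]; move: r01 => r01' h1 h2; split; lra. Qed.

Lemma Phi_usc x y : off K x y -> forall c : R, Phi x y < c ->
  exists2 d : R, 0 < d & forall x' y', `|x - x'| < d -> `|y - y'| < d ->
    off K x' y' -> Phi x' y' < c.
Proof.
move=> oxy c hc; set g := c - Phi x y; have g0 : 0 < g by rewrite subr_gt0.
have [|d1 d10 hd1] := @h_usc x y oxy (h x y + g / 3); first by rewrite ltrDl divr_gt0.
have [C1 C10 HC1] := logs_lip oxy.
have [C2 C20 HC2] := uscL_quad q0 (e2 - B) (e2 + B) x y.
pose d := Num.min d1 (Num.min 1 (g / (6 * (C1 + C2 + 1)))).
have C3 : 0 < 6 * (C1 + C2 + 1) by lra.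
exists d; first by rewrite /d !lt_min d10 ltr01 divr_gt0.
move=> x' y'; rewrite /d !lt_min => /and3P[a1 a2 a3] /and3P[b1 b2 b3] o'.
have := hd1 _ _ a1 b1 o'; have := HC1 _ _ o' (ltW a2) (ltW b2); have := HC2 _ _ (ltW a2) (ltW b2).
rewrite ltr_pdivlMr// in a3; rewrite ltr_pdivlMr// in b3.
have X0 : 0 <= `|x - x'| by []. have Y0 : 0 <= `|y - y'| by [].
move: (`|x - x'|) (`|y - y'|) a3 b3 X0 Y0 => X Y a3 b3 X0 Y0.
have hX : (C1 + C2) * (X + Y) <= g / 3 by nra.
have gE : c = Phi x y + g by rewrite /g; ring.
rewrite -/(quad x y) -/(quad x' y') gE /Phi; lra.
Qed.

Lemma quad_le x y : `|x - q0| <= 1 -> `|y| <= 1 -> quad x y <= B + 2 * e2.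
Proof.
move=> x1 y1; have a1 : (x - q0) ^+ 2 <= 1.
  by rewrite -(real_normK (num_real (x - q0))) exprn_ile1.
have a2 : y ^+ 2 <= 1 by rewrite -(real_normK (num_real y)) exprn_ile1.
have := sqr_ge0 (x - q0); have := sqr_ge0 y; rewrite /quad.
by move: B0 (ltW e20) => B0' e20'; nra.
Qed.

Lemma prod_near x : E x -> exists2 d : R, 0 < d & forall x' y', `|x - x'| < d -> `|y'| < d ->
  \prod_(i < n) ((x' - t i) ^+ 2 + y' ^+ 2) <
    expR (- (n%:R * (1 + (Mh + B + 2 * e2) / e1))) ^+ 2.
Proof.
move=> Ex; pose f (z : R * R) := \prod_(i < n) ((z.1 - t i) ^+ 2 + z.2 ^+ 2).
have cf : f z @[z --> (x, 0 : R)] --> f (x, 0).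
  apply: cvg_big => [|i _]; first exact: mul_continuous.
  apply: cvgD.
    apply: (@continuous_cvg _ _ _ _ _ (fun z : R * R => z.1 - t i) (fun a : R => a ^+ 2)).
      exact: exprn_continuous.
    by apply: cvgB; [exact: cvg_fst|exact: cvg_cst].
  apply: (@continuous_cvg _ _ _ _ _ (fun z : R * R => z.2) (fun a : R => a ^+ 2)).
    exact: exprn_continuous.
  exact: cvg_snd.
set V := expR _ ^+ 2.
have fV : f (x, 0) < V.
  rewrite /f/= (eq_bigr (fun i : 'I_n => `|x - t i| ^+ 2)); last first.
    by move=> i _; rewrite expr0n/= addr0 real_normK// num_real.
  rewrite prodrXl; apply: (@le_lt_trans _ _ (expR (- (n%:R * (2 + (Mh + B + 2 * e2) / e1))) ^+ 2)).
    by rewrite lerXn2r ?nnegrE ?expR_ge0 ?prodr_ge0// tE.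
  rewrite ltrXn2r// ?expR_ge0// ltr_expR ltrN2 ltr_pM2l// ltrD2r; lra.
have : nbhs ((x, 0) : R * R) (fun z => f z < V) by exact: (@cvgr_lt _ _ _ _ _ _ cf _ fV).
move=> /(nbhs_ballP ((x, 0) : R * R)) [d /= d0 hd]; exists d => // x' y' h1 h2.
apply: (hd (x', y')); split => //=; rewrite /ball/= sub0r normrN//.
Qed.

(** Near [E] the logarithmic term is below [- e1 - (Mh + B + 2 e2)] and outweighs all others; of the
    constant [2 + ...] in [tE], one unit is spent on leaving the line and the other gives [- e1].
    Near the rest of [K] one has [h <= eta] and, at height 0, the quadratic part is at most
    [e2 r0^2]. *)
Lemma Phi_atK x : square q0 r0 (x, 0) -> K x -> forall c : R, eta + 2 * e2 * r0 ^+ 2 < c ->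
  exists2 d : R, 0 < d & forall x' y', `|x - x'| < d -> `|0 - y'| < d ->
    off K x' y' -> Phi x' y' < c.
Proof.
move=> [/= xq _] Kx c Lc.
have r2 : 0 < r0 ^+ 2 by rewrite exprn_gt0.
have L0 : 0 <= eta + 2 * e2 * r0 ^+ 2 by rewrite addr_ge0// !mulr_ge0// ltW.
have reg x' y' : `|x - x'| < 1 / 2 -> `|0 - y'| < 1 / 2 -> `|x' - q0| <= 1 /\ `|y'| <= 1.
  move: xq; rewrite sub0r normrN !ler_norml !ltr_norml => xq h1 h2; split.
    by move: xq h1 r01; case/andP => ? ? /andP[? ?] ?; lra.
  by move: h2 => /andP[? ?]; lra.
have [Ex|nEx] := pselect (E x).
  have [d d0 hd] := prod_near Ex.
  exists (Num.min d (1 / 2)); first by rewrite lt_min d0 divr_gt0.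
  move=> x' y'; rewrite !lt_min => /andP[h1 h2] /andP[h3 h4] o'.
  have [x1 y1] := reg _ _ h2 h4.
  have hp := hd x' y' h1; rewrite sub0r normrN in h3; have {}hp := hp h3.
  have hl : logs x' y' <= - e1 - (Mh + B + 2 * e2).
    rewrite /logs; have -> : \sum_(i < n) logd (t i) x' y' =
        ln (\prod_(i < n) ((x' - t i) ^+ 2 + y' ^+ 2)) / 2.
      rewrite ln_prod ?mulr_suml// => i; exact: off_dist_gt0 (Kt i) o'.
    have pp : 0 < \prod_(i < n) ((x' - t i) ^+ 2 + y' ^+ 2).
      by apply: prodr_gt0 => i _; exact: off_dist_gt0 (Kt i) o'.
    have : ln (\prod_(i < n) ((x' - t i) ^+ 2 + y' ^+ 2)) <= - (n%:R * (1 + (Mh + B + 2 * e2) / e1)) * 2.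
      move: (ltW hp); rewrite -ler_ln ?posrE// ?exprn_gt0 ?expR_gt0//.
      by rewrite lnXn ?expR_gt0// expRK mulr_natr.
    set l := ln _ => hl; apply: (@le_trans _ _ (e1 / n%:R * (- (n%:R * (1 + (Mh + B + 2 * e2) / e1))))).
      by rewrite ler_pM2l ?divr_gt0// ler_pdivrMr.
    rewrite le_eqVlt; apply/orP; left; apply/eqP; field.
    by rewrite !gt_eqF.
  have := quad_le x1 y1; have := h_bound x1 y1 o'.
  have l4 : 0 <= e1 * ln 4 by rewrite mulr_ge0 ?ln_ge0// ?ltW//; lra.
  by move: e10 => e10'; rewrite /Phi; lra.
have [d d0 hd] := h_K Kx nEx.
have [C C0 HC] := uscL_quad q0 (e2 - B) (e2 + B) x 0.
set g := c - (eta + 2 * e2 * r0 ^+ 2); have g0 : 0 < g by rewrite subr_gt0.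
have C1 : 0 < 4 * (C + 1) by lra.
exists (Num.min d (Num.min (1 / 2) (g / (4 * (C + 1))))); first by rewrite !lt_min d0 !divr_gt0.
move=> x' y'; rewrite !lt_min => /and3P[a1 a2 a3] /and3P[b1 b2 b3] o'.
have [x1 y1] := reg _ _ a2 b2.
have hh : h x' y' <= eta by apply: hd => //; rewrite sub0r normrN in b1.
have hl := logs_le o' x1 y1.
have hq := HC x' y' (le_trans (ltW a2) (_ : 1 / 2 <= 1)) (le_trans (ltW b2) (_ : 1 / 2 <= 1)).
have {}hq : quad x' y' <= quad x 0 + C * (`|x - x'| + `|0 - y'|) by apply: hq; rewrite ler_pdivrMr// mul1r ler1n.
have hx0 : quad x 0 <= e2 * r0 ^+ 2.
  rewrite /quad expr0n/= mulr0 addr0.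
  have s1 : (x - q0) ^+ 2 <= r0 ^+ 2.
    by rewrite -(real_normK (num_real (x - q0))) ler_pXn2r ?nnegrE// ltW.
  by move: B0 e20 => B0' e20'; have := sqr_ge0 (x - q0); nra.
rewrite ltr_pdivlMr// in a3; rewrite ltr_pdivlMr// in b3.
have X0 : 0 <= `|x - x'| by []. have Y0 : 0 <= `|0 - y'| by [].
move: (`|x - x'|) (`|0 - y'|) a3 b3 X0 Y0 hq => X Y a3 b3 X0 Y0 hq.
have hX : C * (X + Y) < g by nra.
have : 0 < e2 * r0 ^+ 2 by rewrite mulr_gt0.
rewrite /Phi /g in hX *; lra.
Qed.

(** Where [|y| >= r0 / 2] the barrier term is at most [- A m0] and [AP] applies. Elsewhere on the
    boundary [|x - q0| = r0], so the saddle is at most [- 3 / 4 B r0^2] and [BP] applies. *)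
Lemma Phi_bdry x y : square q0 r0 (x, y) -> off K x y -> `|x - q0| = r0 \/ `|y| = r0 ->
  ((Phi x y)%:E + A%:E * b (Complex x y) <= (eta + 2 * e2 * r0 ^+ 2)%:E)%E.
Proof.
move=> Qxy oxy bd; have [x1 y1] := square_region Qxy.
have hl := logs_le oxy x1 y1; have hh := h_bound x1 y1 oxy.
have Uz := QU Qxy oxy.
case: (Qxy) => /= xr yr.
have s1 : (x - q0) ^+ 2 <= r0 ^+ 2.
  by rewrite -(real_normK (num_real (x - q0))) ler_pXn2r ?nnegrE// ltW.
have s2 : y ^+ 2 <= r0 ^+ 2.
  by rewrite -(real_normK (num_real y)) ler_pXn2r ?nnegrE// ltW.
have x0 := sqr_ge0 (x - q0); have y0 := sqr_ge0 y.
have qE : quad x y = e2 * ((x - q0) ^+ 2 + y ^+ 2) + B * y ^+ 2 - B * (x - q0) ^+ 2.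
  by rewrite /quad; ring.
have q1 : e2 * ((x - q0) ^+ 2 + y ^+ 2) <= 2 * e2 * r0 ^+ 2 by move: e20 => e20'; nra.
have [yr2|yr2] := leP (r0 / 2) `|y|.
  apply: (@le_trans _ _ ((Phi x y)%:E + A%:E * (- m0)%:E)%E).
    by rewrite leeD2l// lee_wpmul2l ?lee_fin ?(ltW A0)//; exact: bm.
  rewrite -EFinM -EFinD lee_fin /Phi qE.
  have : B * y ^+ 2 <= B * r0 ^+ 2 by rewrite ler_wpM2l.
  have : 0 <= B * (x - q0) ^+ 2 by rewrite mulr_ge0.
  move: AP eta0 => AP' eta0'; lra.
have xe : `|x - q0| = r0 by case: bd => // ye; move: yr2 r00; rewrite ye; lra.
apply: (@le_trans _ _ (Phi x y)%:E).
  by rewrite -[leRHS]adde0 leeD2l// mule_ge0_le0 ?lee_fin ?ltW// bneg.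
rewrite lee_fin /Phi qE.
have s3 : (x - q0) ^+ 2 = r0 ^+ 2 by rewrite -xe real_normK// num_real.
have s4 : y ^+ 2 <= (r0 / 2) ^+ 2.
  by rewrite -(real_normK (num_real y)) ler_pXn2r ?nnegrE// ltW// divr_gt0.
have : B * y ^+ 2 <= B * (r0 / 2) ^+ 2 by rewrite ler_wpM2l.
have -> : (r0 / 2) ^+ 2 = r0 ^+ 2 / 4 by field.
by move: BP eta0 => BP' eta0'; rewrite s3 in q1 *; nra.
Qed.

Lemma compare_eps y : 0 < y <= r0 ->
  ((h q0 y + e1 * (ln y - ln 4))%:E + A%:E * b (Complex q0 y) <= (eta + 2 * e2 * r0 ^+ 2)%:E)%E.
Proof.
move=> /andP[y0 yr].
have oy : off K q0 y by move=> [ye _]; rewrite ye ltxx in y0.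
have Qy : square q0 r0 (q0, y) by split => /=; rewrite ?subrr ?normr0 ?(ltW r00)// gtr0_norm.
have := @maximum_principle R K U b (fun z Uz => Uz.2) bneg bsub.2.2.1 bsub.2.2.2
  q0 r0 QU Phi A e2 (eta + 2 * e2 * r0 ^+ 2) A0 e20
  (fun x y _ o => Phi_taylor o) (fun x y _ o => Phi_usc o) Phi_atK Phi_bdry q0 y Qy oy.
apply: le_trans; rewrite leeD2r// lee_fin /Phi.
have : 0 <= quad q0 y by rewrite /quad subrr expr0n/= mulr0 add0r mulr_ge0 ?sqr_ge0// addr_ge0// ltW.
have : e1 * ln y <= logs q0 y.
  rewrite /logs -mulrA ler_pM2l// mulrC ler_pdivlMr//.
  rewrite -[leLHS](_ : \sum_(i < n) ln y = _); last by rewrite sumr_const card_ord mulr_natr.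
  apply: ler_sum => i _; rewrite /logd ler_pdivlMr// mulr_natr -lnXn// ler_ln ?posrE ?exprn_gt0//; last first.
    exact: (off_dist_gt0 (Kt i) oy).
  by rewrite lerDr sqr_ge0.
lra.
Qed.

End eps.

(* Near a point with a barrier, [h] is dominated by [- A b], up to the saddle
   [(x - q0)^2 - y^2], which is nonnegative on the real line and takes care of the
   boundary of the square near [K]; the exceptional set [E] costs a small multiple of
   a logarithmic potential that is large on it. *)
Lemma barrier_compare (e : R) : 0 < e -> exists2 y0 : R, 0 < y0 &
  forall y, 0 < y < y0 -> h q0 y <= eta + e.
Proof.
move=> e0; have [r0 /andP[r00 r01] QU] := barrier_radius.
have [m0 m00 bm] := barrier_bound r00 QU.
have r2 : 0 < r0 ^+ 2 by rewrite exprn_gt0.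
pose B := Mh / (3 / 4 * r0 ^+ 2).
have B0 : 0 <= B by rewrite divr_ge0// mulr_ge0// ?ltW//; lra.
have BP : Mh <= B * (3 / 4 * r0 ^+ 2) by rewrite divfK// gt_eqF// mulr_gt0//; lra.
pose A := (Mh + B * r0 ^+ 2) / m0 + 1.
have A0 : 0 < A.
  suff : 0 <= (Mh + B * r0 ^+ 2) / m0 by rewrite /A; lra.
  apply: divr_ge0; last exact: ltW.
  by apply: addr_ge0 => //; apply: mulr_ge0 => //; exact: ltW.
have AP : Mh + B * r0 ^+ 2 <= A * m0 by rewrite /A mulrDl divfK ?gt_eqF// lerDl mul1r ltW.
have eA : 0 < e / (2 * A) by rewrite divr_gt0// mulr_gt0.
have [d d0 hd] := blim eA.
exists (Num.min r0 d); first by rewrite lt_min r00.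
move=> y; rewrite lt_min => /andP[y0 /andP[yr yd]].
have ln4 : 0 < 1 + `|ln 4 - ln y| by rewrite ltr_wpDr.
(* The error [e] is shared out: [e / 2] for [A b] close to [q0], [e / 4] for the logarithmic term,
   whose weight may depend on [y], and [2 (e / 8) r0^2 <= e / 4] for the strict term. *)
pose e1 := e / 4 / (1 + `|ln 4 - ln y|).
have e10 : 0 < e1 by rewrite !divr_gt0.
have e20 : 0 < e / 8 by rewrite divr_gt0.
have [n [t [n0 Kt tE]]] := E_polar (2 + (Mh + B + 2 * (e / 8)) / e1).
have yr' : 0 < y <= r0 by rewrite y0 ltW.
have := compare_eps r00 r01 A0 B0 QU bm AP BP e10 e20 n0 Kt tE yr'.
have oy : off K q0 y by move=> [ye _]; rewrite ye ltxx in y0.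
have Uy : U (Complex q0 y).
  by apply: QU => //; split => /=; rewrite ?subrr ?normr0 ?ltW// gtr0_norm.
have bd : ((- (e / (2 * A)))%:E < b (Complex q0 y))%E.
  apply: hd => //; apply: (le_lt_trans (cmod_le_sum _ _)).
  by rewrite subrr normr0 add0r oppr0 addr0 gtr0_norm.
have b0 := bneg Uy.
case: (b (Complex q0 y)) bd b0 => [r| |]//.
rewrite !lte_fin => rd _; rewrite -EFinM -EFinD lee_fin => hle.
have hA : - (e / 2) < A * r.
  have -> : - (e / 2) = A * - (e / (2 * A)) by field; rewrite gt_eqF.
  by rewrite ltr_pM2l.
have h1 : e1 * (ln 4 - ln y) <= e / 4.
  apply: (@le_trans _ _ (e1 * (1 + `|ln 4 - ln y|))).
    by rewrite ler_pM2l// (le_trans (ler_norm _))// lerDr.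
  by rewrite /e1 divfK// gt_eqF.
have h2 : r0 ^+ 2 <= 1 by rewrite exprn_ile1//; lra.
have : e * r0 ^+ 2 <= e by rewrite ler_piMr// ltW.
lra.
Qed.

End BarrierComparison.

(** * The equilibrium potential *)

Lemma integrable_ae_eq d (T : measurableType d) (R : realType) (mu : {measure set T -> \bar R})
    (D : set T) (f g : T -> \bar R) :
  measurable D -> measurable_fun D f -> mu.-integrable D g ->
  {ae mu, forall x, D x -> f x = g x} -> mu.-integrable D f.
Proof.
move=> mD mf /integrableP[mg goo] fg; apply/integrableP; split => //.
rewrite (ae_eq_integral (fun x => `|g x|%E))//.
- exact: measurableT_comp.
- exact: measurableT_comp.
- by apply: filterS fg => x h Dx; rewrite h.
Qed.

Section EquilibriumPotential.
Variables (R : realType) (K : set R).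
Hypotheses (cK : compact K) (K1 : K `<=` [set x : R | -1 <= x <= 1]).
Hypotheses (Kreg : regular_set K) (K0 : K !=set0).

(** If all energies were infinite, [K] itself could serve as the exceptional set, and the comparison
    for the constant function 1 with [eta = 0] would yield [1 <= 1 / 2]. *)
Lemma exists_finite_energy : exists2 nu : probability R R, prob_on K nu & (energy nu nu < +oo)%E.
Proof.
apply: contrapT => no.
have inf (nu : probability R R) : prob_on K nu -> energy nu nu = +oo%E.
  move=> nuK; apply/eqP; rewrite -leye_eq leNgt; apply/negP => h.
  by apply: no; exists nu.
have pol := polar_small_products cK K1 K0 inf.
have [q0 Kq0] := K0.
have [N [b [oN Nq0 bs bn bl]]] := Kreg Kq0.
have half : 0 < 1 / 2 :> R by rewrite divr_gt0.
have [||||y0 y00 /(_ (y0 / 2))] := @barrier_compare R K q0 K1 Kq0 N b oN Nq0 bs bn bl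
  (fun _ _ => 1) 1 0 ler01 (lexx 0) _ _ _ K pol _ (1 / 2) half.
- by move=> x y _; exact: subtaylor_cst.
- by move=> x y _ c hc; exists 1.
- by [].
- by move=> x Kx nKx; exfalso.
have h : 0 < y0 / 2 < y0 by apply/andP; split; lra.
by move=> /(_ h); lra.
Qed.

Variables (mu : probability R R) (I : R).
Hypotheses (muK : prob_on K mu).
Hypothesis mumin : forall p : probability R R, prob_on K p -> (energy mu mu <= energy p p)%E.
Hypothesis muI : energy mu mu = I%:E.

Definition robin : R := I - shift4 R.
Local Notation V := robin.

Let mKK : measurable K. Proof. exact: mK. Qed.
Let muK1 : mu K = 1%E. Proof. exact: prob_onK. Qed.

Lemma robin_ge : - ln 2 <= V.
Proof.
suff : ((- ln 2 + shift4 R)%:E <= energy mu mu)%E by rewrite muI lee_fin /robin; lra.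
rewrite /energy (integral_onK cK muK); last exact: measurable_potkn.
apply: (@le_trans _ _ (\int[mu]_(t in K) (- ln 2 + shift4 R)%:E)%E).
  have -> : (\int[mu]_(t in K) (- ln 2 + shift4 R)%:E = (- ln 2 + shift4 R)%:E * mu K)%E :=
    integral_cst mu mKK _.
  by rewrite muK1 mule1.
apply: le_integral_nomeas => x Kx; have x1 := Knorm K1 Kx.
rewrite (potkn_pot cK K1 muK); last by lra.
rewrite EFinD leeD2r//; apply: (pot_ge cK muK) => t Kt; apply: lk_ge => //.
have t1 := Knorm K1 Kt; rewrite addr0 -(real_normK (num_real (x - t))) ler_pXn2r ?nnegrE//.
by rewrite (le_trans (ler_normB _ _))//; lra.
Qed.

Lemma pot_le_robin x s : 0 <= s -> (pot K mu x s <= V%:E)%E.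
Proof.
move=> s0; have Vge := robin_ge.
have [x3|x3] := leP `|x| 3.
  apply: (@le_trans _ _ (pot K mu x 0)); first exact: pot_decr.
  apply/lee_addgt0Pr => e e0; rewrite -EFinD.
  have -> : V + e = I + e - shift4 R by rewrite /robin; ring.
  apply: (frostman_upper3 cK K1 muK mumin muI) => //.
  by move: Vge; rewrite /robin; lra.
apply: (@le_trans _ _ (- ln 2)%:E); last by rewrite lee_fin.
apply: (pot_le cK muK) => t Kt; apply: lk_le => //.
have t1 := Knorm K1 Kt; have : 2 <= `|x - t| by have := lerB_dist x t; lra.
move=> h; apply: (@le_trans _ _ ((x - t) ^+ 2)); last by rewrite lerDl.
by rewrite -(real_normK (num_real (x - t))) ler_pXn2r ?nnegrE.
Qed.

Lemma lk_lower x s t : 0 <= s -> K t -> ((- ln (`|x| + 2 + s))%:E <= lk x s t)%E.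
Proof.
move=> s0 /(Knorm K1) t1; have x0 : 0 <= `|x| by [].
apply: lk_ge => //; first by lra.
have h : `|x - t| <= `|x| + 1 by rewrite (le_trans (ler_normB _ _))// lerD2l.
have : (x - t) ^+ 2 <= (`|x| + 1) ^+ 2.
  by rewrite -(real_normK (num_real (x - t))) ler_pXn2r ?nnegrE//; lra.
move: x0; move: `|x| => n n0; nra.
Qed.

Lemma lk_integrable x s : 0 <= s -> mu.-integrable K (lk x s).
Proof.
move=> s0; have m : measurable_fun K (lk x s) by apply: measurable_funTS; exact: measurable_lk.
apply/integrableP; split => //.
have x0 : 0 <= `|x| by []. set M := `|x| + 2 + s.
have M1 : 0 <= ln M by rewrite ln_ge0// /M; lra.
apply: (@le_lt_trans _ _ (\int[mu]_(t in K) (lk x s t + (2 * ln M)%:E))%E).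
  apply: le_integral_nomeas => t Kt; have := lk_lower x s0 Kt; rewrite -/M.
  case: (lk x s t) => [r| |]//=.
  by rewrite -EFinD !lee_fin => h; rewrite ler_norml; apply/andP; split; lra.
rewrite integral_shift//; last first.
  move=> t Kt; have := lk_lower x s0 Kt; rewrite -/M; case: (lk x s t) => [r| |]//=.
    by rewrite -EFinD !lee_fin; lra.
  by move=> _; exact: leey.
apply: (@le_lt_trans _ _ (V%:E + (2 * ln M)%:E)%E); last by rewrite -EFinD ltry.
by rewrite leeD2r//; exact: pot_le_robin.
Qed.

(** The kernel at [x] is integrable, the potential being bounded above, but takes the value [+oo] at
    [x]. *)
Lemma equilibrium_null_pt x : mu [set x] = 0%E.
Proof.
have [A [mA A0 AP]] := integrable_ae mKK (lk_integrable x (lexx 0)).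
have [Kx|nKx] := pselect (K x); last first.
  apply: (@subset_measure0 _ _ _ mu _ (~` K)) => //; first exact: measurableC.
    by move=> _ -> /=.
  exact: muK.2.
apply: (@subset_measure0 _ _ _ mu _ A) => // _ ->; apply: AP => /= /(_ Kx).
by rewrite /lk subrr expr0n/= add0r eqxx.
Qed.

Lemma logd_lk (x y t : R) : ~ (y = 0 /\ t = x) -> lk x (y ^+ 2) t = (- logd t x y)%:E.
Proof.
move=> n; rewrite /lk paddr_eq0 ?sqr_ge0// !sqrf_eq0 subr_eq0.
case: ifPn => // /andP[/eqP xt /eqP y0]; by exfalso; apply: n.
Qed.

(** Where the kernel is infinite [logd] has the default value [ln 0 = 0]; this happens at one point
    at most, which is null. *)
Lemma ae_logd_lk x y : {ae mu, forall t, K t -> lk x (y ^+ 2) t = (- logd t x y)%:E}.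
Proof.
exists [set x]; split => //; first exact: equilibrium_null_pt.
move=> t /=; apply: contra_notP => tx _; apply: logd_lk => -[_ e]; exact: tx.
Qed.

Lemma measurable_logd (x y : R) : measurable_fun setT (fun t => logd t x y).
Proof.
rewrite /logd; apply: measurable_funM => //; apply: measurableT_comp; first exact: measurable_ln.
by apply: measurable_funD => //; apply: measurable_funX; exact: measurable_funB.
Qed.

Local Notation Int f := (mu.-integrable K (EFin \o f)).
Lemma IntD f g : Int f -> Int g -> Int (fun t => f t + g t).
Proof. by move=> hf hg; have := integrableD mKK hf hg. Qed.

Lemma IntZ f c : Int f -> Int (fun t => f t * c).
Proof.
move=> hf; have := integrableZr mKK c hf; congr (integrable _ _ _).
Qed.

Lemma Int_bounded (f : R -> R) (M : R) : measurable_fun setT f -> (forall t, K t -> `|f t| <= M) -> Int f.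
Proof.
move=> mf fM; apply: measurable_bounded_integrable => //.
- have h : (mu K < +oo)%E by rewrite muK1 ltry.
  exact: h.
- exact: measurable_funTS.
- exists M; split; first exact: num_real.
  by move=> x Mx t Kt /=; rewrite (le_trans (fM t Kt))// ltW.
Qed.

Lemma Int_cst c : Int (fun _ => c).
Proof. exact: (@Int_bounded _ `|c|). Qed.

Lemma mean_cst (c : R) : \int[mu]_(t in K) c = c.
Proof.
have -> : \int[mu]_(t in K) c = c * fine (mu K) := Rintegral_cst mu mKK c.
by rewrite muK1 mulr1.
Qed.

Lemma meanD f g : Int f -> Int g ->
  \int[mu]_(t in K) (f t + g t) = \int[mu]_(t in K) f t + \int[mu]_(t in K) g t.
Proof. exact: RintegralD. Qed.

Lemma meanZ f c : Int f -> \int[mu]_(t in K) (f t * c) = (\int[mu]_(t in K) f t) * c.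
Proof. exact: RintegralZr. Qed.

Lemma mean_lin5 f a b c e (u v p q w : R) : Int f -> Int a -> Int b -> Int c -> Int e ->
  Int (fun t => f t + a t * u + b t * v + c t * p + e t * q + - w) /\
  \int[mu]_(t in K) (f t + a t * u + b t * v + c t * p + e t * q + - w) =
  \int[mu]_(t in K) f t + (\int[mu]_(t in K) a t) * u + (\int[mu]_(t in K) b t) * v +
    (\int[mu]_(t in K) c t) * p + (\int[mu]_(t in K) e t) * q - w.
Proof.
move=> If Ia Ib Ic Ie; have Iw := Int_cst (- w).
have Iau := IntZ u Ia; have Ibv := IntZ v Ib; have Icp := IntZ p Ic; have Ieq := IntZ q Ie.
have I1 := IntD If Iau; have I2 := IntD I1 Ibv; have I3 := IntD I2 Icp; have I4 := IntD I3 Ieq.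
split; first exact: IntD I4 Iw.
by rewrite (meanD I4 Iw) (meanD I3 Ieq) (meanD I2 Icp) (meanD I1 Ibv) (meanD If Iau) !meanZ// mean_cst.
Qed.

Lemma le_mean f g : Int f -> Int g -> (forall t, K t -> f t <= g t) ->
  \int[mu]_(t in K) f t <= \int[mu]_(t in K) g t.
Proof. exact: le_Rintegral. Qed.

Lemma logd_integrableN x y : mu.-integrable K (fun t => (- logd t x y)%:E).
Proof.
have mlogd : measurable_fun K (fun t => (- logd t x y)%:E).
  apply/measurable_EFinP; apply: measurable_funTS; apply: measurableT_comp => //.
  exact: measurable_logd.
apply: (integrable_ae_eq mKK mlogd (lk_integrable x (sqr_ge0 y))).
by apply: filterS (ae_logd_lk x y) => t h Kt; rewrite h.
Qed.

Lemma logd_integrable x y : mu.-integrable K (EFin \o (fun t => logd t x y)).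
Proof.
have := integrableN (logd_integrableN x y); congr (integrable _ _ _).
by apply/funext => t /=; rewrite opprK.
Qed.

Definition logmean x y : R := \int[mu]_(t in K) logd t x y.

Lemma pot_logmean x y : pot K mu x (y ^+ 2) = (- logmean x y)%:E.
Proof.
rewrite /pot (ae_eq_integral (fun t => (- logd t x y)%:E))//.
- have -> : - logmean x y = \int[mu]_(t in K) (- logd t x y).
    rewrite /logmean -[LHS]mulrN1 -meanZ; last exact: logd_integrable.
    by apply: eq_Rintegral => t _; rewrite mulrN1.
  by rewrite /Rintegral fineK//; apply: integrable_fin_num (logd_integrableN x y).
- by apply: measurable_funTS; exact: measurable_lk.
- apply/measurable_EFinP; apply: measurable_funTS; apply: measurableT_comp => //.
  exact: measurable_logd.
- exact: ae_logd_lk.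
Qed.

Lemma logmean_ge x y : - V <= logmean x y.
Proof.
have := pot_le_robin x (sqr_ge0 y); rewrite pot_logmean lee_fin; lra.
Qed.

Lemma logmean_mono x y y' : `|y| <= `|y'| -> logmean x y <= logmean x y'.
Proof.
move=> yy; have := @pot_decr R K mu x (y ^+ 2) (y' ^+ 2) (sqr_ge0 y).
rewrite !pot_logmean lee_fin => h.
suff : y ^+ 2 <= y' ^+ 2 by move=> /h; lra.
by rewrite -(real_normK (num_real y)) -(real_normK (num_real y')) ler_pXn2r ?nnegrE.
Qed.

Lemma le_mean_ae f g : Int f -> Int g -> {ae mu, forall t, K t -> f t <= g t} ->
  \int[mu]_(t in K) f t <= \int[mu]_(t in K) g t.
Proof.
move=> If Ig fg.
have /integrableP[/measurable_EFinP mf _] := If.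
have /integrableP[/measurable_EFinP mg _] := Ig.
have e : (\int[mu]_(t in K) (f t)%:E = \int[mu]_(t in K) (Num.min (f t) (g t))%:E)%E.
  apply: ae_eq_integral => //; try exact/measurable_EFinP.
    by apply/measurable_EFinP; exact: measurable_minr.
  by apply: filterS fg => t h Kt; rewrite min_l// h.
rewrite /Rintegral fine_le//.
- exact: (integrable_fin_num mKK If).
- exact: (integrable_fin_num mKK Ig).
- by rewrite e; apply: le_integral_nomeas => t _; rewrite lee_fin ge_min lexx orbT.
Qed.

Lemma off_gap x y : off K x y -> exists2 d : R, 0 < d & forall t, K t -> d ^+ 2 <= (x - t) ^+ 2 + y ^+ 2.
Proof.
move=> oxy; have [y0|y0] := eqVneq y 0; last first.
  exists `|y|; first by rewrite normr_gt0.
  by move=> t _; rewrite real_normK ?num_real// lerDr sqr_ge0.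
have nK : (~` K) x by move=> Kx; apply: oxy.
have oK : open (~` K) by apply: closed_openC; exact: compact_closed.
have /nbhs_ballP[e /= e0 he] := open_nbhs_nbhs (conj oK nK).
exists e => // t Kt; rewrite y0 expr0n/= addr0.
rewrite -(real_normK (num_real (x - t))) ler_pXn2r ?nnegrE// ?(ltW e0)//.
by rewrite leNgt; apply/negP => h; exact: (he t h).
Qed.

Lemma logmean_taylor x y : off K x y -> subtaylor 0 logmean x y.
Proof.
move=> oxy; have [d d0 hd] := off_gap oxy.
pose P t := (x - t) ^+ 2 + y ^+ 2.
have d2 : 0 < d ^+ 2 by rewrite exprn_gt0.
have P0 t : K t -> 0 < P t by move=> Kt; rewrite (lt_le_trans d2)// hd.
(* Equal to [1 / P] on [K], but written so that measurability on the whole line is immediate. *)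
pose iP t := expR (- ln (P t)).
have iPE t : K t -> iP t = (P t)^-1.
  by move=> Kt; rewrite /iP expRN lnK// posrE P0.
have mP : measurable_fun setT P.
  by apply: measurable_funD => //; apply: measurable_funX; exact: measurable_funB.
have miP : measurable_fun setT iP.
  apply: measurableT_comp; first exact: measurable_expR.
  apply: measurableT_comp => //; apply: measurableT_comp; first exact: measurable_ln.
  exact: mP.
have iPd t : K t -> 0 <= iP t <= (d ^+ 2)^-1.
  by move=> Kt; rewrite expR_ge0 iPE//= lef_pV2 ?posrE ?P0// hd.
have mX : measurable_fun setT (fun t : R => x - t) by exact: measurable_funB.
have Xb t : K t -> `|x - t| <= `|x| + 1.
  by move=> Kt; rewrite (le_trans (ler_normB _ _))// lerD2l (Knorm K1 Kt).
pose a t := (x - t) * iP t; pose b t := iP t * y.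
pose c t := ((x - t) ^+ 2 - y ^+ 2) * iP t ^+ 2 * - 2^-1.
pose e t := (x - t) * iP t ^+ 2 * (- 2 * y).
have iP2 t : K t -> `|iP t ^+ 2| <= (d ^+ 2)^-1 ^+ 2.
  move=> Kt; rewrite normrX ger0_norm ?expR_ge0// ler_pXn2r ?nnegrE ?expR_ge0//.
    by case/andP: (iPd _ Kt).
  by rewrite invr_ge0 ltW.
have iP1 t : K t -> `|iP t| <= (d ^+ 2)^-1.
  by move=> Kt; rewrite ger0_norm ?expR_ge0//; case/andP: (iPd _ Kt).
have Ia : Int a.
  apply: (@Int_bounded _ ((`|x| + 1) * (d ^+ 2)^-1)); first exact: measurable_funM.
  by move=> t Kt; rewrite /a normrM ler_pM// ?Xb// iP1.
have Ib : Int b by apply: IntZ; exact: (@Int_bounded _ ((d ^+ 2)^-1)).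
have Ic : Int c.
  apply: IntZ; apply: (@Int_bounded _ (((`|x| + 1) ^+ 2 + y ^+ 2) * (d ^+ 2)^-1 ^+ 2)).
    apply: measurable_funM; last exact: measurable_funX.
    by apply: measurable_funB => //; exact: measurable_funX.
  move=> t Kt; rewrite normrM ler_pM// ?iP2//.
  rewrite (le_trans (ler_normB _ _))// (ger0_norm (sqr_ge0 y)) lerD2r normrX.
  by rewrite ler_pXn2r ?nnegrE ?Xb// addr_ge0.
have Ie : Int e.
  apply: IntZ; apply: (@Int_bounded _ ((`|x| + 1) * (d ^+ 2)^-1 ^+ 2)).
    by apply: measurable_funM => //; exact: measurable_funX.
  by move=> t Kt; rewrite normrM ler_pM// ?iP2// Xb.
exists (\int[mu]_(t in K) a t), (\int[mu]_(t in K) b t), (\int[mu]_(t in K) c t),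
  (\int[mu]_(t in K) e t), (16 / d ^+ 3), (d / 8).
split; [by rewrite divr_gt0|by rewrite divr_ge0// exprn_ge0// ltW|].
move=> r u v rd uv; rewrite mul0r addr0.
have I0 := logd_integrable x y.
set w := 16 / d ^+ 3 * r ^+ 3.
have [IL <-] := mean_lin5 u v (u ^+ 2 - v ^+ 2) (u * v) w I0 Ia Ib Ic Ie.
apply: le_mean; [exact: IL|exact: logd_integrable|].
move=> t Kt; have Pt := P0 t Kt.
have := logd_taylor d0 (erefl (P t)) (hd t Kt) rd uv.
apply: le_trans; rewrite /a /b /c /e iPE// /w le_eqVlt; apply/orP; left; apply/eqP.
by field; rewrite !gt_eqF.
Qed.

Lemma logmean_usc x y : off K x y -> exists2 C : R, 0 <= C &
  forall x' y', off K x' y' -> `|x - x'| <= 1 -> `|y - y'| <= 1 ->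
    logmean x' y' <= logmean x y + C * (`|x - x'| + `|y - y'|).
Proof.
move=> oxy; have [d d0 hd] := off_gap oxy.
have d2 : 0 < d ^+ 2 by rewrite exprn_gt0.
pose C := (2 * `|x| + 3 + 2 * `|y| + 1) / d ^+ 2 / 2.
have x0 : 0 <= `|x| by []. have y0 : 0 <= `|y| by [].
exists C; first by rewrite !divr_ge0// ?(ltW d2)//; lra.
move=> x' y' o' xx yy; set D := `|x - x'| + `|y - y'|.
have D0 : 0 <= D by rewrite addr_ge0.
rewrite -(mean_cst (C * D)) -meanD; [|exact: logd_integrable|exact: Int_cst].
apply: le_mean; [exact: logd_integrable|apply: IntD; [exact: logd_integrable|exact: Int_cst]|].
move=> t Kt; have t1 := Knorm K1 Kt.
have P0 := off_dist_gt0 Kt oxy; have P0' := off_dist_gt0 Kt o'.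
have := ln_le_tangent P0' P0; rewrite /logd.
set P := (x - t) ^+ 2 + y ^+ 2 in P0 *; set P' := (x' - t) ^+ 2 + y' ^+ 2 in P0' *.
have dP := hd t Kt; rewrite -/P in dP.
suff : P' / P - 1 <= C * D * 2 by lra.
have -> : P' / P - 1 = (P' - P) / P by field; rewrite gt_eqF.
have hPP : P' - P <= (2 * `|x| + 3 + 2 * `|y| + 1) * D.
  have -> : P' - P = (x' - x) * (2 * (x - t) + (x' - x)) + (y' - y) * (2 * y + (y' - y)).
    by rewrite /P /P'; ring.
  have k1 (p q r : R) : `|p| <= 1 -> `|q| <= r -> p * (2 * q + p) <= (2 * r + 1) * `|p|.
    move=> p1 qr; apply: (le_trans (ler_norm _)); rewrite normrM mulrC ler_wpM2r//.
    by rewrite (le_trans (ler_normD _ _))// normrM ger0_norm//; lra.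
  have xt : `|x - t| <= `|x| + 1 by rewrite (le_trans (ler_normB _ _))// lerD2l.
  have h1 := @k1 (x' - x) _ _ _ xt; rewrite distrC in h1; have {}h1 := h1 xx.
  have h2 := @k1 (y' - y) y `|y| _ (lexx _); rewrite [`|y' - y|]distrC in h2; have {}h2 := h2 yy.
  have h3 : 0 <= `|x - x'| * `|y| by rewrite mulr_ge0.
  have h4 : 0 <= `|y - y'| * `|x| by rewrite mulr_ge0.
  have h5 : 0 <= `|x - x'| by []. have h6 : 0 <= `|y - y'| by [].
  rewrite /D; lra.
rewrite ler_pdivrMr//; apply: (le_trans hPP).
have -> : C * D * 2 * P = (2 * `|x| + 3 + 2 * `|y| + 1) * D * (P / d ^+ 2).
  by rewrite /C; field; rewrite gt_eqF.
rewrite ler_peMr// ?ler_pdivlMr// ?mul1r//.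
by rewrite mulr_ge0//; lra.
Qed.

Lemma logmean_le x y : `|x| <= 2 -> `|y| <= 1 -> logmean x y <= ln 4.
Proof.
move=> x2 y1; have : ((- ln 4)%:E <= pot K mu x (y ^+ 2))%E.
  apply: (pot_ge cK muK) => t Kt; have t1 := Knorm K1 Kt; apply: lk_ge => //; first exact: sqr_ge0.
  have : (x - t) ^+ 2 <= 3 ^+ 2.
    rewrite -(real_normK (num_real (x - t))) ler_pXn2r ?nnegrE//.
    by rewrite (le_trans (ler_normB _ _))//; lra.
  have : y ^+ 2 <= 1 by rewrite -(real_normK (num_real y)) exprn_ile1.
  rewrite !expr2; lra.
by rewrite pot_logmean lee_fin lerN2.
Qed.

(** The set [E] where the potential is at most [V - eta] is compact by semicontinuity and carries no
    measure of finite energy: its cross energy with [mu] would be at most [I - eta]. Hence the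
    comparison applies to [h = V + logmean] and gives [h <= 2 eta] just above [x]; monotonicity in
    the height brings this down to the line. *)
Lemma logmean_onK x : K x -> logmean x 0 = - V.
Proof.
move=> Kx; apply/eqP; rewrite eq_le logmean_ge andbT.
suff h (eta : R) : 0 < eta -> V + logmean x 0 <= eta + eta.
  apply/ler_addgt0Pr => e e0; have e2 : 0 < e / 2 by rewrite divr_gt0.
  by have := h _ e2; lra.
move=> eta0; have Vge := robin_ge.
have [N [b [oN Nq0 bs bn bl]]] := Kreg Kx.
pose E := [set z | K z /\ (pot K mu z 0 <= (V - eta)%:E)%E].
have clE : compact E.
  apply: (subclosed_compact _ cK); last by move=> z [].
  have -> : E = ~` [set z | ~ K z \/ (K z /\ ((V - eta)%:E < pot K mu z 0)%E)].
    apply/seteqP; split => z /=.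
      by move=> [Kz hz] [//|[_]]; rewrite ltNge hz.
    move=> h; have Kz : K z by apply: contrapT => nK; apply: h; left.
    by split => //; rewrite leNgt; apply/negP => hz; apply: h; right.
  apply: open_closedC; rewrite openE => z /= [nKz|[Kz hz]].
    have oK : open (~` K) by apply: closed_openC; exact: compact_closed.
    by apply: filterS (open_nbhs_nbhs (conj oK nKz)) => w nw; left.
  have z3 : `|z| < 3 by have := Knorm K1 Kz; lra.
  have [d d0 hd] := pot_lsc cK K1 muK z3 hz.
  apply/nbhs_ballP; exists d => // w zw; have [Kw|nKw] := pselect (K w); [right|by left].
  by split => //; apply: hd => //; rewrite lexx ltW.
have E_polar (M : R) : exists n (t : nat -> R), [/\ (0 < n)%N, forall i, K (t i) &
    forall z, E z -> \prod_(i < n) `|z - t i| <= expR (- (n%:R * M))].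
  have [En|E0] := pselect (E !=set0); last first.
    by exists 1%N, (fun => x); split => // z Ez; exfalso; apply: E0; exists z.
  have Einf (nu : probability R R) : prob_on E nu -> energy nu nu = +oo%E.
    move=> nuE; apply/eqP; rewrite -leye_eq leNgt; apply/negP => hfin.
    have nuK : prob_on K nu.
      split; first exact: nuE.1.
      apply: (@subset_measure0 _ _ _ nu _ (~` E)); [exact: measurableC| |by move=> z nK [] |exact: nuE.2].
      by apply: measurableC; exact: compact_measurable.
    have muoo : (energy mu mu < +oo)%E by rewrite muI ltry.
    have := cross_energy_ge mumin muK nuK muoo hfin.
    rewrite leNgt => /negP; apply; rewrite energy_sym muI.
    apply: (@le_lt_trans _ _ (V - eta + shift4 R)%:E); last by rewrite lte_fin /robin; lra.
    rewrite /energy (integral_onK clE nuE); last exact: measurable_potkn.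
    have mE : measurable E := compact_measurable clE.
    apply: (@le_trans _ _ (\int[nu]_(t in E) (V - eta + shift4 R)%:E)%E); last first.
      have -> : (\int[nu]_(t in E) (V - eta + shift4 R)%:E = (V - eta + shift4 R)%:E * nu E)%E :=
        integral_cst nu mE _.
      by rewrite (prob_onK clE nuE) mule1.
    apply: le_integral_nomeas => z [Kz hz]; rewrite (potkn_pot cK K1 muK).
      by rewrite EFinD leeD2r.
    by have := Knorm K1 Kz; lra.
  have E1 : E `<=` [set x : R | -1 <= x <= 1] by move=> z [/K1].
  have [n [t [n0 tE tP]]] := polar_small_products clE E1 En Einf M.
  by exists n, t; split => // i; have [] := tE i.
have [|||||y0 y00 /(_ (y0 / 2))] := @barrier_compare R K x K1 Kx N b oN Nq0 bs bn bl
  (fun x y => V + logmean x y) (V + ln 4) eta _ (ltW eta0) _ _ _ E E_polar _ eta eta0.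
- suff : ln 2 <= ln 4 :> R by lra.
  by rewrite ler_ln ?posrE// ler_nat.
- move=> z y o; have := subtaylorD (subtaylor_cst V z y) (logmean_taylor o).
  by rewrite add0r.
- move=> z y o c hc; have [C C0 hC] := logmean_usc o.
  pose g := c - (V + logmean z y); have g0 : 0 < g by rewrite subr_gt0.
  have C1 : 0 < 2 * (C + 1) by lra.
  exists (Num.min 1 (g / (2 * (C + 1)))); first by rewrite lt_min ltr01 divr_gt0.
  move=> x' y'; rewrite !lt_min => /andP[a1 a2] /andP[b1 b2] o'.
  have := hC x' y' o' (ltW a1) (ltW b1).
  rewrite ltr_pdivlMr// in a2; rewrite ltr_pdivlMr// in b2.
  have X0 : 0 <= `|z - x'| by []. have Y0 : 0 <= `|y - y'| by [].
  have gE : c = V + logmean z y + g by rewrite /g; ring.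
  move: (`|z - x'|) (`|y - y'|) a2 b2 X0 Y0 => X Y a2 b2 X0 Y0; rewrite gE; nra.
- move=> z y zx y1 _; rewrite lerD2l; apply: logmean_le => //.
  have -> : z = (z - x) + x by ring.
  by rewrite (le_trans (ler_normD _ _))//; have := Knorm K1 Kx; lra.
- move=> z Kz nEz.
  have hz : ((V - eta)%:E < pot K mu z 0)%E.
    by rewrite ltNge; apply/negP => h; apply: nEz.
  have z3 : `|z| < 3 by have := Knorm K1 Kz; lra.
  have [d d0 hd] := pot_lsc cK K1 muK z3 hz.
  exists (Num.min 1 d); first by rewrite lt_min ltr01.
  move=> x' y'; rewrite !lt_min => /andP[a1 a2] /andP[b1 b2] o'.
  have y2 : 0 <= y' ^+ 2 <= d.
    rewrite sqr_ge0/= -(real_normK (num_real y')) expr2.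
    by rewrite (le_trans _ (ltW b2))// ler_piMl// ltW.
  have := hd x' _ a2 y2; rewrite pot_logmean lte_fin; lra.
have hy : 0 < y0 / 2 < y0 by apply/andP; split; lra.
move=> /(_ hy); apply: le_trans; rewrite lerD2l; apply: logmean_mono.
by rewrite normr0.
Qed.

(** For [y = 0], [ln |x - h - t| + ln |x + h - t|] is less than [2 ln |x - t|] by a fixed amount
    when [h = d / 2], while both means on the left are at least [- V]. For [y <> 0] the point is
    compared with the one at half the height. The almost-everywhere form is what
    [equilibrium_support] uses. *)
Lemma logmean_strict_ae x y d : 0 < d ->
  {ae mu, forall t, K t -> d ^+ 2 <= (x - t) ^+ 2 + y ^+ 2} -> - V < logmean x y.
Proof.
move=> d0 hd.
have d2 : 0 < d ^+ 2 by rewrite exprn_gt0.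
set M := (`|x| + 1) ^+ 2 + y ^+ 2.
have PM t : K t -> (x - t) ^+ 2 + y ^+ 2 <= M.
  move=> Kt; rewrite lerD2r -(real_normK (num_real (x - t))) ler_pXn2r ?nnegrE ?addr_ge0//.
  by rewrite (le_trans (ler_normB _ _))// lerD2l (Knorm K1 Kt).
have M0 : 0 < M by rewrite /M ltr_pwDl ?sqr_ge0// exprn_gt0// ltr_wpDl.
have [y0|y0] := eqVneq y 0.
  pose h := d / 2; have h0 : 0 < h by rewrite divr_gt0.
  have hd2 : h ^+ 2 < d ^+ 2 by rewrite ltr_pXn2r ?nnegrE ?ltW//; rewrite /h; lra.
  have : logmean (x - h) 0 + logmean (x + h) 0 <= logmean x 0 * 2 + - (h ^+ 2 / M).
    rewrite -(mean_cst (- (h ^+ 2 / M))) -meanZ; last exact: logd_integrable.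
    have Ih z := logd_integrable z 0.
    rewrite -!meanD//; [|exact: IntZ|exact: Int_cst].
    apply: le_mean_ae; [exact: IntD|apply: IntD; [exact: IntZ|exact: Int_cst]|].
    apply: filterS hd => t hdt Kt; have := PM t Kt; have := hdt Kt; rewrite y0 expr0n/= !addr0.
    set D := (x - t) ^+ 2 => dD DM.
    have D0 : 0 < D by lra.
    have Dh : 0 < D - h ^+ 2 by lra.
    rewrite /logd expr0n/= !addr0 -/D -mulrDl.
    have n1 : 0 < (x - h - t) ^+ 2.
      rewrite lt_neqAle sqr_ge0 andbT eq_sym sqrf_eq0; apply/eqP => e.
      suff : D - h ^+ 2 = 0 by lra.
      have xt : x - t = h by lra.
      by rewrite /D xt subrr.
    have n2 : 0 < (x + h - t) ^+ 2.
      rewrite lt_neqAle sqr_ge0 andbT eq_sym sqrf_eq0; apply/eqP => e.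
      suff : D - h ^+ 2 = 0 by lra.
      have xt : x - t = - h by lra.
      by rewrite /D xt sqrrN subrr.
    rewrite -lnM ?posrE//.
    have -> : (x - h - t) ^+ 2 * (x + h - t) ^+ 2 = (D - h ^+ 2) ^+ 2 by rewrite /D; ring.
    rewrite lnXn// -(mulr_natr (ln _)) mulfK ?pnatr_eq0// divfK ?pnatr_eq0//.
    have := ln_le_tangent Dh D0.
    have -> : (D - h ^+ 2) / D - 1 = - (h ^+ 2 / D) by field; rewrite gt_eqF.
    have : h ^+ 2 / M <= h ^+ 2 / D.
      by rewrite ler_wpM2l ?sqr_ge0// lef_pV2 ?posrE.
    lra.
  have := logmean_ge (x - h) 0; have := logmean_ge (x + h) 0.
  have : 0 < h ^+ 2 / M by rewrite divr_gt0// exprn_gt0.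
  rewrite y0; lra.
pose g := 3 / 8 * y ^+ 2 / M.
have y2 : 0 < y ^+ 2 by rewrite lt_neqAle sqr_ge0 andbT eq_sym sqrf_eq0.
have g0 : 0 < g by rewrite divr_gt0// mulr_gt0// divr_gt0.
have : logmean x (y / 2) + g <= logmean x y.
  rewrite -(mean_cst g) -meanD; [|exact: logd_integrable|exact: Int_cst].
  apply: le_mean; [by apply: IntD; [exact: logd_integrable|exact: Int_cst]|exact: logd_integrable|].
  move=> t Kt; have DM := PM t Kt; rewrite /logd.
  set D := (x - t) ^+ 2 + y ^+ 2 in DM *; set D' := (x - t) ^+ 2 + (y / 2) ^+ 2.
  have s0 := sqr_ge0 (x - t).
  have yE : (y / 2) ^+ 2 = y ^+ 2 / 4 by field.
  have D0 : 0 < D by rewrite /D; lra.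
  have D0' : 0 < D' by rewrite /D' yE; lra.
  have := ln_le_tangent D0' D0.
  have -> : D' / D - 1 = - (3 / 4 * y ^+ 2 / D).
    by rewrite /D' yE /D; field; rewrite gt_eqF.
  have : 3 / 4 * y ^+ 2 / M <= 3 / 4 * y ^+ 2 / D.
    by rewrite ler_wpM2l ?lef_pV2 ?posrE// mulr_ge0// ?ltW// divr_gt0.
  have -> : g = 3 / 4 * y ^+ 2 / M / 2 by rewrite /g; field; rewrite gt_eqF.
  lra.
have := logmean_ge x (y / 2); lra.
Qed.

Lemma logmean_strict x y : off K x y -> - V < logmean x y.
Proof.
move=> oxy; have [d d0 hd] := off_gap oxy.
exact: (logmean_strict_ae d0 (aeW _ hd)).
Qed.

(** If the ball were null, almost all of [K] would be at distance at least [r] from [x], and the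
    strict inequality would contradict [logmean_onK]. *)
Lemma equilibrium_support x r : K x -> 0 < r -> mu (K `&` ball x r) <> 0%E.
Proof.
move=> Kx r0 N0; suff : - V < logmean x 0 by rewrite (logmean_onK Kx) ltxx.
apply: (logmean_strict_ae r0); exists (K `&` ball x r); split => //.
  by apply: measurableI => //; exact: measurable_ball.
move=> t /= h; have [Kt nt] : K t /\ ~ r ^+ 2 <= (x - t) ^+ 2 + 0 ^+ 2.
  by split; [apply: contrapT => nK; apply: h|move=> h'; apply: h].
split => //; move/negP: nt; rewrite expr0n/= addr0 -ltNge.
by rewrite -(real_normK (num_real (x - t))) ltr_pXn2r ?nnegrE// ltW.
Qed.

End EquilibriumPotential.

(** * Logarithmic means of polynomials *)

Section ComplexRoots.
Variable R : realType.
Local Notation C := (complex R).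
Implicit Types (Q : {poly R}) (z w : C) (rs : seq C).

Definition sqmod z : R := complex.Re z ^+ 2 + complex.Im z ^+ 2.

Lemma sqmodM z w : sqmod (z * w) = sqmod z * sqmod w.
Proof. by case: z => a b; case: w => c d; rewrite /sqmod /=; ring. Qed.

Lemma sqmod_prod rs (f : C -> C) : sqmod (\prod_(z <- rs) f z) = \prod_(z <- rs) sqmod (f z).
Proof.
elim: rs => [|z rs IH]; first by rewrite !big_nil /sqmod /= expr1n expr0n addr0.
by rewrite !big_cons sqmodM IH.
Qed.

Lemma sqmod_ge0 z : 0 <= sqmod z. Proof. by rewrite addr_ge0// sqr_ge0. Qed.

Lemma sqmod_eq0 z : (sqmod z == 0) = (z == 0).
Proof. by case: z => a b; rewrite /sqmod paddr_eq0 ?sqr_ge0// !sqrf_eq0 eq_complex. Qed.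

Lemma sqmod_cR (x : R) : sqmod (cR x) = x ^+ 2.
Proof. by rewrite /sqmod/= expr0n addr0. Qed.

Lemma horner_cR Q (t : R) : (map_poly (@cR R) Q).[cR t] = cR Q.[t].
Proof. exact: (horner_map (real_complex R)). Qed.

Lemma real_poly_roots Q : Q != 0 -> exists rs : seq C,
  [/\ size rs = (size Q).-1,
      map_poly (@cR R) Q = cR (lead_coef Q) *: \prod_(z <- rs) ('X - z%:P) &
      forall z, (z \in rs) = root (map_poly (@cR R) Q) z].
Proof.
move=> Q0; have [rs rsE] := closed_field_poly_normal (map_poly (real_complex R) Q).
rewrite lead_coef_map in rsE.
have l0 : real_complex R (lead_coef Q) != 0 by rewrite fmorph_eq0 lead_coef_eq0.
exists rs; split => //.
  have := congr1 (fun p : {poly C} => size p) rsE.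
  by rewrite size_map_poly size_scale// size_prod_XsubC => ->.
by move=> z; rewrite [map_poly _ _]rsE rootZ// root_prod_XsubC.
Qed.

Lemma sqmod_horner Q rs z : map_poly (@cR R) Q = cR (lead_coef Q) *: \prod_(z <- rs) ('X - z%:P) ->
  sqmod (map_poly (@cR R) Q).[z] = lead_coef Q ^+ 2 * \prod_(w <- rs) sqmod (z - w).
Proof.
move=> ->; rewrite hornerZ sqmodM sqmod_cR; congr (_ * _).
rewrite horner_prod sqmod_prod; apply: eq_bigr => w _.
by rewrite hornerXsubC.
Qed.

End ComplexRoots.

(* Satisfied by the equilibrium measure [mu] and the Robin constant [V] of a regular
   compact set [K]; the potential is [- logmean K mu]. *)
Record equilibrium_potential (R : realType) (K : set R) (mu : probability R R) (V : R) : Prop :=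
  EquilibriumPotential {
  ep_int : forall x y, mu.-integrable K (EFin \o (fun t => logd t x y));
  ep_null : forall x, mu [set x] = 0%E;
  ep_ge : forall x y, - V <= logmean K mu x y;
  ep_onK : forall x, K x -> logmean K mu x 0 = - V;
  ep_strict : forall x y, off K x y -> - V < logmean K mu x y;
  ep_taylor : forall x y, off K x y -> subtaylor 0 (logmean K mu) x y;
  ep_support : forall x r, K x -> 0 < r -> mu (K `&` ball x r) <> 0%E }.

Section LogMeanPolynomials.
Variables (R : realType) (K : set R).
Hypotheses (cK : compact K) (K1 : K `<=` [set x : R | -1 <= x <= 1]).
Variables (mu : probability R R) (V : R).
Hypotheses (muK : prob_on K mu) (mup : equilibrium_potential K mu V).
Local Notation C := (complex R).
Local Notation Int f := (mu.-integrable K (EFin \o f)).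
Local Notation "'E[ f ]" := (\int[mu]_(t in K) f t).
Implicit Types (P Q T p : {poly R}).

Lemma ae_not_in (rs : seq C) : {ae mu, forall t, forall z, z \in rs -> z != cR t}.
Proof.
elim: rs => [|w rs IH]; first exact: aeW.
have wt : {ae mu, forall t, w != cR t}.
  exists [set complex.Re w]; split => //; first exact: (ep_null mup).
  by move=> t /= /negP; rewrite negbK => /eqP ->.
apply: filterS2 IH wt => t h1 h2 z; rewrite inE => /orP[/eqP ->//|]; exact: h1.
Qed.

Lemma ae_nonroot Q : Q != 0 -> {ae mu, forall t, Q.[t] != 0}.
Proof.
move=> Q0; have [rs [_ _ rsE]] := real_poly_roots Q0.
apply: filterS (ae_not_in rs) => t h; apply/eqP => Qt.
have /h : cR t \in rs by rewrite rsE /root horner_cR Qt.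
by rewrite eqxx.
Qed.

Lemma measurable_horner Q : measurable_fun setT (fun t : R => Q.[t]).
Proof. by apply: continuous_measurable_fun => x; exact: continuous_horner. Qed.

Lemma poly_bounded Q : exists2 M : R, 0 <= M & forall t, K t -> `|Q.[t]| <= M.
Proof.
exists (\sum_(i < size Q) `|Q`_i|); first exact: sumr_ge0.
move=> t Kt; rewrite horner_coef (le_trans (ler_norm_sum _ _ _))//.
apply: ler_sum => i _; rewrite normrM ler_piMr// normrX exprn_ile1//.
exact: (Knorm K1 Kt).
Qed.

Lemma Int_poly Q : Int (fun t => Q.[t]).
Proof.
have [M _ QM] := poly_bounded Q.
exact: (Int_bounded cK muK (measurable_horner Q) QM).
Qed.

Definition lnmean Q : R := 'E[fun t => ln `|Q.[t]|].

(* Logarithm of [|lead Q| Cap(K)^(deg Q)]. *)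
Definition lncap Q : R := ln `|lead_coef Q| - (size Q).-1%:R * V.

Lemma measurable_lnpoly Q : measurable_fun setT (fun t : R => ln `|Q.[t]|).
Proof.
apply: measurableT_comp; first exact: measurable_ln.
by apply: measurableT_comp => //; exact: measurable_horner.
Qed.

Lemma Int_sum_logd (rs : seq C) :
  Int (fun t => \sum_(z <- rs) logd t (complex.Re z) (complex.Im z)) /\
  'E[fun t => \sum_(z <- rs) logd t (complex.Re z) (complex.Im z)] =
  \sum_(z <- rs) logmean K mu (complex.Re z) (complex.Im z).
Proof.
elim: rs => [|z rs [IH1 IH2]].
  have e : (fun t : R => \sum_(z <- [::]) logd t (complex.Re z) (complex.Im z)) = fun=> 0.
    by apply/funext => t; rewrite big_nil.
  by rewrite e big_nil (mean_cst cK muK); split => //; exact: Int_cst.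
have e : (fun t : R => \sum_(z <- z :: rs) logd t (complex.Re z) (complex.Im z)) =
    fun t => logd t (complex.Re z) (complex.Im z) + \sum_(z <- rs) logd t (complex.Re z) (complex.Im z).
  by apply/funext => t; rewrite big_cons.
have Iz := ep_int mup (complex.Re z) (complex.Im z).
rewrite e big_cons (meanD cK Iz IH1) IH2; split => //; exact: IntD.
Qed.

(** Off the real roots, a null set, [ln |Q(t)|] is [ln |lead|] plus the sum of [logd] over the
    complex roots; at the real roots the default [ln 0 = 0] spoils the identity. *)
Lemma lnmean_roots Q rs : Q != 0 ->
  map_poly (@cR R) Q = cR (lead_coef Q) *: \prod_(z <- rs) ('X - z%:P) ->
  Int (fun t => ln `|Q.[t]|) /\
  lnmean Q = ln `|lead_coef Q| + \sum_(z <- rs) logmean K mu (complex.Re z) (complex.Im z).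
Proof.
move=> Q0 QE; have [IS ES] := Int_sum_logd rs.
have l0 : lead_coef Q != 0 by rewrite lead_coef_eq0.
pose S t := \sum_(z <- rs) logd t (complex.Re z) (complex.Im z).
have Il := Int_cst cK muK (ln `|lead_coef Q|).
have IF : Int (fun t => ln `|lead_coef Q| + S t) by exact: IntD.
have FE t : (forall z, z \in rs -> z != cR t) -> ln `|Q.[t]| = ln `|lead_coef Q| + S t.
  move=> h; have := sqmod_horner (cR t) QE; rewrite horner_cR sqmod_cR => e.
  have p0 z : z \in rs -> 0 < sqmod (cR t - z).
    by move=> /h zt; rewrite lt_neqAle sqmod_ge0 eq_sym sqmod_eq0 subr_eq0 eq_sym zt.
  have pp : 0 < \prod_(w <- rs) sqmod (cR t - w).
    by rewrite big_seq; apply: prodr_gt0 => z; exact: p0.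
  have ln2 (a : R) : a != 0 -> ln (a ^+ 2) = 2 * ln `|a|.
    by move=> a0; rewrite -(real_normK (num_real a)) lnXn ?normr_gt0// mulr_natl.
  have Qt : Q.[t] != 0.
    rewrite -sqrf_eq0 e; apply: mulf_neq0; first by rewrite sqrf_eq0.
    exact: lt0r_neq0 pp.
  have l2 : 0 < lead_coef Q ^+ 2 by rewrite lt_neqAle eq_sym sqrf_eq0 l0 sqr_ge0.
  have : ln (Q.[t] ^+ 2) = ln (lead_coef Q ^+ 2) + ln (\prod_(w <- rs) sqmod (cR t - w)).
    by rewrite e; apply: lnM; rewrite posrE.
  rewrite !ln2//.
  have -> : ln (\prod_(w <- rs) sqmod (cR t - w)) = 2 * S t.
    rewrite /S; move: p0; elim: (rs) => [|w r IH] p0; first by rewrite !big_nil ln1 mulr0.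
    have pr z : z \in r -> 0 < sqmod (cR t - z) by move=> zr; apply: p0; rewrite inE zr orbT.
    rewrite !big_cons lnM ?posrE ?p0 ?mem_head//; last first.
      by rewrite big_seq; apply: prodr_gt0 => z; exact: pr.
    rewrite IH// mulrDr; congr (_ + _).
    rewrite /logd mulrC divfK ?pnatr_eq0//; congr ln.
    by case: w {p0} => a b; rewrite /sqmod/=; ring.
  by move=> e2; lra.
have aeF : {ae mu, forall t, K t -> ln `|Q.[t]| = ln `|lead_coef Q| + S t}.
  by apply: filterS (ae_not_in rs) => t h _; exact: FE.
have mQ : measurable_fun K (EFin \o (fun t => ln `|Q.[t]|)).
  by apply/measurable_EFinP; apply: measurable_funTS; exact: measurable_lnpoly.
have mKK := mK cK.
have IQ : Int (fun t => ln `|Q.[t]|).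
  apply: (integrable_ae_eq _ mQ IF) => //.
  by apply: filterS aeF => t h Kt /=; rewrite h.
split => //.
have := IF => /integrableP[mF _].
rewrite /lnmean /Rintegral (ae_eq_integral (fun t => (ln `|lead_coef Q| + S t)%:E))//; last first.
  by apply: filterS aeF => t h Kt /=; rewrite h.
by rewrite -[LHS]/('E[fun t => ln `|lead_coef Q| + S t]) (meanD cK Il IS) (mean_cst cK muK) ES.
Qed.

Lemma Int_lnpoly Q : Q != 0 -> Int (fun t => ln `|Q.[t]|).
Proof. by move=> Q0; have [rs [_ QE _]] := real_poly_roots Q0; have [] := lnmean_roots Q0 QE. Qed.

Lemma sum_robin (rs : seq C) : \sum_(z <- rs) - V = - ((size rs)%:R * V).
Proof.
elim: rs => [|z rs IH]; first by rewrite big_nil mul0r oppr0.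
by rewrite big_cons IH /= -[X in _ = - (X * _)]natr1; ring.
Qed.

Lemma lnmean_ge Q : Q != 0 -> lncap Q <= lnmean Q.
Proof.
move=> Q0; have [rs [szrs QE _]] := real_poly_roots Q0.
have [_ ->] := lnmean_roots Q0 QE; rewrite /lncap -szrs lerD2l -sum_robin.
by apply: ler_sum => z _; exact: (ep_ge mup).
Qed.

Lemma lnmean_ge_root Q (z : C) : Q != 0 -> root (map_poly (@cR R) Q) z ->
  lncap Q + (V + logmean K mu (complex.Re z) (complex.Im z)) <= lnmean Q.
Proof.
move=> Q0 zQ; have [rs [szrs QE rsE]] := real_poly_roots Q0.
have [_ ->] := lnmean_roots Q0 QE; rewrite /lncap -szrs -addrA lerD2l -sum_robin.
have zr : z \in rs by rewrite rsE.
rewrite !(perm_big _ (perm_to_rem zr))/= !big_cons.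
suff : \sum_(j <- rem z rs) - V <= \sum_(j <- rem z rs) logmean K mu (complex.Re j) (complex.Im j).
  by lra.
by apply: ler_sum => w _; exact: (ep_ge mup).
Qed.

Lemma lnmean_onK Q : Q != 0 ->
  (forall z, root (map_poly (@cR R) Q) z -> exists2 x, K x & z = cR x) ->
  lnmean Q = lncap Q.
Proof.
move=> Q0 QK; have [rs [szrs QE rsE]] := real_poly_roots Q0.
have [_ ->] := lnmean_roots Q0 QE; rewrite /lncap -szrs -sum_robin; congr (_ + _).
apply: eq_big_seq => z; rewrite rsE => /QK[x Kx ->]; exact: (ep_onK mup).
Qed.

Lemma lnmeanM P Q : P != 0 -> Q != 0 -> lnmean (P * Q) = lnmean P + lnmean Q.
Proof.
move=> P0 Q0; have PQ0 : P * Q != 0 by rewrite mulf_neq0.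
rewrite /lnmean -(meanD cK (Int_lnpoly P0) (Int_lnpoly Q0)).
have e : {ae mu, forall t, K t -> ln `|(P * Q).[t]| = ln `|P.[t]| + ln `|Q.[t]|}.
  apply: filterS2 (ae_nonroot P0) (ae_nonroot Q0) => t Pt Qt _.
  by rewrite hornerM normrM lnM ?posrE ?normr_gt0.
have IPQ := Int_lnpoly PQ0; have ID := IntD cK (Int_lnpoly P0) (Int_lnpoly Q0).
apply/eqP; rewrite eq_le; apply/andP; split; apply: (le_mean_ae cK) => //.
  by apply: filterS e => t h Kt; rewrite h.
by apply: filterS e => t h Kt; rewrite h.
Qed.

Lemma lnmean_le Q (g : R -> R) : Q != 0 -> Int g ->
  (forall t, K t -> ln `|Q.[t]| <= g t) -> lnmean Q <= 'E[g].
Proof. by move=> Q0 Ig h; apply: (le_mean cK) => //; exact: Int_lnpoly. Qed.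

Lemma lncap_comp p T : p != 0 -> (1 < size T)%N ->
  lncap (p \Po T) = ln `|lead_coef p| + (size p).-1%:R * lncap T.
Proof.
move=> p0 T1; have T0 : T != 0 by rewrite -size_poly_gt0 ltnW.
rewrite /lncap lead_coef_comp// normrM normrX lnM ?posrE ?exprn_gt0 ?normr_gt0 ?lead_coef_eq0//.
rewrite lnXn ?normr_gt0 ?lead_coef_eq0// size_comp_poly natrM -mulr_natl; ring.
Qed.

Lemma comp_neq0 p T : p != 0 -> (1 < size T)%N -> p \Po T != 0.
Proof. by move=> p0 T1; rewrite comp_poly_eq0. Qed.

Lemma lnmean_comp_ge p T : p != 0 -> (1 < size T)%N ->
  ln `|lead_coef p| + (size p).-1%:R * lncap T <= lnmean (p \Po T).
Proof. by move=> p0 T1; rewrite -lncap_comp// lnmean_ge// comp_neq0. Qed.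

Lemma probK_gt0 (A : set R) : {ae mu, forall t, A t} -> exists2 t, K t & A t.
Proof.
move=> [N [mN N0 AN]]; apply: contrapT => no.
have KN : K `<=` N by move=> t Kt; apply: AN => At; apply: no; exists t.
have K00 : mu K = 0%E by exact: (subset_measure0 (mK cK) mN KN N0).
by have := prob_onK cK muK; rewrite K00 => /eqP; rewrite eq_sym onee_eq0.
Qed.

Lemma mean_eq0_poly Q : (forall t, K t -> 0 <= Q.[t]) -> 'E[fun t => Q.[t]] = 0 -> Q = 0.
Proof.
move=> Qge QE; apply/eqP; apply/negPn/negP => Q0.
have m : measurable_fun K (fun t => Q.[t]%:E).
  by apply/measurable_EFinP; apply: measurable_funTS; exact: measurable_horner.
have E0 : (\int[mu]_(t in K) Q.[t]%:E = 0)%E.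
  have f : (\int[mu]_(t in K) Q.[t]%:E)%E \is a fin_num := integrable_fin_num (mK cK) (Int_poly Q).
  by rewrite -(fineK f); move: QE; rewrite /Rintegral => ->.
have E1 : (\int[mu]_(t in K) `|Q.[t]%:E| = 0)%E.
  by rewrite -[RHS]E0; apply: eq_integral => t /set_mem Kt; rewrite gee0_abs// lee_fin Qge.
have := (ae_eq_integral_abs mu (mK cK) m).1 E1 => h.
have [t Kt /=] := probK_gt0 (filterI h (ae_nonroot Q0)).
by case=> /(_ Kt) [->]; rewrite eqxx.
Qed.

End LogMeanPolynomials.

(** * The mean of a nonnegative polynomial *)

Section IntervalGreen.
Variable R : realType.
Implicit Types (s t p : R) (k : nat).

(** The derivative [2 / (1 - y^2)] of [ln ((1 + y) / (1 - y))] increases on [[0, 1[], so its value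
    at [p] bounds every slope on the left of [p]. *)
Lemma log_ratio_le (p' p : R) : 0 <= p' -> p' <= p -> p < 1 ->
  (1 - p ^+ 2) * (ln (1 + p) - ln (1 - p) - (ln (1 + p') - ln (1 - p'))) <= 2 * (p - p').
Proof.
move=> p'0; rewrite le_eqVlt => /predU1P[-> _|pp p1]; first by rewrite !subrr !mulr0.
pose f := (fun y : R => ln (1 + y)) - (fun y : R => ln (1 - y)).
have df (y : R) : 0 <= y -> y < 1 -> is_derive y 1 f ((1 + y)^-1 + (1 - y)^-1).
  move=> y0 y1; have d1 : is_derive y 1 (fun y : R => ln (1 + y)) (1 + y)^-1.
    rewrite -[X in is_derive _ _ _ X]mulr1; apply: (@is_derive1_comp R (@ln R) (fun y => 1 + y)).
      by apply: is_derive1_ln; lra.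
    by rewrite -[X in is_derive _ _ _ X]add0r; apply: is_deriveD.
  have d2 : is_derive y 1 (fun y : R => ln (1 - y)) (- (1 - y)^-1).
    rewrite -[X in is_derive _ _ _ X]mulrN1; apply: (@is_derive1_comp R (@ln R) (fun y => 1 - y)).
      by apply: is_derive1_ln; lra.
    by rewrite -[X in is_derive _ _ _ X]add0r; apply: is_deriveB.
  by rewrite -[X in _ + X]opprK; exact: is_deriveB.
have [||x] := @MVT R f (fun y => (1 + y)^-1 + (1 - y)^-1) p' p pp.
- by move=> y; rewrite in_itv/= => /andP[y1 y2]; apply: df; lra.
- apply: derivable_within_continuous => y; rewrite in_itv/= => /andP[y1 y2].
  by have [] : is_derive y 1 f ((1 + y)^-1 + (1 - y)^-1) by apply: df; lra.
rewrite in_itv/= => /andP[x1 x2] e.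
have -> : ln (1 + p) - ln (1 - p) - (ln (1 + p') - ln (1 - p')) = f p - f p' by [].
rewrite e mulrA ler_wpM2r//; first by rewrite subr_ge0 ltW.
have -> : (1 + x)^-1 + (1 - x)^-1 = 2 / (1 - x ^+ 2).
  by field; rewrite !gt_eqF//=; nra.
rewrite mulrCA -[leRHS]mulr1 ler_pM2l// ler_pdivrMr ?mul1r; nra.
Qed.

(* [exp] of the Green function with pole at infinity of the complement of [[0, 4s]],
   on the half-line [t >= 0]; [green s] integrates to [t / 2] over [s > 0]. *)
Definition jouk s t : R := let y := Num.max 1 (t / (2 * s) - 1) in y + Num.sqrt (y ^+ 2 - 1).
Definition green s t : R := ln (jouk s t).

Lemma jouk_props s t : 0 < s -> exists y, [/\ y = Num.max 1 (t / (2 * s) - 1), 1 <= y,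
  1 <= jouk s t, jouk s t <= 2 * y & jouk s t ^+ 2 + 1 = 2 * jouk s t * y].
Proof.
move=> s0; rewrite /jouk; set y := Num.max _ _; exists y.
have y1 : 1 <= y by rewrite /y le_max lexx.
have y2 : 0 <= y ^+ 2 - 1 by rewrite subr_ge0 exprn_ege1.
have q0 := sqrtr_ge0 (y ^+ 2 - 1); have q2 := sqr_sqrtr y2.
split => //; first by lra.
  suff : Num.sqrt (y ^+ 2 - 1) <= y by lra.
  by rewrite -(@ler_pXn2r _ 2) ?nnegrE// ?q2; lra.
rewrite sqrrD q2; ring.
Qed.

Lemma jouk_eq1 s t : 0 < s -> t <= 4 * s -> jouk s t = 1.
Proof.
move=> s0 ts; rewrite /jouk; have -> : Num.max 1 (t / (2 * s) - 1) = 1.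
  apply/max_idPl; rewrite lerBlDr ler_pdivrMr ?mulr_gt0//; lra.
by rewrite expr1n subrr sqrtr0 addr0.
Qed.

Lemma jouk_ge1 s t : 0 < s -> 1 <= jouk s t.
Proof. by move=> /(jouk_props t)[y []]. Qed.

Lemma green_ge0 s t : 0 < s -> 0 <= green s t.
Proof. by move=> s0; rewrite ln_ge0// jouk_ge1. Qed.

Lemma green_le s t : 0 < s -> 0 <= t -> green s t <= 4 + t / s.
Proof.
move=> s0 t0; have [y [yE y1 j1 j2 _]] := jouk_props t s0.
have : ln (1 + (jouk s t - 1)) <= jouk s t - 1 by apply: le_ln1Dx; lra.
have -> : 1 + (jouk s t - 1) = jouk s t by ring.
rewrite -/(green s t); have : y <= 1 + t / (2 * s).
  have : 0 <= t / (2 * s) by rewrite divr_ge0// mulr_ge0// ltW.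
  by rewrite yE ge_max; move=> h; apply/andP; split; lra.
have -> : t / s = 2 * (t / (2 * s)) by field; rewrite gt_eqF.
lra.
Qed.

Lemma measurable_green s : measurable_fun setT (green s).
Proof.
apply: measurableT_comp; first exact: measurable_ln.
have my : measurable_fun setT (fun t : R => Num.max 1 (t / (2 * s) - 1)).
  apply: (measurable_maxr (f := fun=> 1) (g := fun t : R => t / (2 * s) - 1)) => //.
  by apply: measurable_funB => //; apply: measurable_funM.
apply: measurable_funD => //.
apply: (measurableT_comp (f := @Num.sqrt R)).
  by apply: continuous_measurable_fun => x; exact: sqrt_continuous.
by apply: measurable_funB => //; exact: measurable_funX.
Qed.

(** This is [tanh (green s t / 2)], which for [t >= 4 s] equals [sqrt (1 - 4 s / t)]. In this
    variable [s = t / 4 (1 - p^2)], which makes the integral of [green] over [s] elementary. *)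
Definition gp s t : R := (jouk s t - 1) / (jouk s t + 1).

Lemma gp_props s t : 0 < s -> [/\ 0 <= gp s t, gp s t < 1 &
  green s t = ln (1 + gp s t) - ln (1 - gp s t)].
Proof.
move=> s0; have j1 := jouk_ge1 t s0; rewrite /gp /green.
move: (jouk s t) j1 => x x1.
have x2 : 0 < x + 1 by lra.
split; first by rewrite divr_ge0//; lra.
  by rewrite ltr_pdivrMr//; lra.
have -> : 1 + (x - 1) / (x + 1) = 2 * x / (x + 1) by field; rewrite gt_eqF.
have -> : 1 - (x - 1) / (x + 1) = 2 / (x + 1) by field; rewrite gt_eqF.
have xp : 0 < x by lra.
by rewrite !ln_div ?posrE ?mulr_gt0// lnM ?posrE//; ring.
Qed.

Lemma jouk_decr s s' t : 0 <= t -> 0 < s -> s <= s' -> jouk s' t <= jouk s t.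
Proof.
move=> t0 s0 ss; rewrite /jouk; have s'0 : 0 < s' by lra.
set y' := Num.max 1 (t / (2 * s') - 1); set y := Num.max 1 (t / (2 * s) - 1).
have yy : y' <= y.
  rewrite /y' /y ge_max !le_max lexx/=; apply/orP; right.
  by rewrite lerD2r ler_wpM2l// lef_pV2 ?posrE ?mulr_gt0// ler_pM2l.
have y1 : 1 <= y' by rewrite /y' le_max lexx.
by rewrite lerD// ler_wsqrtr// lerD2r ler_pXn2r ?nnegrE//; lra.
Qed.

Lemma green_decr s s' t : 0 <= t -> 0 < s -> s <= s' -> green s' t <= green s t.
Proof.
move=> t0 s0 ss; have s'0 : 0 < s' by lra.
have := jouk_ge1 t s0; have := jouk_ge1 t s'0 => a b.
by rewrite /green ler_ln ?posrE ?jouk_decr//; lra.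
Qed.

Lemma gp_decr s s' t : 0 <= t -> 0 < s -> s <= s' -> gp s' t <= gp s t.
Proof.
move=> t0 s0 ss; have s'0 : 0 < s' by lra.
have := jouk_ge1 t s0; have := jouk_ge1 t s'0; have := jouk_decr t0 s0 ss; rewrite /gp.
move: (jouk s t) (jouk s' t) => x x' h a b.
have x0 : 0 < x + 1 by lra.
have x'0 : 0 < x' + 1 by lra.
rewrite ler_pdivrMr// mulrAC ler_pdivlMr//; lra.
Qed.

(** A discrete form of [s dg = t / 4 (1 - p^2) (2 dp / (1 - p^2)) = t / 2 dp]. *)
Lemma green_slope s p' t : 0 <= t -> 0 < s -> 0 <= p' -> p' <= gp s t ->
  s * (green s t - (ln (1 + p') - ln (1 - p'))) <= t / 2 * (gp s t - p').
Proof.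
move=> t0 s0 p'0 pp; have [p0 p1 ->] := gp_props t s0.
have [ts|ts] := leP t (4 * s).
  have j1 := jouk_eq1 s0 ts.
  have g0 : gp s t = 0 by rewrite /gp j1 subrr mul0r.
  have e0 : p' = 0 by lra.
  by rewrite g0 e0 !subrr !mulr0.
have [y [yE y1 j1 _ jE]] := jouk_props t s0.
have ym : y = t / (2 * s) - 1.
  rewrite yE; apply/max_idPr; rewrite lerBrDr ler_pdivlMr ?mulr_gt0//; lra.
have sE : s = t / 4 * (1 - gp s t ^+ 2).
  have tE : t = 2 * s * (y + 1) by rewrite ym; field; rewrite gt_eqF.
  rewrite /gp; move: (jouk s t) j1 jE => x x1 jE.
  have -> : 1 - ((x - 1) / (x + 1)) ^+ 2 = 4 * x / (x + 1) ^+ 2 by field; lra.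
  have -> : (x + 1) ^+ 2 = 2 * x * (y + 1) by rewrite sqrrD; lra.
  by rewrite tE; field; lra.
have := log_ratio_le p'0 pp p1; move/(ler_wpM2l (_ : 0 <= t / 4)).
rewrite mulrA -sE => h; have {}h := h (divr_ge0 t0 (ler0n _ 4)); lra.
Qed.

(** Integration by parts gives the integral of [green] over []0, s]] as
    [Ga s = s green + t / 2 (1 - gp)]. By [green_slope] each term of the Riemann sum is at most the
    increment of [Ga], and [Ga s <= t / 2]. *)
Lemma green_sum h t (M : nat) : 0 < h -> 0 <= t ->
  \sum_(j < M) h * green (j.+1%:R * h) t <= t / 2.
Proof.
move=> h0 t0; pose Ga s := s * green s t + t / 2 * (1 - gp s t).
have sj j : 0 < j.+1%:R * h :> R by rewrite mulr_gt0.
have GaM (n : nat) : \sum_(j < n.+1) h * green (j.+1%:R * h) t <= Ga (n.+1%:R * h).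
  elim: n => [|n IH].
    rewrite big_ord1 /Ga !mul1r lerDl mulr_ge0 ?divr_ge0// subr_ge0 ltW//.
    by have [] := gp_props t h0.
  rewrite big_ord_recr/=; apply: (le_trans (lerD IH (lexx _))).
  have ss : n.+1%:R * h <= n.+2%:R * h by rewrite ler_pM2r// ler_nat.
  have [q0 q1 qE] := gp_props t (sj n.+1).
  have := green_slope t0 (sj n) q0 (gp_decr t0 (sj n) ss); rewrite -qE /Ga.
  have -> : h * green (n.+2%:R * h) t = n.+2%:R * h * green (n.+2%:R * h) t - n.+1%:R * h * green (n.+2%:R * h) t.
    by rewrite -mulrBl -mulrBl -natrB// subSnn mul1r.
  lra.
case: M => [|n]; first by rewrite big_ord0 divr_ge0.
apply: (le_trans (GaM n)); have [p0 p1 pE] := gp_props t (sj n).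
by have := green_slope t0 (sj n) (lexx 0) p0; rewrite subr0 addr0 ln1 subrr subr0 /Ga; lra.
Qed.

(* Chebyshev polynomials of degree [2^k] of the interval [[0, 4s]], normalised to sup norm 1. *)
Fixpoint cheb s k : {poly R} :=
  if k is k'.+1 then 2 *: cheb s k' ^+ 2 - 1 else (2 * s)^-1 *: 'X - 1.

Lemma cheb_size_lead s k : 0 < s -> size (cheb s k) = (2 ^ k).+1 /\
  lead_coef (cheb s k) != 0 /\
  ln `|lead_coef (cheb s k)| = - ((2 ^ k)%:R * ln s) - ln 2.
Proof.
move=> s0; have l2 : (0 : R) < 2 * s by rewrite mulr_gt0.
elim: k => [|k [sz [l0 lE]]].
  have i0 : (2 * s)^-1 != 0 by rewrite invr_eq0 gt_eqF.
  have szX : (size (1%R : {poly R}) < size ((2 * s)^-1 *: 'X : {poly R}))%N.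
    by rewrite size_scale// size_polyX size_poly1.
  rewrite /= size_polyDl ?size_polyN// size_scale// size_polyX.
  rewrite lead_coefDl ?size_polyN// lead_coefZ lead_coefX mulr1; split => //; split => //.
  by rewrite gtr0_norm ?invr_gt0// lnV ?posrE// lnM ?posrE// mul1r; ring.
have c0 : cheb s k != 0 by rewrite -lead_coef_eq0.
have n2 : 2 != 0 :> R by rewrite pnatr_eq0.
have szS : size (2 *: cheb s k ^+ 2) = (2 ^ k.+1).+1.
  by rewrite size_scale// expr2 size_mul// sz expnS mul2n -addnn addSn addnS.
have sz1 : (size (- 1 : {poly R})%R < size (2 *: cheb s k ^+ 2)%R)%N.
  by rewrite size_polyN size_poly1 szS ltnS expn_gt0.
rewrite /= size_polyDl// lead_coefDl// szS lead_coefZ lead_coef_exp; split => //.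
split; first by rewrite mulf_neq0// expf_neq0.
rewrite normrM normrX lnM ?posrE ?exprn_gt0 ?normr_gt0//.
rewrite lnXn ?normr_gt0// lE ger0_norm// -(mulr_natl _ 2) expnS natrM; ring.
Qed.

Lemma cheb_bound s k t : 0 < s -> 0 <= t ->
  `|(cheb s k).[t]| <= (jouk s t ^+ (2 ^ k) + (jouk s t ^+ (2 ^ k))^-1) / 2.
Proof.
move=> s0 t0; have [y [yE y1 j1 _ jE]] := jouk_props t s0; set x := jouk s t in j1 jE *.
have a0 (j : nat) : 1 <= x ^+ j by rewrite exprn_ege1.
elim: k => [|k IH].
  rewrite /= expr1 !hornerE.
  have -> : (x + x^-1) / 2 = y.
    have xp : x != 0 by rewrite gt_eqF//; lra.
    apply: (mulfI xp); rewrite mulrA; have -> : x * (x + x^-1) = x ^+ 2 + 1 by field.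
    by rewrite jE; field.
  have h : 0 <= t / (2 * s) by rewrite divr_ge0// mulr_ge0// ltW.
  rewrite mulrC ler_norml; apply/andP; split; first by lra.
  by rewrite yE le_max lexx orbT.
rewrite /= hornerD hornerN hornerZ hornerC horner_exp.
have aE : x ^+ (2 ^ k.+1) = (x ^+ (2 ^ k)) ^+ 2 by rewrite -exprM expnSr.
rewrite aE; move: (x ^+ (2 ^ k)) (a0 (2 ^ k)%N) IH => a a1 IH.
have ai : a * a^-1 = 1 by rewrite divff// gt_eqF//; lra.
have ai0 : 0 < a^-1 by rewrite invr_gt0; lra.
have e2 : ((a + a^-1) / 2) ^+ 2 * 2 - 1 = (a ^+ 2 + (a ^+ 2)^-1) / 2.
  by field; lra.
have sq : (cheb s k).[t] ^+ 2 <= ((a + a^-1) / 2) ^+ 2.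
  rewrite -(real_normK (num_real (cheb s k).[t])) ler_pXn2r ?nnegrE// divr_ge0//; lra.
have ge1 : 1 <= (a ^+ 2 + (a ^+ 2)^-1) / 2.
  rewrite -e2; have : 1 <= ((a + a^-1) / 2) ^+ 2 by rewrite exprn_ege1//; nra.
  lra.
have := sqr_ge0 (cheb s k).[t].
by rewrite ler_norml -e2 => h; apply/andP; split; move: ge1; rewrite -e2; lra.
Qed.

Lemma ln_cheb_le s k t : 0 < s -> 0 <= t -> ln `|(cheb s k).[t]| <= (2 ^ k)%:R * green s t.
Proof.
move=> s0 t0; have j1 := jouk_ge1 t s0.
have g0 : 0 <= (2 ^ k)%:R * green s t by rewrite mulr_ge0// green_ge0.
have [c0|c0] := eqVneq (cheb s k).[t] 0; first by rewrite c0 normr0 ln0.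
have -> : (2 ^ k)%:R * green s t = ln (jouk s t ^+ (2 ^ k)).
  by rewrite /green lnXn ?mulr_natl//; lra.
have a1 : 1 <= jouk s t ^+ (2 ^ k) by rewrite exprn_ege1.
rewrite ler_ln ?posrE ?normr_gt0//; last by lra.
apply: (le_trans (cheb_bound k s0 t0)).
suff : (jouk s t ^+ (2 ^ k))^-1 <= 1 by lra.
by rewrite invf_le1//; lra.
Qed.

Lemma ln_lt_linear (e : R) : 0 < e -> exists m0 : nat, forall m, (m0 < m)%N -> 1 + ln m%:R <= e * m%:R.
Proof.
move=> e0; exists (Num.trunc ((3 / e) ^+ 2)) => m hm.
have m0 : (0 < m)%N by rewrite (leq_ltn_trans _ hm).
have mp : (0 : R) < m%:R by rewrite ltr0n.
set q := Num.sqrt (m%:R : R).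
have q2 : q ^+ 2 = m%:R by rewrite sqr_sqrtr// ltW.
have qp : 0 < q by rewrite sqrtr_gt0.
have q1 : 1 <= q by rewrite -(@ler_pXn2r _ 2) ?nnegrE// ?q2 ?expr1n ?ler1n// ltW.
have eq3 : 3 <= e * q.
  rewrite mulrC -ler_pdivrMr// -(@ler_pXn2r _ 2) ?nnegrE ?divr_ge0// ?(ltW e0) ?(ltW qp)// q2.
  by rewrite (le_trans (ltW (truncnS_gt _)))// ler_nat.
have lq : ln q <= q - 1.
  have := @le_ln1Dx R (q - 1); have -> : 1 + (q - 1) = q by ring.
  by apply; lra.
rewrite -q2 lnXn// -(mulr_natl _ 2) expr2; nra.
Qed.

(** The half of Stirling's formula by which the Riemann sum of [ln (c / s)] over []0, c]] tends to
    at least [c]. *)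
Lemma sum_ln_le (m : nat) : (0 < m)%N ->
  \sum_(j < m) ln (j.+1%:R : R) <= m.+1%:R * ln m%:R + 1 - m%:R.
Proof.
case: m => // m _; elim: m => [|m IH]; first by rewrite big_ord1 ln1; lra.
rewrite big_ord_recr/=; apply: (le_trans (lerD IH (lexx _))).
have m1 : (0 : R) < m.+1%:R by rewrite ltr0n.
have m2 : (0 : R) < m.+2%:R by rewrite ltr0n.
have := ln_le_tangent m1 m2.
have -> : m.+1%:R / m.+2%:R - 1 = - (m.+2%:R)^-1 :> R.
  by rewrite -[m.+2%:R]natr1; field; rewrite gt_eqF// addr_gt0.
move=> h; have := ler_wpM2l (ltW m2) h.
rewrite mulrDr mulrN divff ?gt_eqF// => {}h.
have e3 : m.+3%:R = m.+2%:R + 1 :> R by rewrite natr1.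
have e2 : m.+2%:R = m.+1%:R + 1 :> R by rewrite natr1.
rewrite e3; lra.
Qed.

End IntervalGreen.

(** * Integration of the Green function bounds over [s] *)

Section MeanInequality.
Variables (R : realType) (K : set R).
Hypotheses (cK : compact K) (K1 : K `<=` [set x : R | -1 <= x <= 1]).
Variables (mu : probability R R) (V : R).
Hypotheses (muK : prob_on K mu) (mup : equilibrium_potential K mu V).
Variable T : {poly R}.
Hypotheses (T1 : (1 < size T)%N) (T0 : forall x, K x -> 0 <= T.[x]).
Local Notation Int f := (mu.-integrable K (EFin \o f)).
Local Notation "'E[ f ]" := (\int[mu]_(t in K) f t).

Let phi s := 'E[fun t => green s T.[t]].

Lemma Int_green s : 0 < s -> Int (fun t => green s T.[t]).
Proof.
move=> s0; have [M M0 TM] := poly_bounded K1 T.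
apply: (@Int_bounded _ _ cK _ muK _ (4 + M / s)).
  apply: measurableT_comp; first exact: measurable_green.
  exact: measurable_horner.
move=> t Kt; rewrite ger0_norm ?green_ge0//.
rewrite (le_trans (green_le s0 (T0 Kt)))// lerD2l ler_pM2r ?invr_gt0//.
by rewrite (le_trans (ler_norm _))// TM.
Qed.

Lemma phi_ge0 s : 0 < s -> 0 <= phi s.
Proof. by move=> s0; apply: Rintegral_ge0 => t _; exact: green_ge0. Qed.

(** Degree [2^k] gives the inequality multiplied by [2^k] with a loss of only [ln 2], from the
    leading coefficient; letting [k] grow removes the loss. *)
Lemma phi_ge s : 0 < s -> lncap V T - ln s <= phi s.
Proof.
move=> s0; suff h k : (2 ^ k)%:R * (lncap V T - ln s - phi s) <= ln 2.
  rewrite -subr_le0 leNgt; apply/negP => d0.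
  set d := lncap V T - ln s - phi s in h d0.
  have l2 : 0 <= ln 2 :> R by rewrite ln_ge0// ler1n.
  have := h (Num.trunc (ln 2 / d)); apply/negP; rewrite -ltNge -ltr_pdivrMr//.
  rewrite (lt_le_trans (truncnS_gt _))// ler_nat.
  exact: ltn_expl.
have [sz [l0 lE]] := cheb_size_lead k s0.
have c0 : cheb s k != 0 by rewrite -lead_coef_eq0.
have := lnmean_comp_ge cK muK mup c0 T1; rewrite lE sz /= => h1.
have : lnmean K mu (cheb s k \Po T) <= 'E[fun t => green s T.[t] * (2 ^ k)%:R].
  apply: (lnmean_le cK muK mup); [exact: comp_neq0|exact: IntZ (Int_green s0)|].
  by move=> t Kt; rewrite horner_comp mulrC ln_cheb_le// T0.
rewrite (meanZ cK _ (Int_green s0)) -/(phi s); lra.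
Qed.

Lemma phi_decr s s' : 0 < s -> s <= s' -> phi s' <= phi s.
Proof.
move=> s0 ss; have s'0 : 0 < s' by lra.
apply: (le_mean cK); [exact: Int_green|exact: Int_green|].
by move=> t Kt; apply: green_decr => //; exact: T0.
Qed.

Lemma phi_sum h (M : nat) : 0 < h ->
  \sum_(j < M) h * phi (j.+1%:R * h) <= 'E[fun t => T.[t]] / 2.
Proof.
move=> h0; have sj j : 0 < j.+1%:R * h :> R by rewrite mulr_gt0.
have [IS ES] : Int (fun t => \sum_(j < M) h * green (j.+1%:R * h) T.[t]) /\
    'E[fun t => \sum_(j < M) h * green (j.+1%:R * h) T.[t]] = \sum_(j < M) h * phi (j.+1%:R * h).
  elim: M => [|M [IH1 IH2]].
    have -> : (fun t : R => \sum_(j < 0) h * green (j.+1%:R * h) T.[t]) = fun=> 0.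
      by apply/funext => t; rewrite big_ord0.
    by rewrite big_ord0 (mean_cst cK muK); split => //; exact: Int_cst.
  have -> : (fun t : R => \sum_(j < M.+1) h * green (j.+1%:R * h) T.[t]) =
    fun t => \sum_(j < M) h * green (j.+1%:R * h) T.[t] + green (M.+1%:R * h) T.[t] * h.
    by apply/funext => t; rewrite big_ord_recr/= [h * _]mulrC.
  have IM := IntZ cK h (Int_green (sj M)).
  rewrite big_ord_recr/= (meanD cK IH1 IM) IH2 (meanZ cK _ (Int_green (sj M))).
  by split; [exact: IntD|congr (_ + _); exact: mulrC].
have IT := Int_poly cK K1 muK T.
rewrite -ES -(meanZ cK _ IT); apply: (le_mean cK); [exact: IS|exact: IntZ|].
by move=> t Kt; exact: green_sum h0 (T0 Kt).
Qed.

Let c := expR (lncap V T).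

Lemma mean_ge_phi (r : nat) : (0 < r)%N ->
  c + c / r%:R * phi (c * (1 + r%:R^-1)) <= 'E[fun t => T.[t]] / 2.
Proof.
move=> r0; have c0 : 0 < c by exact: expR_gt0.
have rp : (0 : R) < r%:R by rewrite ltr0n.
apply/ler_addgt0Pr => e e0.
have [m0 hm0] := ln_lt_linear (divr_gt0 e0 c0).
pose k := m0.+1; pose m := (r * k)%N.
have k0 : (0 : R) < k%:R by rewrite ltr0n.
have mk : (m0 < m)%N by rewrite /m -[m0]mul1n (leq_ltn_trans (leq_mul r0 (leqnn m0)))// ltn_pmul2l.
have mp : (0 : R) < m%:R by rewrite ltr0n (leq_ltn_trans _ mk).
have mE : m%:R = r%:R * k%:R :> R by rewrite natrM.
pose h := c / m%:R; have h0 : 0 < h by rewrite divr_gt0.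
have hk : k%:R * h = c / r%:R by rewrite /h mE; field; rewrite !gt_eqF.
have hm : m%:R * h = c by rewrite /h mulrC divfK// gt_eqF.
apply: (le_trans _ (lerD (phi_sum (m + k) h0) (lexx e))).
rewrite big_split_ord/=.
have s1 : c - e <= \sum_(j < m) h * phi (j.+1%:R * h).
  apply: (@le_trans _ _ (\sum_(j < m) h * (ln m%:R - ln j.+1%:R))); last first.
    apply: ler_sum => j _; rewrite ler_pM2l//.
    apply: le_trans (phi_ge _); last by rewrite mulr_gt0.
    rewrite lnM ?posrE// /h ln_div ?posrE// /c expRK; lra.
  rewrite -mulr_sumr sumrB sumr_const card_ord.
  have mgt : (0 < m)%N by rewrite (leq_ltn_trans _ mk).
  have := sum_ln_le R mgt => hs.
  have hl := hm0 _ mk.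
  have : h * (m%:R - 1 - ln m%:R) <= h * (ln m%:R *+ m - \sum_(j < m) ln j.+1%:R).
    rewrite ler_pM2l// -(mulr_natl (ln _)); move: hs; rewrite -[m.+1%:R]natr1; lra.
  apply: le_trans.
  have -> : h * (m%:R - 1 - ln m%:R) = c - h * (1 + ln m%:R) by rewrite -hm; ring.
  rewrite lerD2l lerN2.
  apply: (le_trans (ler_wpM2l (ltW h0) hl)).
  rewrite /h le_eqVlt; apply/orP; left; apply/eqP; field.
  by rewrite !gt_eqF.
have s2 : c / r%:R * phi (c * (1 + r%:R^-1)) <= \sum_(j < k) h * phi ((m + j).+1%:R * h).
  have -> : c / r%:R * phi (c * (1 + r%:R^-1)) = \sum_(j < k) h * phi (c * (1 + r%:R^-1)).
    by rewrite sumr_const card_ord -(mulr_natl (h * _)) mulrA hk.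
  apply: ler_sum => j _; rewrite ler_pM2l//; apply: phi_decr.
    by apply: mulr_gt0 h0; rewrite ltr0n.
  have -> : c * (1 + r%:R^-1) = (m + k)%:R * h by rewrite natrD mulrDl hm hk mulrDr mulr1.
  by rewrite ler_pM2r// ler_nat -addnS leq_add2l.
lra.
Qed.

Lemma mean_ge : 2 * c <= 'E[fun t => T.[t]].
Proof.
have c0 : 0 < c by exact: expR_gt0.
have := mean_ge_phi (ltn0Sn 0).
have s0 : 0 < c * (1 + 1%:R^-1) by rewrite mulr_gt0// addr_gt0// invr_gt0.
have := mulr_ge0 (divr_ge0 (ltW c0) (ler0n R 1)) (phi_ge0 s0); lra.
Qed.

(** Equality forces [phi (c (1 + 1 / r)) = 0] for every [r]. If [T(x) > 4 c], some [r] has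
    [4 c (1 + 1 / r) < T(x)], and then [green] of [T] is positive on a ball around [x], which has
    positive measure in [K]. *)
Lemma mean_eq_bound : 'E[fun t => T.[t]] = 2 * c -> forall x, K x -> T.[x] <= 4 * c.
Proof.
move=> TE x Kx; have c0 : 0 < c by exact: expR_gt0.
rewrite leNgt; apply/negP => Tx.
pose g := T.[x] / (4 * c) - 1.
have g0 : 0 < g by rewrite subr_gt0 ltr_pdivlMr ?mul1r// mulr_gt0.
pose r := (Num.trunc (g^-1)).+1.
have rp : (0 : R) < r%:R by rewrite ltr0n.
have rg : r%:R^-1 < g.
  by rewrite invf_plt ?posrE// truncnS_gt.
pose s := c * (1 + r%:R^-1).
have s0 : 0 < s by rewrite mulr_gt0// addr_gt0// invr_gt0.
have sT : 4 * s < T.[x].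
  have -> : T.[x] = 4 * c * (1 + g) by rewrite /g; field; rewrite gt_eqF.
  by rewrite /s mulrA ltr_pM2l ?mulr_gt0// ltrD2l.
have phi0 : phi s = 0.
  apply/eqP; rewrite eq_le phi_ge0// andbT.
  have := mean_ge_phi (ltn0Sn (Num.trunc (g^-1))); rewrite -/r -/s TE.
  have cr : 0 < c / r%:R by rewrite divr_gt0.
  move=> h; have {}h : c / r%:R * phi s <= 0 by lra.
  by rewrite -(pmulr_rle0 _ cr).
have mg : measurable_fun K (fun t => (green s T.[t])%:E).
  apply/measurable_EFinP; apply: measurable_funTS.
  by apply: measurableT_comp; [exact: measurable_green|exact: measurable_horner].
have E0 : (\int[mu]_(t in K) (green s T.[t])%:E = 0)%E.
  have f : (\int[mu]_(t in K) (green s T.[t])%:E)%E \is a fin_num := integrable_fin_num (mK cK) (Int_green s0).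
  by rewrite -(fineK f); move: phi0; rewrite /phi /Rintegral => ->.
have E1 : (\int[mu]_(t in K) `|(green s T.[t])%:E| = 0)%E.
  by rewrite -[RHS]E0; apply: eq_integral => t _; rewrite gee0_abs// lee_fin green_ge0.
have [N [mN N0 HN]] := (ae_eq_integral_abs mu (mK cK) mg).1 E1.
have cT : T.[y] @[y --> x] --> T.[x] by exact: continuous_horner.
have [e e0 he] : exists2 e : R, 0 < e & forall y, ball x e y -> 4 * s < T.[y].
  have : nbhs x (fun y => 4 * s < T.[y]) by exact: (@cvgr_gt _ _ _ _ _ _ cT _ sT).
  by move/(nbhs_ballP x) => [e /= e0 he]; exists e.
apply: (ep_support mup Kx e0).
apply: (subset_measure0 _ mN _ N0).
  by apply: measurableI; [exact: mK|exact: measurable_ball].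
move=> y [Ky /he hy]; apply: HN => /= /(_ Ky) [].
apply/eqP; rewrite gt_eqF// /green ln_gt0//.
have [z [zE z1 j1 _ jE]] := jouk_props T.[y] s0.
have z2 : 1 < z by rewrite zE lt_max; apply/orP; right; rewrite ltrBrDr ltr_pdivlMr ?mulr_gt0//; lra.
rewrite lt_neqAle j1 andbT eq_sym; apply/eqP => je; move: jE; rewrite je; lra.
Qed.

End MeanInequality.

(** * Equality case and inverse images *)

Section ChebyshevNodes.
Variable R : realType.
Implicit Types (s : R) (k : nat).

Lemma cheb_cos s k (th : R) : 0 < s -> (cheb s k).[2 * s * (1 + cos th)] = cos (th *+ 2 ^ k).
Proof.
move=> s0; elim: k => [|k IH].
  rewrite /= hornerD hornerN hornerC hornerZ hornerX expn0 mulr1n.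
  by field; rewrite gt_eqF.
rewrite /= hornerD hornerN hornerZ hornerC horner_exp IH expnS mulnC mulrnA cos_mulr2n.
by rewrite mulr_natl.
Qed.

(** In the variable [b = 2 s (1 + cos x)] the polynomial is [cos (2^k x)], which takes one value
    [kap] at all shifts of the angle [th] of [b0] by multiples of [2 pi / 2^k]. The sign [sg] of the
    shift keeps the angles in [[0, pi]], where [cos] is injective. *)
Lemma cheb_nodes s (b0 e : R) (M : nat) : 0 < s -> 0 < e -> 0 <= b0 <= 4 * s ->
  exists k (kap : R) (bs : seq R), [/\ `|kap| <= 1, uniq bs, size bs = M &
    forall b, b \in bs -> `|b - b0| < e /\ root (cheb s k - kap%:P) b].
Proof.
move=> s0 e0 /andP[b00 b04].
have a1 : -1 <= b0 / (2 * s) - 1 <= 1.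
  have h : 0 <= b0 / (2 * s) by rewrite divr_ge0// mulr_ge0// ltW.
  have h2 : b0 / (2 * s) <= 2 by rewrite ler_pdivrMr ?mulr_gt0//; lra.
  by apply/andP; split; lra.
have [/andP[th0 thpi] cth] := acos_def a1; set th := acos _ in th0 thpi cth.
have b0E : b0 = 2 * s * (1 + cos th) by rewrite cth; field; rewrite gt_eqF.
have pi0 : 0 < pi :> R := pi_gt0 R.
have [d d0 hd] : exists2 d : R, 0 < d & forall x, `|th - x| < d -> `|2 * s * (1 + cos x) - b0| < e.
  have e2 : 0 < e / (2 * s) by rewrite divr_gt0// mulr_gt0.
  have cc : cos x @[x --> th] --> cos th by exact: continuous_cos.
  have /(nbhs_ballP th)[d /= d0 hd] : nbhs th (fun x => `|cos th - cos x| < e / (2 * s)).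
    by have /cvgrPdist_lt := cc; apply.
  exists d => // x /hd hx; rewrite b0E.
  have -> : 2 * s * (1 + cos x) - 2 * s * (1 + cos th) = - (2 * s * (cos th - cos x)) by ring.
  by rewrite normrN normrM gtr0_norm ?mulr_gt0// mulrC -ltr_pdivlMr ?mulr_gt0.
(* The first summand keeps [M] shifts within [d], the second keeps them below [pi / 2]. *)
pose k := Num.trunc (2 * pi * M%:R / d + 4 * M%:R).
have k2 : 2 * pi * M%:R / d + 4 * M%:R < 2 ^+ k.
  rewrite -natrX (lt_le_trans (truncnS_gt _))// ler_nat; exact: ltn_expl.
have kp : 0 < 2 ^+ k :> R by rewrite exprn_gt0.
pose sg : R := if th <= pi / 2 then 1 else -1.
pose x (j : nat) : R := th + sg * (2 * pi * j%:R / 2 ^+ k).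
have xj j : (j < M)%N -> 0 <= 2 * (pi : R) * j%:R / 2 ^+ k < d /\
    2 * (pi : R) * j%:R / 2 ^+ k <= (pi : R) / 2.
  move=> jM; have jR : j%:R < M%:R :> R by rewrite ltr_nat.
  have j0 : 0 <= j%:R :> R by [].
  have M0 : 0 <= 2 * pi * M%:R / d by rewrite divr_ge0 ?mulr_ge0// ltW.
  split.
    apply/andP; split; first by apply: divr_ge0; [rewrite !mulr_ge0 ?pi_ge0|exact: ltW].
    rewrite ltr_pdivrMr// [d * _]mulrC -ltr_pdivrMr//; apply: le_lt_trans (_ : _ <= 2 * pi * M%:R / d) _.
      by rewrite ler_pM2r ?invr_gt0// ler_pM2l ?mulr_gt0// ltW.
    by apply: le_lt_trans k2; rewrite lerDl mulr_ge0.
  rewrite ler_pdivrMr//.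
  have h4 : 4 * j%:R <= 2 ^+ k :> R by lra.
  by have := ler_wpM2l (ltW pi0) h4; lra.
have xpi j : (j < M)%N -> x j \in `[0, (pi : R)].
  move=> /xj[/andP[h1 _] h2]; rewrite in_itv/= /x /sg.
  by case: ifP => [ht|/negbT]; [|rewrite -ltNge => ht]; apply/andP; split; lra.
pose f j := 2 * s * (1 + cos (x j)).
exists k, (cos (th *+ 2 ^ k)), [seq f j | j <- iota 0 M]; split.
- by rewrite ler_norml cos_geN1 cos_le1.
- rewrite map_inj_in_uniq ?iota_uniq// => i j; rewrite !mem_iota !add0n => iM jM.
  move=> /(mulfI _) fE; have {}fE := fE (lt0r_neq0 (mulr_gt0 _ s0)).
  have /addrI ce := fE (ltr0n R 2).
  have xe := cos_inj (xpi _ iM) (xpi _ jM) ce.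
  have sg0 : sg != 0 by rewrite /sg; case: ifP; rewrite ?oppr_eq0 oner_eq0.
  have k0 : (2 ^+ k)^-1 != 0 :> R by rewrite invr_eq0 gt_eqF.
  have p0 : 2 * (pi : R) != 0 by rewrite mulf_neq0// gt_eqF.
  move: xe; rewrite /x => /addrI/(mulfI sg0)/(mulIf k0)/(mulfI p0)/eqP.
  by rewrite eqr_nat => /eqP.
- by rewrite size_map size_iota.
move=> b /mapP[j]; rewrite mem_iota add0n => /= jM ->; split.
  apply: hd; have [/andP[h1 h2] _] := xj _ jM.
  have -> : th - x j = - (sg * (2 * pi * j%:R / 2 ^+ k)) by rewrite /x; ring.
  rewrite normrN normrM (ger0_norm h1) /sg.
  by case: ifP => _; rewrite ?normrN normr1 mul1r.
rewrite /root hornerD hornerN hornerC cheb_cos// subr_eq0; apply/eqP.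
have per (n : nat) (y : R) : cos (y + pi *+ 2 *+ n) = cos y := periodicn (@cosD2pi R) n y.
rewrite /x mulrnDl -mulrnAr.
have -> : (2 * (pi : R) * j%:R / 2 ^+ k) *+ 2 ^ k = (pi : R) *+ 2 *+ j.
  by rewrite -[LHS]mulr_natr natrX divfK ?gt_eqF// -[RHS]mulr_natr -[pi *+ 2]mulr_natl.
rewrite /sg; case: ifP => _; first by rewrite mul1r per.
by rewrite mulN1r -[LHS](per j) subrK.
Qed.

End ChebyshevNodes.

Lemma size_subC (R : nzRingType) (T : {poly R}) b : (1 < size T)%N -> size (T - b%:P) = size T.
Proof.
by move=> T1; rewrite size_polyDl// size_polyN (leq_ltn_trans (size_polyC_leq1 _)).
Qed.

Lemma subC_neq0 (R : nzRingType) (T : {poly R}) b : (1 < size T)%N -> T - b%:P != 0.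
Proof. by move=> T1; rewrite -size_poly_gt0 size_subC// ltnW. Qed.

Lemma lead_subC (R : nzRingType) (T : {poly R}) b : (1 < size T)%N ->
  lead_coef (T - b%:P) = lead_coef T.
Proof.
by move=> T1; rewrite lead_coefDl// size_polyN (leq_ltn_trans (size_polyC_leq1 _)).
Qed.

Section EqualityCase.
Variables (R : realType) (K : set R).
Hypotheses (cK : compact K) (K1 : K `<=` [set x : R | -1 <= x <= 1]).
Variables (mu : probability R R) (V : R).
Hypotheses (muK : prob_on K mu) (mup : equilibrium_potential K mu V).
Local Notation C := (complex R).
Local Notation Int f := (mu.-integrable K (EFin \o f)).

Lemma logmean_near x y : off K x y -> exists eta r : R, [/\ 0 < eta, 0 < r &
  forall z : C, sqmod (Complex x y - z) <= r ^+ 2 ->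
    eta <= V + logmean K mu (complex.Re z) (complex.Im z)].
Proof.
move=> oxy; have := ep_strict mup oxy; set L := logmean K mu x y => L0.
have [a [b [c [d [D [rho [rho0 D0 H]]]]]]] := ep_taylor mup oxy.
pose S := `|a| + `|b| + `|c| + `|d| + D.
have S0 : 0 <= S by rewrite !addr_ge0.
pose eta := (V + L) / 2; have eta0 : 0 < eta by rewrite divr_gt0//; lra.
pose r := Num.min rho (Num.min 1 (eta / (2 * (S + 1)))).
have r0 : 0 < r by rewrite !lt_min rho0 ltr01 divr_gt0// mulr_gt0//; lra.
have [r1 r2 r3] : [/\ r <= rho, r <= 1 & 2 * (S + 1) * r <= eta].
  split; try by rewrite /r !ge_min lexx ?orbT.
  rewrite mulrC -ler_pdivlMr; last by lra.
  by rewrite /r !ge_min lexx !orbT.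
exists eta, r; split => // -[x' y'] /=; rewrite /sqmod/= => zr.
pose u := x' - x; pose v := y' - y.
pose q := Num.sqrt (u ^+ 2 + v ^+ 2).
have q2 : u ^+ 2 + v ^+ 2 = q ^+ 2 by rewrite sqr_sqrtr// addr_ge0// sqr_ge0.
have q0 : 0 <= q := sqrtr_ge0 _.
have qr : q <= r.
  rewrite -(@ler_pXn2r _ 2) ?nnegrE// ?(ltW r0)// -q2.
  by apply: le_trans zr; rewrite le_eqVlt; apply/orP; left; apply/eqP; rewrite /u /v; ring.
have q01 : 0 <= q <= rho by rewrite q0 (le_trans qr).
have := H q u v q01 q2; rewrite mul0r addr0 -/L.
have -> : x + u = x' by rewrite /u; ring.
have -> : y + v = y' by rewrite /v; ring.
have uq : `|u| <= q.
  by rewrite -(@ler_pXn2r _ 2) ?nnegrE// real_normK ?num_real// -q2 lerDl sqr_ge0.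
have vq : `|v| <= q.
  by rewrite -(@ler_pXn2r _ 2) ?nnegrE// real_normK ?num_real// -q2 lerDr sqr_ge0.
have qq : q ^+ 2 <= q by rewrite expr2 ler_piMr//; lra.
have key (k w : R) : `|w| <= q -> - (`|k| * q) <= k * w.
  move=> wq; have : `|k * w| <= `|k| * q by rewrite normrM ler_wpM2l.
  by rewrite ler_norml => /andP[].
have k1 := key a u uq; have k2 := key b v vq.
have k3 := @key c (u ^+ 2 - v ^+ 2).
have k4 := @key d (u * v).
have {}k3 : - (`|c| * q) <= c * (u ^+ 2 - v ^+ 2).
  apply: k3; have := sqr_ge0 u; have := sqr_ge0 v; move: qq; rewrite -q2 ler_norml => *.
  by apply/andP; split; lra.
have {}k4 : - (`|d| * q) <= d * (u * v).
  apply: k4; rewrite normrM; apply: le_trans qq; rewrite expr2 ler_pM//.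
have k5 : D * q ^+ 3 <= D * q.
  by rewrite ler_wpM2l// exprS (le_trans (ler_wpM2l q0 qq))// -expr2.
have k6 : S * q <= eta.
  have : S * q <= S * r by rewrite ler_wpM2l.
  by move=> h; apply: le_trans h _; lra.
have VL : V + L = 2 * eta by rewrite /eta; field.
rewrite /S in k6; lra.
Qed.

Variable T : {poly R}.
Hypotheses (T1 : (1 < size T)%N).
Let c := expR (lncap V T).

Let Tb_size b := size_subC b T1.
Let Tb_neq0 b := subC_neq0 b T1.
Let Tb_lead b := lead_subC b T1.

Lemma lncap_sub b : lncap V (T - b%:P) = lncap V T.
Proof. by rewrite /lncap Tb_size Tb_lead. Qed.

Lemma map_sub b (z : C) : (map_poly (@cR R) (T - b%:P)).[z] = (map_poly (@cR R) T).[z] - cR b.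
Proof.
have -> : map_poly (@cR R) (T - b%:P) = map_poly (@cR R) T - (cR b)%:P.
  by rewrite [LHS](rmorphB (map_poly (real_complex R))) /= map_polyC.
by rewrite hornerD hornerN hornerC.
Qed.

(** Since [|b0 - b|] is [|lead T|] times the product of the distances from [z0] to the roots of
    [T - b], some root is close to [z0] when [b] is close to [b0]; that root alone contributes the
    surplus [eta]. *)
Lemma lnmean_near (z0 : C) b0 : (map_poly (@cR R) T).[z0] = cR b0 ->
  off K (complex.Re z0) (complex.Im z0) -> exists eta e : R, [/\ 0 < eta, 0 < e &
    forall b, `|b - b0| < e -> lncap V T + eta <= lnmean K mu (T - b%:P)].
Proof.
case: z0 => x y Tz /= oxy; have [eta [r [eta0 r0 H]]] := logmean_near oxy.
have l0 : 0 < `|lead_coef T| by rewrite normr_gt0 lead_coef_eq0 -size_poly_gt0 ltnW.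
exists eta, (`|lead_coef T| * r ^+ (size T).-1).
split => //; first by rewrite mulr_gt0// exprn_gt0.
move=> b hb; have [rs [szrs QE rsE]] := real_poly_roots (Tb_neq0 b).
have := sqmod_horner (Complex x y) QE; rewrite map_sub Tz Tb_lead.
have -> : cR b0 - cR b = cR (b0 - b) by rewrite /cR; congr Complex; rewrite /= ?subrr.
rewrite sqmod_cR => e.
have [w wrs wr] : exists2 w, w \in rs & sqmod (Complex x y - w) <= r ^+ 2.
  apply: contrapT => no; move: hb; apply/negP; rewrite -leNgt.
  rewrite -(@ler_pXn2r _ 2) ?nnegrE ?mulr_ge0 ?exprn_ge0 ?(ltW r0)//.
  rewrite (real_normK (num_real (b - b0))).
  have -> : (b - b0) ^+ 2 = (b0 - b) ^+ 2 by ring.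
  rewrite e exprMn real_normK ?num_real//.
  rewrite ler_wpM2l ?sqr_ge0// -exprM mulnC exprM -(Tb_size b) -szrs.
  elim: rs {szrs QE rsE e} no => [|w rs IH] no; first by rewrite big_nil expr0.
  rewrite big_cons /= exprS; apply: ler_pM; [exact: sqr_ge0|exact: exprn_ge0 (sqr_ge0 _)| |].
  - rewrite leNgt; apply/negP => h; apply: no; exists w; rewrite ?mem_head// ltW//.
  - by apply: IH => -[w' w'r h]; apply: no; exists w' => //; rewrite inE w'r orbT.
have wroot : root (map_poly (@cR R) (T - b%:P)) w by rewrite -rsE.
have := lnmean_ge_root cK muK mup (Tb_neq0 b) wroot; rewrite lncap_sub.
by have := H w wr; lra.
Qed.

Hypothesis TK : forall x, K x -> 0 <= T.[x] <= 4 * c.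

(* Near [b0] there are arbitrarily many roots [b] of [cheb c k = kap]; if [T = b0] had a
   solution off [K], each [T - b] would contribute a fixed surplus to the logarithmic mean of
   [cheb c k (T) - kap], which is bounded by [ln 2]. *)
Lemma preimage_sub (z0 : C) b0 : (map_poly (@cR R) T).[z0] = cR b0 -> 0 <= b0 <= 4 * c ->
  exists2 x, K x & z0 = cR x.
Proof.
move=> Tz b04; apply: contrapT => no; have c0 : 0 < c := expR_gt0 _.
have oz : off K (complex.Re z0) (complex.Im z0).
  move=> [iz Kz]; apply: no; exists (complex.Re z0) => //.
  by case: z0 {Tz} iz Kz => a b /= ->.
have [eta [e [eta0 e0 H]]] := lnmean_near Tz oz.
(* Because [ln c = lncap V T], the lower bound below amounts to [M eta - ln 2], against the upper
   bound [ln 2]. *)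
pose M := (Num.trunc (2 * ln 2 / eta)).+1.
have [k [kap [bs [kap1 ubs szbs Hbs]]]] := cheb_nodes M c0 e0 b04.
have [sz [l0 lE]] := cheb_size_lead k c0.
set p := cheb c k - kap%:P in Hbs.
have kapsz : (size (- kap%:P) < size (cheb c k))%N.
  by rewrite size_polyN sz ltnS (leq_trans (size_polyC_leq1 _))// expn_gt0.
have szp : size p = (2 ^ k).+1 by rewrite /p size_polyDl.
have lp : lead_coef p = lead_coef (cheb c k) by rewrite /p lead_coefDl.
have p0 : p != 0 by rewrite -size_poly_gt0 szp.
have /dvdpP[H0 pE] : \prod_(b <- bs) ('X - b%:P) %| p.
  apply: uniq_roots_dvdp; last by rewrite uniq_rootsE.
  by apply/allP => b /Hbs[].
have H00 : H0 != 0 by apply: contraNneq p0 => h; rewrite pE h mul0r.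
have D0 : \prod_(b <- bs) ('X - b%:P) != 0 :> {poly R} by apply: contraNneq p0 => h; rewrite pE h mulr0.
have lH : lead_coef H0 = lead_coef p.
  by rewrite pE lead_coefM (eqP (monic_prod_XsubC bs _ _)) mulr1.
have szH : ((size H0).-1 + M = 2 ^ k)%N.
  have := congr1 (fun q : {poly R} => (size q).-1) pE.
  rewrite szp size_mul// size_prod_XsubC szbs addnS /=.
  by have := size_poly_gt0 H0; rewrite H00; case: (size H0).
have lnD : (M%:R * (lncap V T + eta) <= lnmean K mu (\prod_(b <- bs) ('X - b%:P) \Po T)) /\
    (\prod_(b <- bs) ('X - b%:P) \Po T != 0).
  rewrite -szbs; have {}Hbs b : b \in bs -> `|b - b0| < e by move=> /Hbs[].
  elim: (bs) Hbs => [|b r IH] Hb.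
    rewrite big_nil comp_polyC mul0r oner_eq0; split => //.
    have -> : lnmean K mu 1 = \int[mu]_(t in K) (0 : R).
      by apply: eq_Rintegral => t _; rewrite hornerC normr1 ln1.
    by rewrite (mean_cst cK muK).
  have [|IH1 IH2] := IH; first by move=> b' b'r; apply: Hb; rewrite inE b'r orbT.
  rewrite big_cons comp_polyM comp_polyD comp_polyX -polyCN comp_polyC polyCN.
  rewrite mulf_neq0//; split => //.
  rewrite (lnmeanM cK muK mup)// /= -[X in X * _]natr1 mulrDl mul1r addrC lerD//.
  by apply: H; apply: Hb; rewrite mem_head.
have low : ln `|lead_coef p| + (2 ^ k)%:R * lncap V T + M%:R * eta <= lnmean K mu (p \Po T).
  rewrite pE comp_polyM (lnmeanM cK muK mup)//; [|exact: comp_neq0|exact: lnD.2].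
  have := lnmean_comp_ge cK muK mup H00 T1; rewrite lH pE.
  have := lnD.1; rewrite -szH natrD.
  move=> h1 h2; apply: le_trans (lerD h2 h1).
  by rewrite le_eqVlt; apply/orP; left; apply/eqP; ring.
have up : lnmean K mu (p \Po T) <= ln 2.
  rewrite -(mean_cst cK muK (ln 2)); apply: (lnmean_le cK muK mup).
  - exact: comp_neq0.
  - exact: Int_cst.
  move=> t Kt; have /andP[Tt0 Tt4] := TK Kt.
  rewrite horner_comp /p hornerD hornerN hornerC.
  have b2 : `|(cheb c k).[T.[t]] - kap| <= 2.
    have := cheb_bound k c0 Tt0; rewrite (jouk_eq1 c0 Tt4) expr1n invr1 => h.
    by rewrite (le_trans (ler_normB _ _))//; lra.
  have [->|n0] := eqVneq ((cheb c k).[T.[t]] - kap) 0.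
    by rewrite normr0 ln0// ln_ge0// ler1n.
  by rewrite ler_ln ?posrE ?normr_gt0.
have Mbig : 2 * ln 2 < M%:R * eta by rewrite -ltr_pdivrMr// truncnS_gt.
move: low; rewrite lp lE /c expRK; lra.
Qed.

End EqualityCase.

(** * Capacity and mean of the inverse image of [[0, 1]] *)

Section InverseImage.
Variables (R : realType) (K : set R).
Hypotheses (cK : compact K) (K1 : K `<=` [set x : R | -1 <= x <= 1]).
Variables (mu : probability R R) (V : R).
Hypotheses (muK : prob_on K mu) (mup : equilibrium_potential K mu V).
Variable v : {poly R}.
Hypothesis v1 : (1 < size v)%N.
Local Notation C := (complex R).
Hypothesis Kv : forall z : C, (exists2 x, K x & z = cR x) <->
  (exists2 b : R, 0 <= b <= 1 & (map_poly (@cR R) v).[z] = cR b).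

Lemma inverse_image_itv x : K x -> 0 <= v.[x] <= 1.
Proof.
move=> Kx; have [b b01] : exists2 b : R, 0 <= b <= 1 & (map_poly (@cR R) v).[cR x] = cR b.
  by apply/Kv; exists x.
by rewrite horner_cR => -[->].
Qed.

(** The complex solutions [a] of [4 a (1 - a)] in [[0, 1]] are exactly the points of [[0, 1]], so
    [K] is also the inverse image of [[0, 1]] under [p4 \Po v]: a second expression of the same
    capacity. *)
Let p4 : {poly R} := 4 *: ('X - 'X^2).

Let p4_size : size p4 = 3.
Proof.
rewrite /p4 size_scale ?pnatr_eq0// addrC size_polyDl ?size_polyN ?size_polyXn//.
by rewrite size_polyX.
Qed.

Let p4_lead : lead_coef p4 = - 4.
Proof.
rewrite /p4 lead_coefZ addrC lead_coefDl ?size_polyN ?size_polyXn ?size_polyX//.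
by rewrite lead_coefN lead_coefXn mulrN1.
Qed.

Let p4_neq0 : p4 != 0. Proof. by rewrite -size_poly_gt0 p4_size. Qed.

Lemma lnmean_inverse b : 0 <= b <= 1 -> lnmean K mu (v - b%:P) = lncap V v.
Proof.
move=> b01; rewrite -(lncap_sub V v1 b); apply: (lnmean_onK cK muK mup).
  exact: subC_neq0.
move=> z; rewrite /root map_sub subr_eq0 => /eqP vz.
by apply/Kv; exists b.
Qed.

Let p4_comp_size : (1 < size (p4 \Po v))%N.
Proof.
have := size_comp_poly p4 v; rewrite p4_size /=.
by move: v1; case: (size v) => [|[|m]]//= _; case: (size _) => [|[|]].
Qed.

Lemma lnmean_inverse4 b : 0 <= b <= 1 ->
  lnmean K mu ((p4 \Po v) - b%:P) = ln 4 + 2 * lncap V v.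
Proof.
move=> b01; have w1 := p4_comp_size.
have -> : ln 4 + 2 * lncap V v = lncap V ((p4 \Po v) - b%:P).
  by rewrite lncap_sub// lncap_comp// p4_lead p4_size normrN ger0_norm.
apply: (lnmean_onK cK muK mup).
  exact: subC_neq0.
move=> z; rewrite /root map_sub subr_eq0 => /eqP wz; apply/Kv.
move: wz; have -> : (map_poly (@cR R) (p4 \Po v)).[z] =
    cR 4 * ((map_poly (@cR R) v).[z] - (map_poly (@cR R) v).[z] ^+ 2).
  rewrite [map_poly _ _](map_comp_poly (real_complex R)) horner_comp.
  rewrite /p4 linearZ /= rmorphB /= map_polyX map_polyXn.
  by rewrite hornerZ hornerD hornerN hornerXn hornerX.
case: ((map_poly (@cR R) v).[z]) => a y; rewrite expr2 => -[re im].
have b4 : 4 * (a - (a * a - y * y)) = b by lra.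
have i4 : 4 * (y - (a * y + y * a)) = 0 by lra.
(* The imaginary part vanishes only for [y = 0] or [a = 1 / 2]; in the second case the real part is
   [1 + 4 y^2 = b <= 1]. *)
have : y * (1 - 2 * a) = 0 by lra.
move=> /eqP; rewrite mulf_eq0 => /orP[/eqP y0|/eqP a2].
  exists a; last by rewrite y0.
  by rewrite y0 in b4; apply/andP; split; nra.
have y0 : y = 0.
  have aE : a = 1 / 2 by lra.
  by rewrite aE in b4; nra.
exists a; last by rewrite y0.
by apply/andP; split; lra.
Qed.

(** Write [L = lncap V v]. Both values lie in [[0, 1]], so the kernel is nonnegative on [K] and
    Tonelli applies; one order yields [- L], the other [- (ln 4 + 2 L)]. *)
Lemma inverse_image_lncap : lncap V v = - ln 4.
Proof.
pose F (z : R * R) : \bar R := maxe 0%E (- ln `|(p4 \Po v).[z.1] - v.[z.2]|)%:E.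
have F0 z : (0 <= F z)%E by rewrite /F le_max lexx.
have mF : measurable_fun setT F.
  apply: measurable_maxe => //; apply/measurable_EFinP; apply: measurableT_comp => //.
  apply: measurableT_comp; first exact: measurable_ln.
  apply: measurableT_comp => //; apply: measurable_funB.
    exact: (measurableT_comp (measurable_horner _) measurable_fst).
  exact: (measurableT_comp (measurable_horner _) measurable_snd).
have w01 x : K x -> 0 <= (p4 \Po v).[x] <= 1.
  move=> /inverse_image_itv/andP[a0 a1]; rewrite horner_comp /p4 !hornerE/=.
  move: v.[x] a0 a1 => a a0 a1; have a2 : 0 <= a * (1 - a) by rewrite mulr_ge0// subr_ge0.
  by have := sqr_ge0 (2 * a - 1); rewrite sqrrB expr1n exprMn => h; apply/andP; split; lra.
have FE x y : K x -> K y -> F (x, y) = (- ln `|(p4 \Po v).[x] - v.[y]|)%:E.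
  move=> /w01/andP[a0 a1] /inverse_image_itv/andP[b0 b1].
  rewrite /F/= max_r// lee_fin oppr_ge0 ln_le0// ler_norml; apply/andP; split; lra.
have mF1 x : measurable_fun setT (fun y => F (x, y)).
  exact: (measurableT_comp mF (measurable_pair1 x)).
have mF2 y : measurable_fun setT (fun x => F (x, y)).
  exact: (measurableT_comp mF (measurable_pair2 y)).
have cstE (f : R -> \bar R) (a : R) : measurable_fun setT f -> (forall x, K x -> f x = a%:E) ->
    (\int[mu]_x f x = a%:E)%E.
  move=> mf fa; rewrite (integral_onK cK muK mf).
  have -> : (\int[mu]_(x in K) f x = \int[mu]_(x in K) a%:E)%E.
    by apply: eq_integral => x /set_mem; exact: fa.
  have -> : (\int[mu]_(x in K) a%:E = a%:E * mu K)%E := integral_cst mu (mK cK) _.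
  by rewrite (prob_onK cK muK) mule1.
have inner (Q : {poly R}) (g : R -> \bar R) : Q != 0 -> measurable_fun setT g ->
    (forall y, K y -> g y = (- ln `|Q.[y]|)%:E) -> (\int[mu]_y g y = (- lnmean K mu Q)%:E)%E.
  move=> Q0 mg gE; rewrite (integral_onK cK muK mg).
  have IQ := Int_lnpoly cK muK mup Q0.
  have -> : - lnmean K mu Q = \int[mu]_(t in K) (ln `|Q.[t]| * -1).
    by rewrite (meanZ cK _ IQ) mulrN1.
  have f := integrable_fin_num (mK cK) (IntZ cK (-1) IQ).
  rewrite /Rintegral fineK//; apply: eq_integral => y /set_mem Ky.
  by rewrite gE// mulrN1.
have vb b : v - b%:P != 0.
  exact: subC_neq0.
have wb b : (p4 \Po v) - b%:P != 0.
  exact: subC_neq0.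
have H1 x : K x -> (\int[mu]_y F (x, y) = (- lncap V v)%:E)%E.
  move=> Kx; rewrite (inner (v - ((p4 \Po v).[x])%:P))//; last first.
    by move=> y Ky; rewrite FE// hornerD hornerN hornerC distrC.
  by rewrite lnmean_inverse// w01.
have H2 y : K y -> (\int[mu]_x F (x, y) = (- (ln 4 + 2 * lncap V v))%:E)%E.
  move=> Ky; rewrite (inner ((p4 \Po v) - (v.[y])%:P))//; last first.
    by move=> x Kx; rewrite FE// hornerD hornerN hornerC.
  by rewrite lnmean_inverse4// inverse_image_itv.
have := @fubini_tonelli _ _ _ _ R mu mu F mF F0.
rewrite (cstE _ _ (measurable_fun_fubini_tonelli_F F mF F0) H1).
rewrite (cstE _ _ (measurable_fun_fubini_tonelli_G F mF F0) H2).
by move=> -[]; lra.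
Qed.

Lemma inverse_image_mean : \int[mu]_(t in K) v.[t] = 1 / 2.
Proof.
have lc := inverse_image_lncap.
have e4 : expR (lncap V v) = 1 / 4 by rewrite lc expRN lnK ?posrE// div1r.
have Iv := Int_poly cK K1 muK v.
have h1 : 2 * expR (lncap V v) <= \int[mu]_(t in K) v.[t].
  by apply: mean_ge => // x /inverse_image_itv/andP[].
have vN : 1 - v = - (v - 1%:P) by rewrite opprB.
have v1' : (1 < size (1 - v)%R)%N by rewrite vN size_polyN size_subC.
have lc' : lncap V (1 - v) = lncap V v.
  by rewrite /lncap vN lead_coefN normrN size_polyN lead_subC// size_subC.
have h2 : 2 * expR (lncap V (1 - v)) <= \int[mu]_(t in K) (1 - v).[t].
  apply: mean_ge => // x /inverse_image_itv/andP[_ h].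
  by rewrite hornerD hornerN hornerC subr_ge0.
have E1 : \int[mu]_(t in K) (1 - v).[t] = 1 - \int[mu]_(t in K) v.[t].
  rewrite -[X in _ = X - _](mean_cst cK muK) -[X in _ - X]mulr1 -mulrN -(meanZ cK _ Iv).
  rewrite -(meanD cK (Int_cst cK muK 1) (IntZ cK _ Iv)); apply: eq_Rintegral => t _.
  by rewrite hornerD hornerN hornerC mulrN1.
move: h2; rewrite E1 lc' e4; rewrite e4 in h1; lra.
Qed.

End InverseImage.

(** * Extremal polynomials *)

Section ComplexCoefficients.
Variable R : realType.
Local Notation C := (complex R).
Implicit Types (P Q : {poly C}) (A : {poly R}).

Definition repoly P : {poly R} := \poly_(i < size P) complex.Re P`_i.
Definition impoly P : {poly R} := \poly_(i < size P) complex.Im P`_i.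

Lemma coef_repoly P i : (repoly P)`_i = complex.Re P`_i.
Proof. by rewrite coef_poly; case: ltnP => // h; rewrite nth_default. Qed.

Lemma coef_impoly P i : (impoly P)`_i = complex.Im P`_i.
Proof. by rewrite coef_poly; case: ltnP => // h; rewrite nth_default. Qed.

Lemma horner_reim P (x : R) : P.[cR x] = Complex (repoly P).[x] (impoly P).[x].
Proof.
rewrite horner_coef !horner_poly.
elim/big_rec3: _ => [//|i a b c _ ->].
have -> : cR x ^+ i = cR (x ^+ i) by rewrite [RHS](rmorphXn (real_complex R)).
case: (P`_i) => u v; rewrite /cR /=; congr Complex; rewrite /=; ring.
Qed.

Lemma poly_reim_inj P Q : repoly P = repoly Q -> impoly P = impoly Q -> P = Q.
Proof.
move=> er ei; apply/polyP => i.
have := congr1 (fun p : {poly R} => p`_i) er; have := congr1 (fun p : {poly R} => p`_i) ei.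
rewrite /= !coef_repoly !coef_impoly.
by case: (P`_i) => a b; case: (Q`_i) => c d /= -> ->.
Qed.

Lemma repoly_map A : repoly (map_poly (@cR R) A) = A.
Proof. by apply/polyP => i; rewrite coef_repoly (coef_map (real_complex R)). Qed.

Lemma impoly_map A : impoly (map_poly (@cR R) A) = 0.
Proof. by apply/polyP => i; rewrite coef_impoly (coef_map (real_complex R)) coef0. Qed.

Lemma monic_repoly n P : monic_deg n P -> repoly P \is monic /\ size (repoly P) = n.+1.
Proof.
move=> [Pm Ps]; have c1 : (repoly P)`_n = 1.
  by rewrite coef_repoly; move: Pm; rewrite monicE lead_coefE Ps => /eqP ->.
have sz : size (repoly P) = n.+1.
  apply/eqP; rewrite eqn_leq -{1}Ps size_poly/= ltnNge; apply/negP => /leq_sizeP/(_ n (leqnn n)).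
  by rewrite c1 => /eqP; rewrite oner_eq0.
by rewrite monicE lead_coefE sz c1.
Qed.

Lemma size_impoly n P : monic_deg n P -> (size (impoly P) <= n)%N.
Proof.
move=> [Pm Ps]; apply/leq_sizeP => j; rewrite leq_eqVlt => /predU1P[<-|nj].
  by rewrite coef_impoly; move: Pm; rewrite monicE lead_coefE Ps => /eqP ->.
by rewrite coef_impoly nth_default ?Ps.
Qed.

Lemma monic_map n A : A \is monic -> size A = n.+1 -> monic_deg n (map_poly (@cR R) A).
Proof.
move=> Am As; split; first exact: (monic_map (real_complex R)).
by rewrite (size_map_poly (real_complex R)).
Qed.

Lemma cmod_sqr (z : C) : cmod z ^+ 2 = sqmod z.
Proof. by rewrite sqr_sqrtr// addr_ge0// sqr_ge0. Qed.

End ComplexCoefficients.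

Section Extremal.
Variables (R : realType) (K : set R).
Hypotheses (cK : compact K) (K1 : K `<=` [set x : R | -1 <= x <= 1]).
Variables (mu : probability R R) (V : R).
Hypotheses (muK : prob_on K mu) (mup : equilibrium_potential K mu V).
Variables (q : {poly R}) (n : nat).
Hypotheses (q1 : (1 < size q)%N) (ql : `|lead_coef q| = 1).
Hypothesis qK : forall x, K x -> 0 <= q.[x].
Local Notation C := (complex R).
Local Notation Int f := (mu.-integrable K (EFin \o f)).
Local Notation "''E' T" := (\int[mu]_(t in K) T.[t]) (at level 10, T at level 8).
Implicit Types (A B T : {poly R}) (P S : {poly C}).

Let IntP T := Int_poly cK K1 muK T.

Lemma meanPD A B : 'E (A + B) = 'E A + 'E B.
Proof.
by rewrite -(meanD cK (IntP A) (IntP B)); apply: eq_Rintegral => t _; rewrite hornerD.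
Qed.

Lemma meanPZ k A : 'E (k *: A) = k * 'E A.
Proof.
by rewrite mulrC -(meanZ cK k (IntP A)); apply: eq_Rintegral => t _; rewrite hornerZ mulrC.
Qed.

Lemma meanPB A B : 'E (A - B) = 'E A - 'E B.
Proof. by rewrite -scaleN1r meanPD meanPZ mulN1r. Qed.

Lemma meanPC k : 'E (k%:P) = k.
Proof.
by rewrite -[RHS](mean_cst cK muK); apply: eq_Rintegral => t _; rewrite hornerC.
Qed.

Lemma meanP_ge0 T : (forall x, K x -> 0 <= T.[x]) -> 0 <= 'E T.
Proof. by move=> h; apply: Rintegral_ge0. Qed.

Lemma zero_on_K T : (forall x, K x -> T.[x] = 0) -> T = 0.
Proof.
move=> h; apply/eqP; apply/negPn/negP => T0.
have [x Kx] := probK_gt0 cK muK (ae_nonroot mup T0).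
by rewrite h// eqxx.
Qed.

(** The restriction of [q |P|^2] to the real line for [P = A + i B]. *)
Definition nrm2 A B : {poly R} := q * (A ^+ 2 + B ^+ 2).

Lemma nrm2E A B x : (nrm2 A B).[x] = q.[x] * (A.[x] ^+ 2 + B.[x] ^+ 2).
Proof. by rewrite /nrm2 !hornerE !expr2. Qed.

Lemma nrm2_ge0 A B x : K x -> 0 <= (nrm2 A B).[x].
Proof. by move=> Kx; rewrite nrm2E mulr_ge0 ?qK// addr_ge0// sqr_ge0. Qed.

Lemma q_neq0 : q != 0. Proof. by rewrite -size_poly_gt0 ltnW. Qed.

Lemma mean_nrm2_eq0 A B : 'E (nrm2 A B) = 0 -> A = 0 /\ B = 0.
Proof.
move=> /(mean_eq0_poly cK K1 muK mup (fun x => @nrm2_ge0 A B x)) N0.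
have AB x : K x -> q.[x] != 0 -> A.[x] = 0 /\ B.[x] = 0.
  move=> Kx qx; have := congr1 (fun T => T.[x]) N0; rewrite /= nrm2E horner0 => /eqP.
  rewrite mulf_eq0 (negbTE qx)/= paddr_eq0 ?sqr_ge0// !sqrf_eq0.
  by move=> /andP[/eqP-> /eqP->].
have [A0 B0] : q * A = 0 /\ q * B = 0.
  split; apply: zero_on_K => x Kx; rewrite hornerM; have [->|qx] := eqVneq q.[x] 0;
    rewrite ?mul0r//; have [a0 b0] := AB x Kx qx; by rewrite ?a0 ?b0 mulr0.
by split; apply/eqP; [move/eqP: A0|move/eqP: B0]; rewrite mulf_eq0 (negbTE q_neq0).
Qed.

(** Logarithm of [Cap(K)^(2 n + deg q)], so that [cc] is [S(mu) Cap(K)^(2 n)]. *)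
Definition lncc : R := - ((2 * n + (size q).-1)%:R * V).
Definition cc : R := expR lncc.

Lemma cc_gt0 : 0 < cc. Proof. exact: expR_gt0. Qed.

Lemma nrm2_size A B : A \is monic -> size A = n.+1 -> (size B <= n)%N ->
  [/\ (1 < size (nrm2 A B))%N, `|lead_coef (nrm2 A B)| = 1 & lncap V (nrm2 A B) = lncc].
Proof.
move=> Am As Bs; have A2 : size (A ^+ 2) = (2 * n).+1.
  by rewrite expr2 size_mul -?size_poly_gt0 ?As// addSn addnS mul2n -addnn.
have B2 : (size (B ^+ 2)%R < size (A ^+ 2)%R)%N.
  rewrite A2 ltnS expr2 (leq_trans (size_polyMleq _ _))//.
  by rewrite (leq_trans (leq_pred _))// mul2n -addnn leq_add.
have sAB : size (A ^+ 2 + B ^+ 2) = (2 * n).+1 by rewrite size_polyDl.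
have lAB : lead_coef (A ^+ 2 + B ^+ 2) = 1.
  by rewrite lead_coefDl//; apply/eqP; rewrite -monicE monic_exp.
have sz : size (nrm2 A B) = (2 * n + (size q).-1).+1.
  rewrite /nrm2 size_mul ?q_neq0 -?size_poly_gt0 ?sAB//.
  by move: q1; case: (size q) => // m _; rewrite addSn addnS /= addnC.
have lT : `|lead_coef (nrm2 A B)| = 1 by rewrite /nrm2 lead_coefM lAB mulr1.
split => //; last by rewrite /lncap lT ln1 sz/= sub0r.
rewrite sz ltnS addn_gt0; move: q1.
by case: (size q) => [|[|m]]//= _; rewrite orbT.
Qed.

Lemma mean_nrm2_ge A B : A \is monic -> size A = n.+1 -> (size B <= n)%N ->
  2 * cc <= 'E (nrm2 A B).
Proof.
move=> Am As Bs; have [T1 _ Tc] := nrm2_size Am As Bs.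
by rewrite /cc -Tc; apply: mean_ge => // x; exact: nrm2_ge0.
Qed.

Lemma mean_nrm2_bound A B (M : R) : A \is monic -> size A = n.+1 -> (size B <= n)%N ->
  (forall x, K x -> (nrm2 A B).[x] <= M) -> 2 * cc <= M - 'E (nrm2 A B).
Proof.
move=> Am As Bs TM; have [T1 _ Tc] := nrm2_size Am As Bs; set T := nrm2 A B in TM T1 Tc *.
have TN : M%:P - T = - (T - M%:P) by rewrite opprB.
have T1' : (1 < size (M%:P - T)%R)%N by rewrite TN size_polyN size_subC.
have Tc' : lncap V (M%:P - T) = lncc.
  by rewrite -Tc /lncap TN lead_coefN normrN size_polyN lead_subC// size_subC.
have := mean_ge cK K1 muK mup T1'; rewrite Tc' -/cc meanPB meanPC; apply.
by move=> x Kx; rewrite hornerD hornerN hornerC subr_ge0 TM.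
Qed.

(* Parallelogram identity. *)
Lemma mean_nrm2_uniq A B A' B' : A \is monic -> size A = n.+1 -> (size B <= n)%N ->
  A' \is monic -> size A' = n.+1 -> (size B' <= n)%N ->
  'E (nrm2 A B) <= 2 * cc -> 'E (nrm2 A' B') <= 2 * cc -> A' = A /\ B' = B.
Proof.
move=> Am As Bs Am' As' Bs' H H'.
pose F := 2^-1 *: (A + A'); pose G := 2^-1 *: (B + B').
have Fs' : (size F <= n.+1)%N.
  by rewrite (leq_trans (size_scale_leq _ _))// (leq_trans (size_polyD _ _))// As As' maxnn.
have Fn : F`_n = 1.
  rewrite coefZ coefD; move: Am Am'; rewrite !monicE !lead_coefE As As' => /eqP-> /eqP->.
  by rewrite -(natrD _ 1 1) mulVf ?pnatr_eq0.
have Fs : size F = n.+1.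
  apply/eqP; rewrite eqn_leq Fs' ltnNge; apply/negP => /leq_sizeP/(_ n (leqnn n)).
  by rewrite Fn => /eqP; rewrite oner_eq0.
have Fm : F \is monic by rewrite monicE lead_coefE Fs Fn.
have Gs : (size G <= n)%N.
  by rewrite (leq_trans (size_scale_leq _ _))// (leq_trans (size_polyD _ _))// geq_max Bs.
have h := mean_nrm2_ge Fm Fs Gs.
have e : 4^-1 *: nrm2 (A' - A) (B' - B) = 2^-1 *: (nrm2 A B + nrm2 A' B') - nrm2 F G.
  have s2 : 2^-1 ^+ 2 = 4^-1 :> R by field.
  have h2 : 2^-1 = 2 * 4^-1 :> R by field.
  rewrite /nrm2 /F /G !exprZn s2 -scalerDr -scalerAr h2 -scalerA.
  rewrite scalerA [2 * _]mulrC -scalerA -scalerBr scaler_nat; congr (_ *: _).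
  by rewrite mulr2n; ring.
have D0 : 'E (nrm2 (A' - A) (B' - B)) = 0.
  have D1 : 4^-1 * 'E (nrm2 (A' - A) (B' - B)) <= 0.
    by rewrite -meanPZ e meanPB meanPZ meanPD; lra.
  have D2 : 0 <= 'E (nrm2 (A' - A) (B' - B)) by apply: meanP_ge0 => x; exact: nrm2_ge0.
  lra.
by have [/eqP + /eqP] := mean_nrm2_eq0 D0; rewrite !subr_eq0 => /eqP-> /eqP->.
Qed.

(** Gram-Schmidt for the scalar product with weight [q]: [X^d] minus its own projection is the next
    orthogonal direction, and its norm is not zero by [mean_nrm2_eq0]. *)
Lemma projection d T : exists2 G : {poly R}, (size G <= d)%N &
  forall Q : {poly R}, (size Q <= d)%N -> 'E (q * ((T - G) * Q)) = 0.
Proof.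
elim: d T => [|d IH] T.
  exists 0; first by rewrite size_poly0.
  by move=> Q; rewrite leqn0 size_poly_eq0 => /eqP->; rewrite !mulr0 meanPC.
have [G0 G0s G0o] := IH T; have [G1 G1s G1o] := IH 'X^d.
pose e : {poly R} := 'X^d - G1.
have es : size e = d.+1 by rewrite /e size_polyDl ?size_polyXn// size_polyN ltnS.
have ed : e`_d = 1 by rewrite /e coefB coefXn eqxx nth_default ?subr0.
have e0 : e != 0 by rewrite -size_poly_gt0 es.
have N0 : 'E (q * (e * e)) != 0.
  have -> : q * (e * e) = nrm2 e 0 by rewrite /nrm2 expr0n addr0 expr2.
  by apply/eqP => /mean_nrm2_eq0[] /eqP; rewrite (negbTE e0).
pose r := 'E (q * (T * e)) / 'E (q * (e * e)).
exists (G0 + r *: e).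
  rewrite (leq_trans (size_polyD _ _))// geq_max (leq_trans G0s)//.
  by rewrite (leq_trans (size_scale_leq _ _))// es.
move=> Q Qs; pose Q' := Q - Q`_d *: e.
have Qs' : (size Q' <= d)%N.
  apply/leq_sizeP => j; rewrite leq_eqVlt => /predU1P[<-|dj].
    by rewrite coefB coefZ ed mulr1 subrr.
  by rewrite coefB coefZ (nth_default 0 (leq_trans Qs dj)) (@nth_default _ 0 e) ?es// mulr0 subr0.
have -> : q * ((T - (G0 + r *: e)) * Q) = q * ((T - G0) * Q') - r *: (q * (e * Q')) +
    Q`_d *: (q * (T * e) - q * (e * G0) - r *: (q * (e * e))).
  have -> : Q = Q' + Q`_d *: e by rewrite /Q' subrK.
  have -> : (Q' + Q`_d *: e)`_d = Q`_d by rewrite /Q' subrK.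
  by rewrite -!mul_polyC; ring.
have eG : 'E (q * (e * G0)) = 0 by exact: G1o.
rewrite meanPD meanPB !meanPZ !meanPB meanPZ G0o// G1o// eG /r.
by field.
Qed.

(** Pythagoras: [A] is [X^n] minus its projection on lower degrees, and both the change of the real
    part and the imaginary part only add a nonnegative mean. *)
Lemma minimizer : exists A, [/\ A \is monic, size A = n.+1 &
  forall A' B', A' \is monic -> size A' = n.+1 -> 'E (nrm2 A 0) <= 'E (nrm2 A' B')].
Proof.
have [G Gs Go] := projection n 'X^n; pose A : {poly R} := 'X^n - G.
have As : size A = n.+1 by rewrite /A size_polyDl ?size_polyXn// size_polyN ltnS.
have An : A`_n = 1 by rewrite /A coefB coefXn eqxx nth_default ?subr0.
have Am : A \is monic by rewrite monicE lead_coefE As An.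
exists A; split => // A' B' Am' As'.
have Ds : (size (A' - A)%R <= n)%N.
  apply/leq_sizeP => j; rewrite leq_eqVlt => /predU1P[<-|nj].
    by rewrite coefB An; move: Am'; rewrite monicE lead_coefE As' => /eqP->; rewrite subrr.
  by rewrite coefB !nth_default ?subr0 ?As ?As'.
have -> : nrm2 A' B' = nrm2 A 0 + 2 *: (q * (A * (A' - A))) + nrm2 (A' - A) B'.
  by rewrite /nrm2 scaler_nat mulr2n; ring.
rewrite !meanPD meanPZ Go// mulr0 addr0 lerDl.
by apply: meanP_ge0 => x; exact: nrm2_ge0.
Qed.

Lemma L2sq_mean P : L2sq mu (fun x => q.[x]) P = ('E (nrm2 (repoly P) (impoly P)))%:E.
Proof.
rewrite /L2sq; have e x : q.[x] * cmod P.[cR x] ^+ 2 = (nrm2 (repoly P) (impoly P)).[x].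
  by rewrite cmod_sqr horner_reim /sqmod/= nrm2E.
under eq_integral => x _ do rewrite e.
rewrite (integral_onK cK muK); last by apply/measurable_EFinP; exact: measurable_horner.
by rewrite /Rintegral fineK//; exact: (integrable_fin_num (mK cK) (IntP _)).
Qed.

Lemma L2sq_ge P : monic_deg n P -> ((2 * cc)%:E <= L2sq mu (fun x => q.[x]) P)%E.
Proof.
move=> Pm; have [Am As] := monic_repoly Pm.
by rewrite L2sq_mean lee_fin mean_nrm2_ge// size_impoly.
Qed.

Lemma L2_inf_ge : ((2 * cc)%:E <= ereal_inf [set L2sq mu (fun x => q.[x]) P | P in monic_deg n])%E.
Proof. by apply: le_ereal_inf_tmp => _ [P Pm <-]; exact: L2sq_ge. Qed.

(** If [M] is the norm, [T <= M^2] on [K]; the mean of [T] and that of [M^2 - T] are both at least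
    [2 cc], so [M^2 >= 4 cc]. *)
Lemma wsupnorm_ge P : monic_deg n P ->
  ((2 * Num.sqrt cc)%:E <= wsupnorm K (fun x => Num.sqrt q.[x]) P)%E.
Proof.
move=> Pm; have [Am As] := monic_repoly Pm; have Bs := size_impoly Pm.
rewrite leNgt; apply/negP => hlt.
have ub x : K x -> ((Num.sqrt q.[x] * cmod P.[cR x])%:E <= wsupnorm K (fun x => Num.sqrt q.[x]) P)%E.
  by move=> Kx; apply: ereal_sup_ubound; exists x.
have [x0 Kx0 _] := probK_gt0 cK muK (aeW mu (fun _ : R => Logic.I)).
move: hlt ub; case: (wsupnorm _ _ _) => [M| |]//; last first.
  by move=> _ /(_ _ Kx0).
rewrite lte_fin => hM ub.
have M0 : 0 <= M.
  have := ub _ Kx0; rewrite lee_fin; apply: le_trans.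
  by rewrite mulr_ge0 ?sqrtr_ge0.
have TM x : K x -> (nrm2 (repoly P) (impoly P)).[x] <= M ^+ 2.
  move=> Kx; have := ub _ Kx; rewrite lee_fin => h.
  rewrite nrm2E -[q.[x]]sqr_sqrtr ?qK//.
  have -> : (repoly P).[x] ^+ 2 + (impoly P).[x] ^+ 2 = cmod P.[cR x] ^+ 2.
    by rewrite cmod_sqr horner_reim.
  by rewrite -exprMn ler_pXn2r ?nnegrE// mulr_ge0 ?sqrtr_ge0.
have := mean_nrm2_bound Am As Bs TM; have := mean_nrm2_ge Am As Bs.
have : M ^+ 2 < (2 * Num.sqrt cc) ^+ 2.
  by rewrite ltr_pXn2r ?nnegrE ?mulr_ge0 ?sqrtr_ge0.
by rewrite exprMn sqr_sqrtr ?(ltW cc_gt0)//; lra.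
Qed.

Section WithInverseImage.
Variable S : {poly C}.
Hypotheses (Ss : size S = n.+1) (KS : is_inverse_image K q S).

(** On [K] the value [q S^2] is real, so [q Re(S) Im(S)] vanishes there and one of the two parts is
    the zero polynomial. If it were the real part, [q S^2 = - q Im(S)^2] would be both nonpositive
    and nonnegative on [K], and [S] would be 0. *)
Lemma inverse_image_real : S = map_poly (@cR R) (repoly S).
Proof.
have val x : K x -> complex.Im ((map_poly (@cR R) q).[cR x] * S.[cR x] ^+ 2) = 0 /\
    0 <= complex.Re ((map_poly (@cR R) q).[cR x] * S.[cR x] ^+ 2) <= 1.
  by move=> Kx; apply/(KS (cR x)); exists x.
have {}val x : K x -> q.[x] * ((repoly S).[x] * (impoly S).[x]) = 0 /\
    0 <= q.[x] * ((repoly S).[x] ^+ 2 - (impoly S).[x] ^+ 2).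
  move=> /val; rewrite horner_cR horner_reim !expr2 /=.
  move: q.[x] ((repoly S).[x]) ((impoly S).[x]) => a b c [h1 /andP[h2 _]].
  by split; [lra|apply: le_trans h2 _; rewrite le_eqVlt; apply/orP; left; apply/eqP; ring].
have /eqP : q * (repoly S * impoly S) = 0.
  by apply: zero_on_K => x /val[h _]; rewrite !hornerM.
rewrite !mulf_eq0 (negbTE q_neq0)/= => /orP[/eqP A0|/eqP B0]; last first.
  by apply: poly_reim_inj; rewrite ?repoly_map ?impoly_map.
have N0 : nrm2 (repoly S) (impoly S) = 0.
  apply: zero_on_K => x Kx; have [_] := val x Kx; have := nrm2_ge0 (repoly S) (impoly S) Kx.
  by rewrite nrm2E A0 horner0 expr0n/= add0r sub0r mulrN; lra.
have [_ B0] : repoly S = 0 /\ impoly S = 0 by apply: mean_nrm2_eq0; rewrite N0 meanPC.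
have S0 : S = 0 by apply: poly_reim_inj; rewrite ?A0 ?B0; apply/polyP => i;
  rewrite ?coef_repoly ?coef_impoly !coef0.
by move: Ss; rewrite S0 size_poly0.
Qed.

Let A := repoly S.
Let a := lead_coef A.

Lemma inverse_image_size : size A = n.+1.
Proof.
have := congr1 (fun p : {poly C} => size p) inverse_image_real.
by rewrite /= (size_map_poly (real_complex R)) Ss.
Qed.

Lemma inverse_image_lead : a != 0.
Proof. by rewrite lead_coef_eq0 -size_poly_gt0 inverse_image_size. Qed.

Let Pr : {poly R} := a^-1 *: A.

Lemma inverse_image_monic : Pr \is monic /\ size Pr = n.+1.
Proof.
rewrite size_scale ?invr_eq0 ?inverse_image_lead// inverse_image_size; split => //.
by rewrite monicE lead_coefZ mulVf// inverse_image_lead.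
Qed.

Lemma inverse_image_scale : (lead_coef S)^-1 *: S = map_poly (@cR R) Pr.
Proof.
rewrite {2}inverse_image_real {1}inverse_image_real.
rewrite [lead_coef _](lead_coef_map (real_complex R)) -/A -/a.
rewrite [RHS](map_polyZ (real_complex R)); congr (_ *: _).
by rewrite [RHS](fmorphV (real_complex R)).
Qed.

Lemma nrm2_inverse_image : nrm2 A 0 = a ^+ 2 *: nrm2 Pr 0.
Proof.
rewrite /nrm2 /Pr expr0n !addr0 exprZn -scalerAr scalerA -exprMn.
by rewrite mulfV ?inverse_image_lead// expr1n scale1r.
Qed.

Lemma inverse_image_cc : a ^+ 2 * cc = 1 / 4 /\ 'E (nrm2 A 0) = 1 / 2 /\
  forall x, K x -> (nrm2 A 0).[x] <= 1.
Proof.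
have [Pm Ps] := inverse_image_monic; have zs : (size (0%R : {poly R}) <= n)%N by rewrite size_poly0.
have [T1 Tl Tc] := nrm2_size Pm Ps zs.
have a0 := inverse_image_lead; have a2 : a ^+ 2 != 0 by rewrite expf_neq0.
have v1 : (1 < size (nrm2 A 0))%N by rewrite nrm2_inverse_image size_scale.
have Kv (z : C) : (exists2 x, K x & z = cR x) <->
  (exists2 b : R, 0 <= b <= 1 & (map_poly (@cR R) (nrm2 A 0)).[z] = cR b).
  have -> : (map_poly (@cR R) (nrm2 A 0)).[z] = (map_poly (@cR R) q).[z] * S.[z] ^+ 2.
    rewrite /nrm2 expr0n addr0 [map_poly _ _](rmorphM (map_poly (real_complex R))).
    rewrite (rmorphXn (map_poly (real_complex R))) hornerM horner_exp.
    by rewrite [in RHS]inverse_image_real.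
  split=> [/KS|[b b01 e]].
    case: (_ * _) => u w /= [-> u01]; by exists u.
  by apply/KS; rewrite /= e.
have lc := inverse_image_lncap cK muK mup v1 Kv.
split.
  have lE : lncap V (nrm2 A 0) = ln (a ^+ 2) + lncc.
    rewrite -Tc nrm2_inverse_image /lncap lead_coefZ size_scale// normrM Tl mulr1 ln1.
    by rewrite (ger0_norm (sqr_ge0 a)); ring.
  have a20 : 0 < a ^+ 2 by rewrite lt_neqAle eq_sym a2 sqr_ge0.
  rewrite -[a ^+ 2]lnK ?posrE// /cc -expRD -lE lc expRN lnK ?posrE// div1r//.
split; first exact: (inverse_image_mean cK K1 muK mup v1 Kv).
by move=> x Kx; have /andP[] := inverse_image_itv Kv Kx.
Qed.

Lemma inverse_image_mean_min : 'E (nrm2 Pr 0) = 2 * cc.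
Proof.
have [ac [Ev _]] := inverse_image_cc; move: Ev; rewrite nrm2_inverse_image meanPZ => Ev.
have a2 : a ^+ 2 != 0 by rewrite expf_neq0// inverse_image_lead.
by apply: (mulfI a2); rewrite Ev mulrCA ac; field.
Qed.

Lemma L2_extremal_inverse :
  L2_extremal mu (fun x => q.[x]) n (map_poly (@cR R) Pr) /\
  (forall P, monic_deg n P -> (L2sq mu (fun x => q.[x]) P <= (2 * cc)%:E)%E ->
     P = map_poly (@cR R) Pr) /\
  L2sq mu (fun x => q.[x]) (map_poly (@cR R) Pr) = (2 * cc)%:E.
Proof.
have [Pm Ps] := inverse_image_monic; have zs : (size (0%R : {poly R}) <= n)%N by rewrite size_poly0.
have Em := inverse_image_mean_min.
have LE : L2sq mu (fun x => q.[x]) (map_poly (@cR R) Pr) = (2 * cc)%:E.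
  by rewrite L2sq_mean repoly_map impoly_map Em.
split; [split|split => //].
- exact: monic_map.
- by move=> Q Qm; rewrite LE; exact: L2sq_ge.
move=> P Pmon; rewrite L2sq_mean lee_fin => hP.
have [Am As] := monic_repoly Pmon; have Bs := size_impoly Pmon.
have Em' : 'E (nrm2 Pr 0) <= 2 * cc by rewrite Em.
have [eA eB] := mean_nrm2_uniq Pm Ps zs Am As Bs Em' hP.
by apply: poly_reim_inj; rewrite ?repoly_map ?impoly_map.
Qed.

(** For uniqueness, any minimiser satisfies [T <= 4 cc] on [K], so [mean_nrm2_bound] makes the mean
    of [T] at most [2 cc], and the uniqueness of the [L2] minimiser applies. *)
Lemma wChebyshev_inverse :
  wChebyshev K (fun x => Num.sqrt q.[x]) n (map_poly (@cR R) Pr) /\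
  (forall P, wChebyshev K (fun x => Num.sqrt q.[x]) n P -> P = map_poly (@cR R) Pr).
Proof.
have [Pm Ps] := inverse_image_monic; have [ac [_ v1]] := inverse_image_cc.
have a0 := inverse_image_lead.
have a20 : 0 < a ^+ 2 by rewrite lt_neqAle eq_sym sqrf_eq0 a0 sqr_ge0.
have Pmon : monic_deg n (map_poly (@cR R) Pr) by exact: monic_map.
have ub : (wsupnorm K (fun x => Num.sqrt q.[x]) (map_poly (@cR R) Pr) <= (2 * Num.sqrt cc)%:E)%E.
  apply: ge_ereal_sup => _ [x Kx <-]; rewrite lee_fin.
  rewrite -(@ler_pXn2r _ 2) ?nnegrE ?mulr_ge0 ?sqrtr_ge0//.
  rewrite !exprMn !sqr_sqrtr ?qK ?(ltW cc_gt0)//; last by rewrite addr_ge0// sqr_ge0.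
  rewrite -/(sqmod _) horner_reim /sqmod/= repoly_map impoly_map -nrm2E.
  have := v1 x Kx; rewrite nrm2_inverse_image hornerZ => h.
  by rewrite -(ler_pM2l a20) (le_trans h)// mulrCA ac expr2; lra.
split; first split => //.
  by move=> Q Qm; apply: le_trans ub _; exact: wsupnorm_ge.
move=> P [Pmon' Pmin]; have [_ [uniqL2 _]] := L2_extremal_inverse.
apply: uniqL2 => //; rewrite L2sq_mean lee_fin.
have [Am As] := monic_repoly Pmon'; have Bs := size_impoly Pmon'.
have TM x : K x -> (nrm2 (repoly P) (impoly P)).[x] <= 4 * cc.
  move=> Kx; have : ((Num.sqrt q.[x] * cmod P.[cR x])%:E <= (2 * Num.sqrt cc)%:E)%E.
    apply: (le_trans _ (le_trans (Pmin _ Pmon) ub)).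
    by apply: ereal_sup_ubound; exists x.
  rewrite lee_fin -(@ler_pXn2r _ 2) ?nnegrE ?mulr_ge0 ?sqrtr_ge0//.
  rewrite !exprMn !sqr_sqrtr ?qK ?(ltW cc_gt0)//; last by rewrite addr_ge0// sqr_ge0.
  by rewrite -/(sqmod _) horner_reim /sqmod/= -nrm2E expr2; lra.
have := mean_nrm2_bound Am As Bs TM; lra.
Qed.

End WithInverseImage.

Lemma inverse_image_of_equality :
  ereal_inf [set L2sq mu (fun x => q.[x]) P | P in monic_deg n] = (2 * cc)%:E ->
  exists S : {poly C}, size S = n.+1 /\ is_inverse_image K q S.
Proof.
move=> infE; have [A [Am As Amin]] := minimizer; have c0 := cc_gt0.
have zs : (size (0%R : {poly R}) <= n)%N by rewrite size_poly0.
have [T1 _ Tc] := nrm2_size Am As zs; set T := nrm2 A 0 in T1 Tc Amin.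
have TE : 'E T = 2 * cc.
  apply/eqP; rewrite eq_le mean_nrm2_ge// andbT -lee_fin -infE.
  apply: le_ereal_inf_tmp => _ [P Pm <-]; rewrite L2sq_mean lee_fin.
  by have [Am' As'] := monic_repoly Pm; exact: Amin.
have T0 x : K x -> 0 <= T.[x] by move=> Kx; exact: nrm2_ge0.
have cE : cc = expR (lncap V T) by rewrite Tc.
have T4 x : K x -> T.[x] <= 4 * cc.
  by rewrite cE; apply: (mean_eq_bound cK K1 muK mup T1 T0); rewrite -cE.
have T04 x : K x -> 0 <= T.[x] <= 4 * expR (lncap V T) by move=> Kx; rewrite T0// -cE T4.
have pre := preimage_sub cK muK mup T1 T04; rewrite -cE in pre.
(* This scaling turns [[0, 4 cc]], the range allowed for [T], into [[0, 1]], since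
   [q (k A)^2 = T / (4 cc)]. *)
pose k := (2 * Num.sqrt cc)^-1.
have sq0 : 0 < Num.sqrt cc by rewrite sqrtr_gt0.
have k0 : k != 0 by rewrite invr_eq0 mulf_neq0// gt_eqF.
have k2 : k ^+ 2 = (4 * cc)^-1.
  by rewrite /k exprVn exprMn sqr_sqrtr ?(ltW c0)// -natrX.
exists (map_poly (@cR R) (k *: A)); split.
  by rewrite (size_map_poly (real_complex R)) size_scale.
move=> z; have vE : (map_poly (@cR R) q).[z] * (map_poly (@cR R) (k *: A)).[z] ^+ 2 =
    cR (k ^+ 2) * (map_poly (@cR R) T).[z].
  rewrite [map_poly _ (k *: A)](map_polyZ (real_complex R)) hornerZ.
  rewrite /T /nrm2 expr0n addr0 [map_poly _ (q * _)](rmorphM (map_poly (real_complex R))).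
  rewrite (rmorphXn (map_poly (real_complex R))) hornerM horner_exp exprMn.
  by rewrite [cR (k ^+ 2)](rmorphXn (real_complex R)) mulrCA.
rewrite /= vE; split=> [[x Kx ->]|].
  rewrite horner_cR /= !mul0r !mulr0 addr0 subr0; split => //.
  have /andP[t0 t4] : 0 <= T.[x] <= 4 * cc by rewrite T0// T4.
  rewrite k2 mulrC divr_ge0 ?mulr_ge0 ?(ltW c0)//= ler_pdivrMr ?mul1r//.
  exact: mulr_gt0.
case TzE : ((map_poly (@cR R) T).[z]) => [u w] /=.
rewrite !mul0r subr0 addr0 => -[w0 u01].
have kk : 0 < k ^+ 2 by rewrite k2 invr_gt0 mulr_gt0.
have {}w0 : w = 0 by move/eqP: w0; rewrite mulf_eq0 gt_eqF//= => /eqP.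
apply: (pre z u); first by rewrite TzE w0.
move: u01; rewrite k2 mulrC => /andP[u0 u1].
rewrite ler_pdivrMr ?mul1r ?mulr_gt0// in u1; rewrite u1 andbT.
by move: u0; rewrite pmulr_lge0// invr_gt0 mulr_gt0.
Qed.

End Extremal.

(** * The equilibrium measure and the Szego function of the weights *)

Section Equilibrium.
Variables (R : realType) (K : set R).
Hypotheses (cK : compact K) (K1 : K `<=` [set x : R | -1 <= x <= 1]).
Hypotheses (Kreg : regular_set K) (K0 : K !=set0).

(** A competitor of finite energy makes the minimal energy a real number, after which all properties
    of the potential become available. *)
Lemma equilibrium_potentialP (muK : {measure set R -> \bar R}) : equilibrium_measure K muK ->
  exists (mu : probability R R) (V : R), [/\ prob_on K mu, equilibrium_potential K mu V,
    robin_const K = V%:E & forall f : R -> \bar R, (\int[muK]_x f x = \int[mu]_x f x)%E].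
Proof.
move=> [muKK muKe]; pose mu : probability R R := as_prob muKK.1.
have muP : prob_on K mu by exact: muKK.
have mumin (p : probability R R) : prob_on K p -> (energy mu mu <= energy p p)%E.
  move=> pK; rewrite -!(log_energyE cK K1)// leeD2r//.
  have -> : log_energy mu = robin_const K by exact: muKe.
  by apply: ereal_inf_lbound; exists p.
have [nu nuK nufin] := exists_finite_energy cK K1 Kreg K0.
have muge : (0 <= energy mu mu)%E by apply: integral_ge0 => x _; exact: potkn_ge0.
have [I muI] : exists I : R, energy mu mu = I%:E.
  exists (fine (energy mu mu)); rewrite fineK// ge0_fin_numE//.
  exact: le_lt_trans (mumin _ nuK) nufin.
exists mu, (robin I); split => //.
  split.
  - exact: (logd_integrable cK K1 muP mumin muI).
  - exact: (equilibrium_null_pt cK K1 muP mumin muI).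
  - exact: (logmean_ge cK K1 muP mumin muI).
  - exact: (logmean_onK cK K1 Kreg muP mumin muI).
  - exact: (logmean_strict cK K1 muP mumin muI).
  - exact: (logmean_taylor cK K1 muP mumin muI).
  - exact: (equilibrium_support cK K1 Kreg muP mumin muI).
have -> : robin_const K = log_energy mu by rewrite -muKe.
have := log_energyE cK K1 muP; rewrite muI; case: (log_energy mu) => [r| |]//=.
by rewrite -EFinD => -[e]; congr EFin; rewrite /robin -e; ring.
Qed.

Variables (mu : probability R R) (V : R).
Hypotheses (muK : prob_on K mu) (mup : equilibrium_potential K mu V).

(** All zeros of [q] lie in [K], so the logarithmic mean of [q] has no surplus:
    [S(mu) = Cap(K)^(deg q)]. *)
Lemma szego_poly (q : {poly R}) : (1 < size q)%N -> `|lead_coef q| = 1 ->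
  (forall x, K x -> 0 <= q.[x]) ->
  (forall z, root (map_poly (@cR R) q) z -> exists2 x, K x & z = cR x) ->
  szego mu (fun x => q.[x]) = (expR (- ((size q).-1%:R * V)))%:E.
Proof.
move=> q1 ql qK qr; have q0 : q != 0 by rewrite -size_poly_gt0 ltnW.
have mlogE : measurable_fun setT (fun x : R => logE q.[x]).
  rewrite /logE; apply: measurable_fun_ifT => //.
    apply: (measurableT_comp (f := fun y : R => y == 0)); last exact: measurable_horner.
    exact: measurable_fun_eqr.
  apply/measurable_EFinP; apply: measurableT_comp; first exact: measurable_ln.
  exact: measurable_horner.
have -> : - ((size q).-1%:R * V) = lnmean K mu q.
  by rewrite (lnmean_onK cK muK mup q0 qr) /lncap ql ln1 sub0r.
rewrite /szego (integral_onK cK muK mlogE).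
rewrite (ae_eq_integral (fun x => (ln `|q.[x]|)%:E))//.
- by rewrite -[(\int[mu]_(x in K) _)%E]fineK//; exact: (integrable_fin_num (mK cK) (Int_lnpoly cK muK mup q0)).
- exact: mK.
- exact: measurable_funTS.
- by apply/measurable_EFinP; apply: measurable_funTS; exact: measurable_lnpoly.
apply: filterS (ae_nonroot mup q0) => x qx Kx.
by rewrite /logE (negbTE qx) ger0_norm// qK.
Qed.

End Equilibrium.

Lemma jacobi_weight (R : realType) (q : {poly R}) :
  (q = 1 - 'X^2 \/ q = 1 + 'X \/ q = 1 - 'X) ->
  [/\ (1 < size q)%N, `|lead_coef q| = 1, forall x, -1 <= x <= 1 -> 0 <= q.[x] &
    forall z, root (map_poly (@cR R) q) z -> z = cR 1 \/ z = cR (-1)].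
Proof.
have s1 : size (1%R : {poly R}) = 1%N by rewrite size_poly1.
have c1 : cR (1 : R) = 1 by [].
have cN1 : cR (-1 : R) = -1 by rewrite /cR -[RHS](rmorphN1 (real_complex R)).
have mapE (p : {poly R}) : map_poly (@cR R) p = map_poly (real_complex R) p by [].
rewrite c1 cN1; case=> [->|[->|->]].
- have E : 1 - 'X^2 = - ('X^2 - 1) :> {poly R} by rewrite opprB.
  have sX : (size (- 1%R : {poly R})%R < size ('X^2 : {poly R}))%N.
    by rewrite size_polyN s1 size_polyXn.
  split.
  + by rewrite E size_polyN size_polyDl// size_polyXn.
  + by rewrite E lead_coefN lead_coefDl// lead_coefXn normrN1.
  + move=> x /andP[x0 x1]; rewrite hornerD hornerN hornerXn hornerC; nra.
  + move=> z; rewrite mapE rmorphB rmorph1 /= map_polyXn /root hornerD hornerN hornerXn hornerC.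
    by rewrite subr_eq0 eq_sym sqrf_eq1 => /orP[/eqP|/eqP]; [left|right].
- have E : 1 + 'X = 'X + 1 :> {poly R} by rewrite addrC.
  have sX : (size (1%R : {poly R})%R < size ('X : {poly R}))%N by rewrite s1 size_polyX.
  split.
  + by rewrite E size_polyDl// size_polyX.
  + by rewrite E lead_coefDl// lead_coefX normr1.
  + by move=> x /andP[x0 x1]; rewrite hornerD hornerX hornerC; lra.
  + move=> z; rewrite mapE rmorphD rmorph1 /= map_polyX /root hornerD hornerX hornerC.
    by rewrite addrC addr_eq0 => /eqP; right.
have E : 1 - 'X = - ('X - 1) :> {poly R} by rewrite opprB.
have sX : (size (- 1%R : {poly R})%R < size ('X : {poly R}))%N by rewrite size_polyN s1 size_polyX.
split.
- by rewrite E size_polyN size_polyDl// size_polyX.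
- by rewrite E lead_coefN lead_coefDl// lead_coefX normrN1.
- by move=> x /andP[x0 x1]; rewrite hornerD hornerN hornerX hornerC; lra.
move=> z; rewrite mapE rmorphB rmorph1 /= map_polyX /root hornerD hornerN hornerX hornerC.
by rewrite subr_eq0 eq_sym => /eqP; left.
Qed.

Theorem theorem4 (R : realType) (K : set R) (muK : {measure set R -> \bar R})
  (n : nat) (q : {poly R}) :
  compact K -> regular_set K ->
  K `<=` [set x : R | -1 <= x <= 1] -> K 1 -> K (-1) ->
  equilibrium_measure K muK -> (0 < n)%N ->
  (q = 1 - 'X^2 \/ q = 1 + 'X \/ q = 1 - 'X) ->
  let f := fun x : R => q.[x] in
  let w := fun x : R => Num.sqrt q.[x] in
  (W2n_sq K muK f n = (2%:E * szego muK f)%E <->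
     exists S : {poly complex R}, size S = n.+1 /\ is_inverse_image K q S)
  /\
  (forall S : {poly complex R},
     W2n_sq K muK f n = (2%:E * szego muK f)%E ->
     size S = n.+1 -> is_inverse_image K q S ->
     let P := (lead_coef S)^-1 *: S in
     [/\ L2_extremal muK f n P,
         (forall P', L2_extremal muK f n P' -> P' = P),
         wChebyshev K w n P &
         (forall T, wChebyshev K w n T -> T = P)]).
Proof.
move=> cK Kreg K1 Kp Kn eqK n0 qE f w.
have K0 : K !=set0 by exists 1.
have [mu [V [muP mup VE muint]]] := equilibrium_potentialP cK K1 Kreg K0 eqK.
have [q1 ql q01 qroots] := jacobi_weight qE.
have qK x : K x -> 0 <= q.[x] by move=> /K1 /q01.
have qr z : root (map_poly (@cR R) q) z -> exists2 x, K x & z = cR x.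
  by move=> /qroots[->|->]; [exists 1|exists (-1)].
have L2E P : L2sq muK f P = L2sq mu f P by rewrite /L2sq muint.
have szE : szego muK f = (expR (- ((size q).-1%:R * V)))%:E.
  have -> : szego muK f = szego mu f by rewrite /szego muint.
  exact: (szego_poly cK muP mup).
have capE : log_cap K = expR (- V) by rewrite /log_cap VE.
have infE : [set L2sq muK f P | P in monic_deg n] = [set L2sq mu f P | P in monic_deg n].
  by apply/seteqP; split => _ [P Pm <-]; exists P.
(* Multiplication by [Cap(K)^(2 n)], which is positive, turns [2 S(mu)] into [2 cc]. *)
have W2E : W2n_sq K muK f n = (2%:E * szego muK f)%E <->
    ereal_inf [set L2sq mu f P | P in monic_deg n] = (2 * cc V q n)%:E.
  rewrite /W2n_sq infE szE capE; set i := ereal_inf _.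
  pose e := expR (- V) ^+ (2 * n).
  have e0 : 0 < e by rewrite exprn_gt0// expR_gt0.
  have ccE : cc V q n = e * expR (- ((size q).-1%:R * V)).
    rewrite /e -expRM_natl -expRD /cc /lncc natrD; congr expR; ring.
  rewrite ccE -/e; split => [h|->]; last first.
    by rewrite -!EFinM; congr EFin; field; rewrite gt_eqF.
  have -> : i = (i * (e^-1)%:E * e%:E)%E.
    by rewrite -muleA -EFinM mulVf ?gt_eqF// mule1.
  by rewrite h -!EFinM; congr EFin; ring.
split.
  rewrite W2E; split; first exact: (inverse_image_of_equality cK K1 muP mup q1 ql qK).
  move=> [S [Ss KS]].
  have [[Pm Pmin] [_ PE]] := L2_extremal_inverse cK K1 muP mup q1 ql qK Ss KS.
  apply/eqP; rewrite eq_le; apply/andP; split.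
    by rewrite -PE; apply: ereal_inf_lbound; eexists; [exact: Pm|].
  exact: (L2_inf_ge cK K1 muP mup n q1 ql qK).
move=> S _ Ss KS P.
have PS : P = map_poly (@cR R) ((lead_coef (repoly S))^-1 *: repoly S).
  exact: (inverse_image_scale cK K1 muP mup q1 qK Ss KS).
have [[Pm Pmin] [Puniq PE]] := L2_extremal_inverse cK K1 muP mup q1 ql qK Ss KS.
have [Cm Cuniq] := wChebyshev_inverse cK K1 muP mup q1 ql qK Ss KS.
rewrite PS; split => //.
- by split => // Q Qm; rewrite !L2E; exact: Pmin.
- by move=> P' [Pm' Pmin']; apply: Puniq => //; rewrite -PE -!L2E; exact: Pmin'.
Qed.
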